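(* Let $k=\overline{\mathbb{F}_2}$. Assume that for every $\alpha\in k\setminus\{0\}$ and all integers $n\ge 1$ and $0\le j<2^n$ one has $$\langle n,j,\alpha\rangle=e_{n+1}\left(g_\alpha^{2j+1}\right)-\tfrac12\left(e_{n+1}\left(g_\alpha^{2j}\right)+e_{n+1}\left(g_\alpha^{2j+2}\right)\right).$$ For each $0\neq\alpha\in k$ let $m_\alpha=[\mathbb{F}_2(\alpha):\mathbb{F}_2]$ and $R_\alpha=k[[x,y,z,u,v]]/(G_\alpha)$, where $G_\alpha=uv+\alpha x^2y^2+z^4+xyz^2+(x^3+y^3)z$. Then for every $0\ne\alpha\in k$ with $m_\alpha\ge 2$, $$e_{HK}(R_\alpha)=\frac{45\cdot 2^{3m_\alpha}-38}{7\cdot 2^{3m_\alpha+2}-28}\qquad\text{and}\qquad s(R_\alpha)=\frac{11\cdot 2^{3m_\alpha}-18}{7\cdot 2^{3m_\alpha+2}-28}.$$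
   Context: Let $k=\overline{\mathbb{F}_2}$; for $\beta\in k$ put $m_\beta=[\mathbb{F}_2(\beta):\mathbb{F}_2]$. For $0\ne\alpha\in k$ let $g_\alpha=\alpha x^2y^2+z^4+xyz^2+(x^3+y^3)z\in k[x,y,z]$. For a polynomial $f\in k[x_1,\dots,x_d]$ and $n\ge 0$, $e_n(f)=\dim_k k[x_1,\dots,x_d]/(x_1^{2^n},\dots,x_d^{2^n},f)$ (so $e_n(1)=0$). Hilbert–Kunz multiplicity and $F$-signature: for a complete local $F$-finite domain $(R,\mathfrak m)$ of characteristic $p>0$, dimension $d$ and perfect residue field, $e_{HK}(R)=\lim_{e\to\infty}\ell_R(R/\mathfrak m^{[p^e]})/p^{ed}$ and $s(R)=\lim_{e\to\infty}\ell_R(R/I_e)/p^{ed}$, where $I_e=\{r\in R: \text{the }R\text{-linear map }R\to R^{1/p^e},\ 1\mapsto r^{1/p^e},\text{ does not split}\}$. Definition of $\langle n,j,\alpha\rangle$: let $0\neq\alpha\in k$, write $\alpha=\lambda^2+\lambda$ with $\lambda\in k$, and put $m=m_\alpha$. Let $P=$ ''even'', $Q=$ ''odd'' if $m_\lambda\ne m_\alpha$, and $P=$ ''odd'', $Q=$ ''even'' if $m_\lambda=m_\alpha$. Let $\Gamma$ be the free abelian group on symbols $A_n,B_n$ ($n\in\mathbb{N}$), $C$, $D$. Define homomorphisms $\sigma_0,\sigma_1:\Gamma\to\Gamma$ by: - $\sigma_0(A_n)=B_{n+1}$ if $m\mid n+1$ and $\frac{n+1}{m}$ has parity $P$; otherwise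 $\sigma_0(A_n)=A_{n+1}$. - $\sigma_1(A_n)=B_{n+1}$ if $m\mid n+1$ and $\frac{n+1}{m}$ has parity $Q$; otherwise $\sigma_1(A_n)=A_{n+1}$. - $\sigma_0(B_n)=0$ if $m\mid n$ and $\frac nm$ has parity $P$; otherwise $\sigma_0(B_n)=A_{n+1}+C$. - $\sigma_1(B_n)=0$ if $m\mid n$ and $\frac nm$ has parity $Q$; otherwise $\sigma_1(B_n)=A_{n+1}+C$. - $\sigma_0(C)=\sigma_1(C)=C$, $\sigma_0(D)=A_1$, $\sigma_1(D)=0$. For $n\ge0$ and $0\le j<2^n$ define $f(n,j)\in\Gamma$ recursively by $f(0,0)=2C+D$, $f(n+1,2j)=\sigma_0(f(n,j))$, $f(n+1,2j+1)=\sigma_1(f(n,j))$. Then $f(n,j)=aA_n+bB_n+cC+dD$ for some integers $a,b,c,d$, and $\langle n,j,\alpha\rangle:=(3a+5b+d)2^c$. *)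

(* Defs.v *)
(* multinomials must be imported before MathComp-Analysis: in the other order *)
(* their notations are incompatible.                                          *)
From HB Require Import structures.
From mathcomp Require Import all_boot all_order all_algebra all_field.
From mathcomp Require Import mpoly freeg.
From mathcomp Require Import boolp classical_sets reals ereal topology.
From mathcomp Require Import normedtype sequences.

Set Implicit Arguments.
Unset Strict Implicit.
Unset Printing Implicit Defensive.

Import Order.TTheory GRing.Theory Num.Theory.

Local Open Scope classical_set_scope.
Local Open Scope ring_scope.

(* The dimension of U / W for subspaces W of U of a vector space, counted by  *)
(* a basis of U modulo W; by convention it is 0 when there is no finite one.  *)
Definition basis_mod (F : fieldType) (V : lmodType F) (U W : set V)
    (d : nat) (b : 'I_d -> V) : Prop :=
  (forall i, U (b i)) /\
  forall v, U v -> exists! c : 'rV[F]_d, W (v - \sum_i c 0 i *: b i).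

Definition dim_quot (F : fieldType) (V : lmodType F) (U W : set V) : nat :=
  xget 0%N [set d | exists b : 'I_d -> V, basis_mod U W b].

Definition is_ideal (A : comNzRingType) (I : set A) : Prop :=
  [/\ I 0, forall x y, I x -> I y -> I (x + y) & forall a x, I x -> I (a * x)].

Definition ideal_gen (A : comNzRingType) (S : set A) : set A :=
  smallest (@is_ideal A) S.

(* [F_2(beta) : F_2], where F_2(beta) is the intersection of the subfields    *)
(* containing beta; pPrimeCharType provides the structure of 'F_2-module.     *)
Definition F2_adjoin (k : fieldType) (beta : k) : set k :=
  [set x | forall S : {pred k}, GRing.divring_closed S -> beta \in S -> x \in S].

Definition m_ (k : fieldType) (char2 : 2%N \in [pchar k]) (beta : k) : nat :=
  @dim_quot 'F_2 (pPrimeCharType char2) (F2_adjoin beta) [set 0].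

Definition e_ (d : nat) (k : fieldType) (n : nat) (f : {mpoly k[d]}) : nat :=
  dim_quot setT
    (ideal_gen (range (fun i : 'I_d => 'X_i ^+ (2 ^ n)) `|` [set f])).

Definition g (k : fieldType) (alpha : k) : {mpoly k[3]} :=
  let x := 'X_(inord 0) in let y := 'X_(inord 1) in let z := 'X_(inord 2) in
  alpha *: (x ^+ 2 * y ^+ 2) + z ^+ 4 + x * y * z ^+ 2 + (x ^+ 3 + y ^+ 3) * z.

Inductive gamma_symbol := GA of nat | GB of nat | GC | GD.

Definition gamma_symbol_code (s : gamma_symbol) : (nat + nat) + bool :=
  match s with
  | GA n => inl (inl n) | GB n => inl (inr n) | GC => inr true | GD => inr false
  end.

Definition gamma_symbol_decode (c : (nat + nat) + bool) : gamma_symbol :=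
  match c with
  | inl (inl n) => GA n | inl (inr n) => GB n
  | inr b => if b then GC else GD
  end.

Lemma gamma_symbol_codeK : cancel gamma_symbol_code gamma_symbol_decode.
Proof. by case. Qed.

HB.instance Definition _ :=
  Countable.copy gamma_symbol (can_type gamma_symbol_codeK).

Definition Gamma := {freeg gamma_symbol / int}.

(* Parities are booleans, true meaning odd: P is true iff m_lambda = m_alpha, *)
(* and Q is its negation.                                                     *)
Definition sigma_symbol (m : nat) (P : bool) (i : bool) (s : gamma_symbol) :
    Gamma :=
  let parity := if i then ~~ P else P in
  match s with
  | GA n => if (m %| n.+1)%N && (odd (n.+1 %/ m) == parity)
            then << GB n.+1 >> else << GA n.+1 >>
  | GB n => if (m %| n)%N && (odd (n %/ m) == parity)
            then 0 else << GA n.+1 >> + << GC >>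
  | GC => << GC >>
  | GD => if i then 0 else << GA 1 >>
  end.

(* The homomorphism sigma_0 (i = false) or sigma_1 (i = true) of Gamma.       *)
Definition sigma (m : nat) (P i : bool) : Gamma -> Gamma :=
  fglift (sigma_symbol m P i).

Fixpoint bracket_elt (m : nat) (P : bool) (n j : nat) : Gamma :=
  if n is n'.+1 then sigma m P (odd j) (bracket_elt m P n' j./2)
  else << GC >> *+ 2 + << GD >>.

(* The choice of the root lambda is immaterial: the other one is lambda + 1,  *)
(* which generates the same field.                                            *)
Definition bracket (k : fieldType) (char2 : 2%N \in [pchar k])
    (n j : nat) (alpha : k) : rat :=
  let lambda := xget 0 [set l : k | alpha = l ^+ 2 + l] in
  let m := m_ char2 alpha in
  let f := bracket_elt m (m_ char2 lambda == m) n j in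
  let a := coeff (GA n) f in let b := coeff (GB n) f in
  let c := coeff GC f in let d := coeff GD f in
  (3 * a + 5 * b + d)%:~R * 2 ^ c.

(* k[[x_1, ..., x_n]]: a power series is the function giving its coefficients *)
Definition fps (n : nat) (R : comNzRingType) : Type := 'X_{1..n} -> R.

Section PowerSeries.
Variables (n : nat) (R : comNzRingType).
Implicit Types (f g h : fps n R) (m : 'X_{1..n}).

HB.instance Definition _ := gen_eqMixin (fps n R).
HB.instance Definition _ := gen_choiceMixin (fps n R).

Definition fps_zero : fps n R := fun=> 0.
Definition fps_opp f : fps n R := fun m => - f m.
Definition fps_add f g : fps n R := fun m => f m + g m.
Definition fps_one : fps n R := fun m => (m == 0%MM)%:R.
Definition fps_mul f g : fps n R := fun m =>
  \sum_(k : 'X_{1..n < (mdeg m).+1, (mdeg m).+1} | m == (k.1 + k.2)%MM)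
     f k.1 * g k.2.

Lemma fps_addA : associative fps_add.
Proof. by move=> f g h; apply/funext => m; apply: addrA. Qed.
Lemma fps_addC : commutative fps_add.
Proof. by move=> f g; apply/funext => m; apply: addrC. Qed.
Lemma fps_add0 : left_id fps_zero fps_add.
Proof. by move=> f; apply/funext => m; apply: add0r. Qed.
Lemma fps_addN : left_inverse fps_zero fps_opp fps_add.
Proof. by move=> f; apply/funext => m; apply: addNr. Qed.

HB.instance Definition _ :=
  GRing.isZmodule.Build (fps n R) fps_addA fps_addC fps_add0 fps_addN.

Definition fps_trunc d f : {mpoly R[n]} := \sum_(a : 'X_{1..n < d}) f a *: 'X_[a].

Lemma fps_truncE d f m : (mdeg m < d)%N -> (fps_trunc d f)@_m = f m.
Proof. exact: mcoeff_mpoly. Qed.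

Lemma mcoeffM_local (p q p' q' : {mpoly R[n]}) m :
  (forall a, (mdeg a <= mdeg m)%N -> p@_a = p'@_a) ->
  (forall a, (mdeg a <= mdeg m)%N -> q@_a = q'@_a) ->
  (p * q)@_m = (p' * q')@_m.
Proof.
move=> hp hq; rewrite !mcoeffM; apply: eq_bigr => -[a b] _ /=.
by rewrite hp ?hq // -ltnS bmdeg.
Qed.

Lemma fps_mulE d f g m : (mdeg m < d)%N ->
  fps_mul f g m = (fps_trunc d f * fps_trunc d g)@_m.
Proof.
move=> md; rewrite mcoeffM; apply: eq_bigr => -[a b] _ /=.
by rewrite !fps_truncE // (leq_trans _ md) // bmdeg.
Qed.

Lemma fps_mulA : associative fps_mul.
Proof.
move=> f g h; apply/funext => m; rewrite !(@fps_mulE (mdeg m).+1) //.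
set T := fps_trunc _.
have hM u v a : (mdeg a <= mdeg m)%N -> (T (fps_mul u v))@_a = (T u * T v)@_a.
  by move=> am; rewrite fps_truncE // (@fps_mulE (mdeg m).+1).
transitivity (T f * (T g * T h))@_m.
  by apply: mcoeffM_local => // a am; rewrite hM.
by rewrite mulrA; apply: mcoeffM_local => // a am; rewrite hM.
Qed.

Lemma fps_mulC : commutative fps_mul.
Proof.
by move=> f g; apply/funext => m; rewrite !(@fps_mulE (mdeg m).+1) // mulrC.
Qed.

Lemma fps_mul1 : left_id fps_one fps_mul.
Proof.
move=> f; apply/funext => m; rewrite (@fps_mulE (mdeg m).+1) //.
rewrite -[RHS](@fps_truncE (mdeg m).+1) // -[in RHS](mul1r (fps_trunc _ f)).
by apply: mcoeffM_local => // a am; rewrite fps_truncE // mcoeff1.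
Qed.

Lemma fps_mulDl : left_distributive fps_mul fps_add.
Proof.
move=> f g h; apply/funext => m; rewrite /fps_add /fps_mul -big_split /=.
by apply: eq_bigr => k _; rewrite mulrDl.
Qed.

Lemma fps_one_neq0 : fps_one != 0.
Proof.
by apply/eqP => /(congr1 (@^~ 0%MM)) /eqP; rewrite /fps_one eqxx oner_eq0.
Qed.

HB.instance Definition _ := GRing.Zmodule_isComNzRing.Build (fps n R)
  fps_mulA fps_mulC fps_mul1 fps_mulDl fps_one_neq0.

Definition fps_of_mpoly (p : {mpoly R[n]}) : fps n R := fun m => p@_m.

Lemma fps_mul_coef0 (f g : fps n R) : (f * g) 0%MM = f 0%MM * g 0%MM.
Proof.
have -> : (f * g) 0%MM = (fps_trunc 1 f * fps_trunc 1 g)@_0%MM.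
  by apply: fps_mulE; rewrite mdeg0.
by rewrite rmorphM /= !fps_truncE ?mdeg0.
Qed.

End PowerSeries.

Lemma fps_pchar (n p : nat) (R : comNzRingType) :
  p \in [pchar R] -> p \in [pchar fps n R].
Proof.
move=> /andP[p_pr /eqP p0]; apply/andP; split => //; apply/eqP/funext => m.
suff H (q : nat) (f : fps n R) : (f *+ q) m = f m *+ q.
  by rewrite H /= -mulr_natr p0 mulr0.
by elim: q => // q IH; rewrite !mulrS -IH.
Qed.

Definition G (k : fieldType) (alpha : k) : {mpoly k[5]} :=
  let x := 'X_(inord 0) in let y := 'X_(inord 1) in let z := 'X_(inord 2) in
  let u := 'X_(inord 3) in let v := 'X_(inord 4) in
  u * v + alpha *: (x ^+ 2 * y ^+ 2) + z ^+ 4 + x * y * z ^+ 2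
    + (x ^+ 3 + y ^+ 3) * z.

Lemma G_coef0 (k : fieldType) (alpha : k) : (G alpha)@_0%MM = 0.
Proof.
have X0 (i : 'I_5) : ('X_i : {mpoly k[5]})@_0%MM = 0.
  by rewrite mcoeffX mnm1_eq0.
have M0 (p q : {mpoly k[5]}) : (p * q)@_0%MM = p@_0%MM * q@_0%MM.
  exact: rmorphM.
rewrite /G !exprS !(mcoeffD, mcoeffZ, M0) !X0.
by rewrite !(mul0r, mulr0, addr0).
Qed.

Definition G_ideal (k : fieldType) (alpha : k) : {pred fps 5 k} :=
  fun s => `[< exists t, s = t * fps_of_mpoly (G alpha) >].

Lemma G_ideal_closed (k : fieldType) (alpha : k) :
  idealr_closed (G_ideal alpha).
Proof.
split; first by apply/asboolP; exists 0; rewrite mul0r.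
  apply/asboolP => -[t /(congr1 (@^~ 0%MM))]; rewrite fps_mul_coef0.
  have -> : (1 : fps 5 k) 0%MM = 1 by rewrite /GRing.one /= /fps_one eqxx.
  by rewrite /fps_of_mpoly G_coef0 mulr0 => /eqP; rewrite oner_eq0.
move=> a u v /asboolP[s ->] /asboolP[t ->]; apply/asboolP.
by exists (a * s + t); rewrite mulrDl mulrA.
Qed.

HB.instance Definition _ (k : fieldType) (alpha : k) :=
  isIdealr.Build (fps 5 k) (G_ideal alpha) (G_ideal_closed alpha).

Definition R_ (k : fieldType) (alpha : k) : comNzRingType :=
  {ideal_quot (G_ideal alpha)}.

Lemma R_pchar (k : fieldType) (alpha : k) :
  2%N \in [pchar k] -> 2%N \in [pchar (R_ alpha)].
Proof.
move=> /(fps_pchar 5) /andP[_ /eqP h]; apply/andP; split => //; apply/eqP.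
by rewrite -(rmorph_nat (\pi_(R_ alpha)%qT)) h rmorph0.
Qed.

Section LocalRings.
Variables (rT : realType) (A : comNzRingType).

(* The maximal ideal of A, A being local.                                     *)
Definition max_ideal : set A := [set x | ~ exists y, x * y = 1].

Definition is_prime_ideal (P : set A) : Prop :=
  [/\ is_ideal P, ~ P 1 & forall x y, P (x * y) -> P x \/ P y].

Definition prime_chain (n : nat) : Prop :=
  exists P : nat -> set A,
    (forall i, (i <= n)%N -> is_prime_ideal (P i)) /\
    (forall i, (i < n)%N -> P i `<` P i.+1).

Definition has_krull_dim (d : nat) : Prop :=
  prime_chain d /\ forall n, prime_chain n -> (n <= d)%N.

(* The length of the A-module A / I, as the supremum of the lengths of the    *)
(* chains of submodules (possibly +oo); these are the J / I for the ideals J  *)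
(* containing I.                                                              *)
Definition ideal_chain (I : set A) (n : nat) : Prop :=
  exists J : nat -> set A,
    (forall i, (i <= n)%N -> is_ideal (J i) /\ I `<=` J i) /\
    (forall i, (i < n)%N -> J i `<` J i.+1).

Definition quot_length (I : set A) : \bar rT :=
  ereal_sup [set (n%:R)%:E | n in ideal_chain I].

Definition frobenius_power (I : set A) (q : nat) : set A :=
  ideal_gen [set x ^+ q | x in I].

(* For A of Krull dimension d: the length of A / I e, divided by p^{ed}, has  *)
(* limit c as e tends to infinity.                                            *)
Definition has_limit_multiplicity (p : nat) (I : nat -> set A) (c : rT) : Prop :=
  exists2 d, has_krull_dim d &
    (fun e => (quot_length (I e) * ((p ^ (e * d))%:R^-1)%:E)%E) @ \oo --> c%:E.

Definition has_eHK (p : nat) (c : rT) : Prop :=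
  has_limit_multiplicity p (fun e => frobenius_power max_ideal (p ^ e)) c.

End LocalRings.

(* R^{1/p^e} for a reduced ring R: x^{1/p^e} is represented by x, so that the *)
(* addition is that of R and a in R acts as multiplication by a^{p^e}.        *)
Definition frobenius_root (A : comNzRingType) (p : nat)
  (charA : p \in [pchar A]) (e : nat) : Type := A.

Section FrobeniusRoot.
Variables (A : comNzRingType) (p : nat) (charA : p \in [pchar A]) (e : nat).

HB.instance Definition _ := GRing.Zmodule.on (frobenius_root charA e).

Definition frobenius_root_scale (a : A) (x : frobenius_root charA e) :
  frobenius_root charA e := (a ^+ (p ^ e) * (x : A) : A).

Fact frobenius_root_scaleA a b x :
  frobenius_root_scale a (frobenius_root_scale b x)
  = frobenius_root_scale (a * b) x.
Proof. by rewrite /frobenius_root_scale mulrA exprMn. Qed.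

Fact frobenius_root_scale1 : left_id 1 frobenius_root_scale.
Proof. by move=> x; rewrite /frobenius_root_scale expr1n mul1r. Qed.

Fact frobenius_root_scaleDr : right_distributive frobenius_root_scale +%R.
Proof. by move=> a x y; apply: mulrDr. Qed.

Fact frobenius_root_scaleDl x :
  {morph frobenius_root_scale^~ x : a b / a + b}.
Proof.
move=> a b; rewrite /frobenius_root_scale exprDn_pchar; first exact: mulrDl.
by rewrite (eq_pnat _ (pcharf_eq charA)) pnatX pnat_id // (pcharf_prime charA).
Qed.

HB.instance Definition _ := GRing.Zmodule_isLmodule.Build A
  (frobenius_root charA e) frobenius_root_scaleA frobenius_root_scale1
  frobenius_root_scaleDr frobenius_root_scaleDl.

Definition root_of (r : A) : frobenius_root charA e := r.

Definition splits (M N : lmodType A) (f : M -> N) : Prop :=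
  exists h : {linear N -> M}, cancel f h.

Definition splitting_ideal : set A :=
  [set r | ~ splits (fun a : A^o => (a : A) *: root_of r)].

End FrobeniusRoot.

Definition has_F_signature (rT : realType) (A : comNzRingType) (p : nat)
    (charA : p \in [pchar A]) (c : rT) : Prop :=
  has_limit_multiplicity p (fun e => splitting_ideal charA e) c.

(* Main.v *)
From HB Require Import structures.
Require Import Defs.
From mathcomp Require Import all_boot all_order all_algebra all_field.
From mathcomp Require Import mpoly freeg.
From mathcomp Require Import boolp classical_sets reals ereal topology.
From mathcomp Require Import normedtype sequences.
From mathcomp Require Import ring lra zify.

(** Let q = 2^n, let m be the maximal ideal of R = k[[x, y, z, u, v]] / (G), where
    G = uv + g, and let E i be the dimension of k[x, y, z] / (x^q, y^q, z^q, g^i),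
    that is e_n (g^i). Both limits come from exact formulas for lengths:

    - length (R / m^[q]) = E q + 2 (E 1 + ... + E (q - 1)): over k[uv], the module
      k[u, v] / (u^q, v^q) is a sum of truncated polynomial modules, one for each
      diagonal of monomials u^a v^b with a - b fixed, and uv + g has the same
      cokernel as g^i on a diagonal of i monomials ([dim_ker_G5]);

    - by Fedder's criterion ([splitting_ideal_piR]) the splitting ideal I_n is
      (m^[q] : G^(q-1)), and G^(q-1) is the sum of the (uv)^i g^(q-1-i), so that on
      a diagonal of i monomials its rank is q^3 - E (q - i) ([dim_img_G5]).

    The two lengths add up to 2 q^4 ([hk_len_img]), whence s = 2 - eHK.

    It remains to sum the E i. Written as a trapezoidal sum over 0, ..., q, the
    first length can be compared at the levels n and n + 1: flatness of the
    Frobenius ([e_sqr]) multiplies the values at even nodes by 8, and by hypothesis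
    the brackets are the differences between the values at odd nodes and the means
    of their neighbours. So the length at level n + 1 is 16 times the one at level
    n plus twice the sum of the brackets ([hk_lenS]). That sum is 6 2^n, plus 2 2^n
    if the degree of alpha divides n ([sum_bracket]): the recursion on symbols is a
    walk on the states A_n and B_n, which carries the weight 2^c. Dividing by q^4
    yields two geometric series, of ratios 1/8 and 1/8^m with m now the degree of
    alpha; their sum is the stated value ([normalised_limit]).

    The normalisation by q^4 requires that R has Krull dimension 4. Kernels of maps
    to a power series ring provide a chain of five primes ([prime_chain_R4]). The
    upper bound is proved for k[[x_1, ..., x_e]] by induction on e: a series in the
    first prime becomes regular in the last variable after a shear, Weierstrass
    division makes the quotient integral over the series in the other variables,
    and in an integral extension comparable primes have distinct traces
    ([prime_chain_bound]). *)

Set Implicit Arguments.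
Unset Strict Implicit.
Unset Printing Implicit Defensive.

Import Order.TTheory GRing.Theory Num.Theory.

Local Open Scope classical_set_scope.
Local Open Scope ring_scope.

(** * Coefficients of power series *)

Section FpsBasics.
Variables (n : nat) (R : comNzRingType).
Implicit Types (f g h : fps n R) (m a : 'X_{1..n}).

Lemma fpsP f g : (forall m, f m = g m) -> f = g.
Proof. by move=> h; apply/funext. Qed.

Lemma fps_coefD f g m : (f + g) m = f m + g m. Proof. by []. Qed.
Lemma fps_coefB f g m : (f - g) m = f m - g m. Proof. by []. Qed.

Lemma fps_coef_sum (I : Type) (r : seq I) (P : pred I) (F : I -> fps n R) m :
  (\sum_(i <- r | P i) F i) m = \sum_(i <- r | P i) F i m.
Proof. by elim/big_rec2: _ => // i x y _ <-. Qed.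

Lemma fps_coefM d f g m : (mdeg m < d)%N ->
  (f * g) m = (fps_trunc d f * fps_trunc d g)@_m.
Proof. exact: fps_mulE. Qed.

Lemma fps_coefX d f (e : nat) m : (mdeg m < d)%N ->
  (f ^+ e) m = (fps_trunc d f ^+ e)@_m.
Proof.
move=> md; elim: e m md => [|e IH] m md; first by rewrite !expr0 mcoeff1.
rewrite !exprS (fps_coefM _ _ md); apply: mcoeffM_local => // a am.
by rewrite fps_truncE ?IH // (leq_ltn_trans am).
Qed.

Fact fps_of_mpoly_is_additive : {morph @fps_of_mpoly n R : p q / p - q}.
Proof. by move=> p q; apply: fpsP => m; rewrite /fps_of_mpoly mcoeffB. Qed.

HB.instance Definition _ :=
  GRing.isZmodMorphism.Build {mpoly R[n]} (fps n R) (@fps_of_mpoly n R)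
    fps_of_mpoly_is_additive.

Fact fps_of_mpoly_is_multiplicative :
  (@fps_of_mpoly n R 1 = 1) * {morph @fps_of_mpoly n R : p q / p * q}.
Proof.
split; first by apply: fpsP => m; rewrite /fps_of_mpoly mcoeff1.
move=> p q; apply: fpsP => m.
rewrite (@fps_coefM (mdeg m).+1) // /fps_of_mpoly.
by apply: mcoeffM_local => a am; rewrite fps_truncE.
Qed.

HB.instance Definition _ :=
  GRing.isMonoidMorphism.Build {mpoly R[n]} (fps n R) (@fps_of_mpoly n R)
    fps_of_mpoly_is_multiplicative.

Lemma fps_of_mpolyE (p : {mpoly R[n]}) m : fps_of_mpoly p m = p@_m.
Proof. by []. Qed.

Lemma mcoeffXM (p : {mpoly R[n]}) a m :
  ('X_[a] * p)@_m = if (a <= m)%MM then p@_(m - a)%MM else 0.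
Proof.
rewrite mulrC; case: ifP => am.
  by rewrite -{1}(submK am) addmC mcoeffMX.
apply: memN_msupp_eq0; rewrite (perm_mem (msuppMX p a)); apply/negP.
by move=> /mapP[b _ mE]; rewrite mE lem_addr in am.
Qed.

Lemma fps_coefXM a f m :
  (fps_of_mpoly 'X_[a] * f) m = if (a <= m)%MM then f (m - a)%MM else 0.
Proof.
rewrite (@fps_coefM (mdeg m).+1) //.
transitivity ('X_[a] * fps_trunc (mdeg m).+1 f)@_m.
  by apply: mcoeffM_local => // b bm; rewrite fps_truncE.
by rewrite mcoeffXM; case: ifP => // _; rewrite fps_truncE // ltnS mdegB.
Qed.

Definition fpsC (c : R) : fps n R := fps_of_mpoly c%:MP.

Lemma fps_coefCM c f m : (fpsC c * f) m = c * f m.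
Proof.
rewrite (@fps_coefM (mdeg m).+1) //.
transitivity (c%:MP * fps_trunc (mdeg m).+1 f)@_m.
  by apply: mcoeffM_local => // b bm; rewrite fps_truncE.
by rewrite mcoeffCM fps_truncE.
Qed.

Lemma fps_coefC c m : fpsC c m = c * (m == 0%MM)%:R.
Proof. by rewrite /fpsC fps_of_mpolyE mcoeffC. Qed.

Lemma fpsC1 : fpsC 1 = 1.
Proof. by rewrite /fpsC mpolyC1 rmorph1. Qed.

Lemma fpsCZ c (p : {mpoly R[n]}) : fps_of_mpoly (c *: p) = fpsC c * fps_of_mpoly p.
Proof. by rewrite -mul_mpolyC rmorphM. Qed.

Lemma fps_coefM_orderS d f g m :
  f 0%MM = 0 -> (forall a, (mdeg a < d)%N -> g a = 0) -> (mdeg m <= d)%N ->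
  (f * g) m = 0.
Proof.
move=> f0 hg md; rewrite -[f * g]/(fps_mul f g) /fps_mul big1 // => -[[a ha] [b hb]] /= /eqP mE.
case: (posnP (mdeg a)) => [/eqP|a0]; first by rewrite mdeg_eq0 => /eqP->; rewrite f0 mul0r.
rewrite hg ?mulr0 //; rewrite mE mdegD in md; lia.
Qed.

End FpsBasics.

(** * Inverses and zero divisors *)

(** A map on power series whose value up to level N + 1 only depends on its
    argument up to level N is contracting, so it has a fixed point; this one
    principle yields inverses (level: total degree) and Weierstrass division
    (level: degree in all variables but one). *)
Lemma fps_contraction_fixpoint (n : nat) (R : comNzRingType)
    (lev : 'X_{1..n} -> nat) (T : fps n R -> fps n R) :
  (forall N (q q' : fps n R), (forall m, (lev m < N)%N -> q m = q' m) ->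
     forall m, (lev m <= N)%N -> T q m = T q' m) ->
  exists q, T q = q.
Proof.
move=> hT; pose q_ N := iter N T 0.
have stable N d m : (lev m < N)%N -> q_ (N + d)%N m = q_ N m.
  elim: N m => // N IH m hm; rewrite addSn /q_ !iterS.
  by apply: (hT N) => // a aN; apply: IH.
exists (fun m => q_ (lev m).+1 m); apply: fpsP => m.
rewrite -[RHS]/(T (q_ (lev m)) m).
by apply: (hT (lev m)) => // a am; rewrite -(subnKC am) stable.
Qed.

Section FpsField.
Variables (n : nat) (k : fieldType).
Implicit Types (f g h : fps n k) (m a : 'X_{1..n}).

(** The inverse is the fixed point of h = c (1 - (f - f_0) h), where c = 1/f_0:
    multiplication by f - f_0 raises the order, so this is a contraction. *)
Lemma fps_unit f : f 0%MM != 0 -> exists h, f * h = 1.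
Proof.
move=> f0; pose c : fps n k := fpsC (f 0%MM)^-1.
have [] := @fps_contraction_fixpoint n k (@mdeg n)
  (fun h => c * (1 - (f - fpsC (f 0%MM)) * h)).
  move=> N q q' hqq' m hm; apply/eqP; rewrite -subr_eq0 -fps_coefB.
  rewrite [X in X m](_ : _ = c * ((f - fpsC (f 0%MM)) * (q' - q))); last by ring.
  apply/eqP; rewrite fps_coefCM (@fps_coefM_orderS _ _ N) ?mulr0 //.
    by rewrite fps_coefB fps_coefC eqxx mulr1 subrr.
  by move=> b bN; rewrite fps_coefB hqq' ?subrr.
move=> h hE; exists h.
have cE : fpsC (f 0%MM) * c = 1.
  by rewrite /c /fpsC -rmorphM /= -mpolyCM divff // -/(fpsC _) fpsC1.
rewrite -[f](subrK (fpsC (f 0%MM))) mulrDl -{2}hE mulrA cE; ring.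
Qed.

Lemma fps_min_supp f : f != 0 -> exists2 m, f m != 0 &
  forall a, f a != 0 -> (m <= a)%O.
Proof.
move=> fn0; suff [m fm] : exists m, f m != 0.
  elim/(well_founded_induction (@ltom_wf n)): m fm => m IH fm.
  have [[a [fa am]]|hN] := pselect (exists a, f a != 0 /\ (a < m)%O).
    exact: IH fa.
  exists m => // a fa; rewrite leNgt; apply/negP => am; apply: hN.
  by exists a.
apply: contrapT => hN; move/eqP: fn0; apply; apply: fpsP => m.
by apply/eqP/negPn/negP => fm; apply: hN; exists m.
Qed.

(** For a monomial order, the product of the least monomials of f and g arises
    in one way only. *)
Lemma fps_mulf_neq0 f g : f != 0 -> g != 0 -> f * g != 0.
Proof.
move=> /fps_min_supp[a fa ha] /fps_min_supp[b gb hb].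
apply/eqP => /(congr1 (@^~ (a + b)%MM)); apply/eqP.
suff -> : (f * g) (a + b)%MM = f a * g b by rewrite mulf_neq0.
rewrite -[f * g]/(fps_mul f g) /fps_mul.
have la : (mdeg a < (mdeg (a + b)%MM).+1)%N by rewrite mdegD; lia.
have lb : (mdeg b < (mdeg (a + b)%MM).+1)%N by rewrite mdegD; lia.
rewrite (bigD1 (BMultinom la, BMultinom lb)) //= big1 ?addr0 //.
move=> [c d] /andP[/eqP /= cdE] /negP cd.
apply/eqP; rewrite mulf_eq0; apply/negPn/negP; rewrite negb_or => /andP[fc gd].
have key (a' b' : 'X_{1..n}) : (a + b = a' + b')%MM -> (a <= a')%O ->
    (b <= b')%O -> a' = a /\ b' = b.
  move=> E; rewrite !le_eqVlt => /orP[/eqP aa|aa] /orP[/eqP bb|bb] //.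
  - by move: E bb; rewrite aa => /addmI ->; rewrite ltxx.
  - by move: E aa; rewrite bb => /addIm ->; rewrite ltxx.
  - by have := ltm_add aa bb; rewrite E ltxx.
have [ca db] := key _ _ cdE (ha _ fc) (hb _ gd).
by apply: cd; apply/eqP; congr (_, _); apply/val_inj.
Qed.

Lemma fps_mulIf f : f != 0 -> injective (fun g => g * f).
Proof.
move=> f0 g h /eqP; rewrite -subr_eq0 -mulrBl => /eqP E.
apply/eqP; rewrite -subr_eq0; apply/negPn/negP => gh.
by move: (fps_mulf_neq0 gh f0); rewrite E eqxx.
Qed.

End FpsField.

(** * The Frobenius on power series *)

Section Frobenius.
Variables (n : nat) (k : closedFieldType) (char2 : 2%N \in [pchar k]) (e : nat).
Local Notation q := (2 ^ e)%N.
Implicit Types (f g h : fps n k) (m a : 'X_{1..n}).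

Lemma q_gt0 : (0 < q)%N. Proof. by rewrite expn_gt0. Qed.

Lemma exprDq (A : comNzRingType) : 2%N \in [pchar A] -> forall x y : A,
  (x + y) ^+ q = x ^+ q + y ^+ q.
Proof.
move=> hA x y; apply: exprDn_pchar.
by rewrite (eq_pnat _ (pcharf_eq hA)) pnatX pnat_id.
Qed.

Lemma oppr2 (A : comNzRingType) : 2%N \in [pchar A] -> forall x : A, - x = x.
Proof. by move=> hA x; rewrite oppr_pchar2. Qed.

(** The inverse of the Frobenius power c -> c^q, which is bijective on an
    algebraically closed field of characteristic 2. *)
Definition root_q (c : k) : k := xget 0 [set b | b ^+ q = c].

Lemma root_qK c : root_q c ^+ q = c.
Proof.
rewrite /root_q; case: xgetP => [x _ //|hN].
have := @solve_monicpoly k q (fun i => if i == 0%N then c else 0) q_gt0.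
move=> [x xE]; case: (hN x); rewrite /= xE.
have := q_gt0; case: q => // p _.
rewrite big_ord_recl /= expr0 mulr1 big1 ?addr0 // => i _.
by rewrite mul0r.
Qed.

Lemma frobq_inj (b c : k) : b ^+ q = c ^+ q -> b = c.
Proof.
move=> bc; apply/eqP; rewrite -subr_eq0.
suff : (b - c) ^+ q == 0 by rewrite expf_eq0 => /andP[].
by rewrite exprDq // oppr2 // bc -[X in _ + X]oppr2 // subrr.
Qed.

Lemma root_qE b : root_q (b ^+ q) = b.
Proof. by apply: frobq_inj; rewrite root_qK. Qed.

Lemma root_q0 : root_q 0 = 0.
Proof. by have := root_qE 0; rewrite expr0n gtn_eqF ?q_gt0. Qed.

Lemma mpoly_pchar : 2%N \in [pchar {mpoly k[n]}].
Proof.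
move: char2 => /andP[_ /eqP h]; apply/andP; split => //.
by rewrite -mpolyC_nat h mpolyC0.
Qed.

(** Frobenius acts on a series coefficientwise, and spreads the exponents
    over the multiples of q. *)
Lemma fps_coef_frob f m : (f ^+ q) m =
  if [forall i, (q %| m i)%N] then f [multinom (m i %/ q)%N | i < n] ^+ q else 0.
Proof.
set d := (mdeg m).+1.
rewrite (@fps_coefX _ _ d) // /fps_trunc.
have -> : (\sum_(a : 'X_{1..n < d}) f a *: 'X_[a]) ^+ q =
   \sum_(a : 'X_{1..n < d}) f a ^+ q *: 'X_[a *+ q] :> {mpoly k[n]}.
  elim/big_rec2: _ => [|a x y _ <-].
    by rewrite expr0n gtn_eqF ?q_gt0.
  by rewrite (exprDq mpoly_pchar) exprZn mpolyXn.
rewrite raddf_sum /=; under eq_bigr do rewrite mcoeffZ mcoeffX.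
case: ifP => [/forallP hq|/negP hN].
  set m' := [multinom _ | i < n].
  have m'E : (m' *+ q)%MM = m.
    by apply/mnmP => i; rewrite mulmnE mnmE divnK.
  have m'd : (mdeg m' < d)%N.
    by rewrite /d -m'E mdegMn ltnS leq_pmulr ?q_gt0.
  rewrite (bigD1 (BMultinom m'd)) //= m'E eqxx mulr1 big1 ?addr0 // => a am.
  suff /negPf-> : (a *+ q)%MM != m by rewrite mulr0.
  apply: contra am => /eqP aE; apply/eqP/val_inj => /=.
  apply/mnmP => i; rewrite mnmE -aE mulmnE mulnK ?q_gt0 //.
rewrite big1 // => a _; suff /negPf-> : (a *+ q)%MM != m by rewrite mulr0.
apply/negP => /eqP aE; apply: hN; apply/forallP => i.
by rewrite -aE mulmnE dvdn_mull.
Qed.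

Definition box := {ffun 'I_n -> 'I_q}.
Definition mnm_of_box (b : box) : 'X_{1..n} := [multinom (b i : nat) | i < n].

(** The coordinate of f on the monomial X^b in the basis of the q-bounded
    monomials of the power series ring over its subring of q-th powers. *)
Definition pi_ (b : box) f : fps n k :=
  fun m => root_q (f (m *+ q + mnm_of_box b)%MM).

Lemma mnm_box_eq (b : box) m : exists m' c, m = (m' *+ q + mnm_of_box c)%MM.
Proof.
exists [multinom (m i %/ q)%N | i < n].
exists [ffun i => Ordinal (ltn_pmod (m i) q_gt0)].
by apply/mnmP => i; rewrite mnmDE mulmnE !mnmE ffunE /= -divn_eq.
Qed.

Lemma mnm_divE (m : 'X_{1..n}) :
  [multinom ((m *+ q)%MM i %/ q)%N | i < n] = m.
Proof. by apply/mnmP => i; rewrite mnmE mulmnE mulnK ?q_gt0. Qed.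

Lemma coef_pi_sum (h : box -> fps n k) b m :
  (\sum_c h c ^+ q * fps_of_mpoly 'X_[mnm_of_box c]) (m *+ q + mnm_of_box b)%MM
  = h b m ^+ q.
Proof.
rewrite fps_coef_sum (bigD1 b) //= mulrC fps_coefXM lem_addl addmK.
rewrite fps_coef_frob ifT; last first.
  by apply/forallP => i; rewrite mulmnE dvdn_mull.
rewrite mnm_divE big1 ?addr0 // => c cb.
rewrite mulrC fps_coefXM; case: ifP => // /mnm_lepP le_c.
rewrite fps_coef_frob ifF //; apply/negP => /forallP hdvd.
move/eqP: cb; apply; apply/ffunP => i; apply/val_inj => /=.
have := hdvd i; rewrite mnmBE mnmDE mulmnE /mnm_of_box !mnmE.
have := le_c i; rewrite mnmDE mulmnE /mnm_of_box !mnmE.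
move=> le1 hd.
have : (m i * q + b i = c i %[mod q])%N by apply/eqP; rewrite eqn_mod_dvd.
by rewrite modnMDl !modn_small.
Qed.

(** With [pi_sum], the freeness of the power series ring over its q-th powers:
    the bounded monomials are a basis, and taking q-th roots of coordinates
    turns linearity over the q-th powers into [pi_frobM]. *)
Lemma pi_decomp f : f = \sum_c pi_ c f ^+ q * fps_of_mpoly 'X_[mnm_of_box c].
Proof.
apply: fpsP => m; have [] := mnm_box_eq [ffun=> Ordinal q_gt0] m.
by move=> m' [c ->]; rewrite coef_pi_sum /pi_ root_qK.
Qed.

Lemma pi_sum (h : box -> fps n k) b :
  pi_ b (\sum_c h c ^+ q * fps_of_mpoly 'X_[mnm_of_box c]) = h b.
Proof. by apply: fpsP => m; rewrite /pi_ coef_pi_sum root_qE. Qed.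

Lemma pi_frobM b (a : fps n k) f : pi_ b (a ^+ q * f) = a * pi_ b f.
Proof.
rewrite {1}(pi_decomp f) mulr_sumr.
under eq_bigr do rewrite mulrA -exprMn.
by rewrite pi_sum.
Qed.

Lemma fps_pchar2 : 2%N \in [pchar fps n k].
Proof. exact: fps_pchar. Qed.

Lemma pi_D b f g : pi_ b (f + g) = pi_ b f + pi_ b g.
Proof.
rewrite {1}(pi_decomp f) {1}(pi_decomp g) -big_split /=.
under eq_bigr do rewrite -mulrDl -(exprDq fps_pchar2).
by rewrite pi_sum.
Qed.

End Frobenius.

(** * The ideal of the q-th powers of the variables *)

(** The ideal generated by the q-th powers of the variables, described by
    coefficients: a series without any monomial of the box [0, q)^n. *)
Definition Jq (n : nat) (k : fieldType) (q : nat) (f : fps n k) : Prop :=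
  forall m : 'X_{1..n}, (forall i, m i < q)%N -> f m = 0.

Section Jq.
Variables (n : nat) (k : fieldType) (q : nat).
Implicit Types (f g h a : fps n k).

Lemma JqD f g : Jq q f -> Jq q g -> Jq q (f + g).
Proof. by move=> hf hg m hm; rewrite fps_coefD hf ?hg ?addr0. Qed.

Lemma JqM a f : Jq q f -> Jq q (a * f).
Proof.
move=> hf m hm; rewrite -[a * f]/(fps_mul a f) /fps_mul big1 // => -[b c] /= /eqP mE.
rewrite hf ?mulr0 // => i; apply: leq_ltn_trans (hm i).
by move/mnmP: mE => ->; rewrite mnmDE leq_addl.
Qed.

Lemma JqN f : Jq q f -> Jq q (- f).
Proof. by move=> hf; rewrite -mulN1r; apply: JqM. Qed.

Lemma Jq_sum (I : Type) (r : seq I) (P : pred I) (F : I -> fps n k) :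
  (forall i, P i -> Jq q (F i)) -> Jq q (\sum_(i <- r | P i) F i).
Proof. by move=> hF; elim/big_rec: _ => // i x /hF; apply: JqD. Qed.

(** A monomial of degree at least n q has an exponent at least q. *)
Lemma Jq_order f : (0 < q)%N -> (forall m, (mdeg m < n * q)%N -> f m = 0) ->
  (0 < n)%N -> Jq q f.
Proof.
move=> q0 hf n0 m hm; apply: hf; rewrite mdegE.
apply: (@leq_ltn_trans (\sum_(i < n) q.-1)).
  by apply: leq_sum => i _; rewrite -ltnS prednK.
by rewrite sum_nat_const card_ord ltn_pmul2l // ltn_predL.
Qed.

End Jq.

Section JqFrobenius.
Variables (n : nat) (k : closedFieldType) (char2 : 2%N \in [pchar k]).
Implicit Types (f g h a : fps n k).

Lemma Jq_frob e f : f 0%MM = 0 -> Jq (2 ^ e) (f ^+ (2 ^ e)).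
Proof.
move=> f0 m hm; rewrite (fps_coef_frob char2).
case: ifP => // /forallP hd; rewrite [X in f X](_ : _ = 0%MM) ?f0.
  by rewrite expr0n gtn_eqF ?q_gt0.
by apply/mnmP => i; rewrite mnmE mnm0E divn_small.
Qed.

Lemma Jq_pi0 e f (b : box n e) : Jq (2 ^ e) f -> (pi_ b f : fps n k) 0%MM = 0.
Proof.
move=> hf; rewrite /pi_ hf ?root_q0 // => i.
by rewrite mnmDE mulmnE mnm0E mul0n mnmE ltn_ord.
Qed.

(** With [Jq_pi0]: as Jq is generated by the q-th powers of the non-units, it
    is cut out by the constant terms of the coordinates. *)
Lemma pi0_Jq e f : (forall b : box n e, pi_ b f 0%MM = 0) -> Jq (2 ^ e) f.
Proof.
move=> hf; rewrite (pi_decomp char2 e f); apply: Jq_sum => b _.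
by rewrite mulrC; apply/JqM/Jq_frob.
Qed.

Lemma Jq_frobS d e f : Jq (2 ^ e) f -> Jq (2 ^ (d + e)) (f ^+ (2 ^ d)).
Proof.
move=> hf m hm; rewrite (fps_coef_frob char2); case: ifP => // /forallP hd.
rewrite hf ?expr0n ?gtn_eqF ?q_gt0 // => i.
by rewrite mnmE ltn_divLR ?q_gt0 // mulnC -expnD.
Qed.

Lemma Jq_piS d e f (b : box n d) : Jq (2 ^ (d + e)) f -> Jq (2 ^ e) (pi_ b f).
Proof.
move=> hf m hm; rewrite /pi_ hf ?root_q0 // => i.
have bi := ltn_ord (b i); rewrite mnmDE mulmnE mnmE.
have : (m i * 2 ^ d + 2 ^ d <= 2 ^ (d + e))%N.
  by rewrite addnC -mulSn mulnC expnD leq_mul2l hm orbT.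
lia.
Qed.

End JqFrobenius.

(** * Dimension counts *)

Section SemilinearDimension.
Variable (k : fieldType).

Lemma linear_lfun (V W : vectType k) (f : V -> W) :
  linear f -> exists F : 'Hom(V, W), forall v, F v = f v.
Proof.
move=> fL; pose L : {linear V -> W} :=
  HB.pack f (GRing.isLinear.Build k V W *:%R f fL).
by exists (linfun L) => v; rewrite lfunE.
Qed.

(** Indexing a basis by a finite type, here and below, avoids choosing an
    order on pairs of indices. *)
Lemma dim_unique_coords (V : vectType k) (K : finType) (v : K -> V)
    (U : {vspace V}) :
  (forall c : K -> k, \sum_i c i *: v i \in U) ->
  (forall u, u \in U -> exists c : K -> k, u = \sum_i c i *: v i) ->
  (forall c : K -> k, \sum_i c i *: v i = 0 -> forall i, c i = 0) ->
  \dim U = #|K|.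
Proof.
move=> vU Uv v0; pose f (c : 'rV[k]_#|K|) := \sum_i c 0 (enum_rank i) *: v i.
have fL : linear f.
  move=> a x y; rewrite /f scaler_sumr -big_split /=; apply: eq_bigr => i _.
  by rewrite !mxE scalerDl scalerA.
have [F FE] := linear_lfun fL.
have kerF : (fullv :&: lker F)%VS = 0%VS.
  apply/eqP; rewrite capfv -subv0; apply/subvP => c; rewrite memv_ker FE => /eqP c0.
  rewrite memv0; apply/eqP/rowP => i; rewrite mxE -[i]enum_valK.
  exact: (v0 (fun j => c 0 (enum_rank j)) c0).
have := limg_ker_dim F fullv; rewrite kerF dimv0 add0n dimvf dim_matrix mul1r => <-.
congr (\dim _); apply/vspaceP => u; apply/idP/idP => [/Uv[c ->]|].
  have -> : \sum_i c i *: v i = F (\row_j c (enum_val j)).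
    by rewrite FE; apply: eq_bigr => i _; rewrite mxE enum_rankK.
  exact/memv_img/memvf.
by move=> /memv_imgP[c _ ->]; rewrite FE; apply: (vU (fun i => c 0 (enum_rank i))).
Qed.

(** The dimension of a product, transported by a parametrisation which is
    only assumed semilinear: with the identity of k this is additivity of
    dimension, with the Frobenius it compares a space with its twist. *)
Lemma dim_semilinear_param (V V' : vectType k) (E : finType)
    (theta : {rmorphism k -> k}) (U : E -> {vspace V}) (U' : {vspace V'})
    (Psi : {ffun E -> V} -> V') :
  (forall c, exists b, theta b = c) ->
  (forall x y, Psi (x + y) = Psi x + Psi y) ->
  (forall c x, Psi (c *: x) = theta c *: Psi x) ->
  (forall x : {ffun E -> V}, (forall e, x e \in U e) -> Psi x = 0 -> x = 0) ->
  (forall x : {ffun E -> V}, (forall e, x e \in U e) -> Psi x \in U') ->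
  (forall u, u \in U' -> exists2 x : {ffun E -> V}, (forall e, x e \in U e) & Psi x = u) ->
  \dim U' = (\sum_e \dim (U e))%N.
Proof.
move=> thS PsiD PsiZ Psi0 PsiU UPsi.
pose K := {e : E & 'I_(\dim (U e))}.
have -> : (\sum_e \dim (U e))%N = #|{: K}|.
  rewrite card_tagged sumnE big_map big_enum /=.
  by apply: eq_bigr => e _; rewrite card_ord.
pose del (p : K) : {ffun E -> V} :=
  [ffun e => if e == tag p then (vbasis (U (tag p)))`_(tagged p) else 0].
have bU e (i : 'I_(\dim (U e))) : (vbasis (U e))`_i \in U e.
  by apply/vbasis_mem/mem_nth; rewrite size_tuple.
have sumE (c : K -> k) e : (\sum_p c p *: del p) e =
    \sum_(i < \dim (U e)) c (Tagged (fun e => 'I_(\dim (U e))) i) *: (vbasis (U e))`_i.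
  rewrite sum_ffunE.
  rewrite (eq_bigr (fun p : K => (fun e' (i : 'I_(\dim (U e'))) =>
     if e == e' then c (Tagged (fun e => 'I_(\dim (U e))) i) *: (vbasis (U e'))`_i
     else 0) (tag p) (tagged p))); last first.
    by move=> [e' i] _; rewrite !ffunE /=; case: ifP; rewrite ?scaler0.
  rewrite -(@sig_big_dep _ _ _ E (fun e' => 'I_(\dim (U e'))) xpredT (fun _ => xpredT)
    (fun e' i => if e == e' then c (Tagged (fun e => 'I_(\dim (U e))) i) *:
      (vbasis (U e'))`_i else 0)) /=.
  rewrite (bigD1 e) //= [X in _ + X]big1 ?addr0; last first.
    by move=> e' /negPf ee'; rewrite big1 // => i _; rewrite eq_sym ee'.
  by apply: eq_bigr => i _; rewrite eqxx.
have inU (c : K -> k) e : (\sum_p c p *: del p) e \in U e.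
  by rewrite sumE; apply: memv_suml => i _; apply/memvZ/bU.
have PsiS (c : K -> k) : Psi (\sum_p c p *: del p) = \sum_p theta (c p) *: Psi (del p).
  have P0 : Psi 0 = 0 by have := PsiZ 0 0; rewrite scale0r rmorph0 scale0r.
  rewrite (big_morph Psi (id1 := 0) (op1 := +%R)) //.
  by apply: eq_bigr => p _; rewrite PsiZ.
have thI c : exists b : K -> k, c = theta \o b.
  exists (fun p => xget 0 [set b | theta b = c p]); apply/funext => p /=.
  by case: xgetP => [x _ <- //|hN]; have [b hb] := thS (c p); case: (hN b).
apply: (@dim_unique_coords V' K (Psi \o del) U').
- move=> c; have [b ->] := thI c; rewrite -[X in X \in _]PsiS; exact/PsiU/inU.
- move=> u /UPsi[x xU <-].
  exists (fun p => theta (coord (vbasis (U (tag p))) (tagged p) (x (tag p)))).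
  rewrite -[RHS]PsiS; congr Psi; apply/ffunP => e.
  by rewrite sumE {1}(coord_vbasis (xU e)).
- move=> c; have [b ->] := thI c; rewrite -[X in X = 0]PsiS => /Psi0 h [e i] /=.
  have /(congr1 (fun x : {ffun E -> V} => x e)) := h (inU b).
  rewrite sumE ffunE => he.
  have /freeP fr := basis_free (vbasisP (U e)).
  by rewrite (fr (fun i => b (Tagged (fun e => 'I_(\dim (U e))) i)) he) rmorph0.
Qed.

(** A basis modulo I maps to a basis of a complement of U, and every basis of a
    complement lifts to a basis modulo I. *)
Lemma dim_quotE (V : lmodType k) (W : vectType k) (tau : V -> W)
    (U : {vspace W}) (I : set V) :
  linear tau -> (forall w, exists v, tau v = w) -> (forall v, I v <-> tau v \in U) ->
  dim_quot setT I = (\dim {:W} - \dim U)%N.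
Proof.
move=> tauL tauS IU.
have [T TE] : exists T : {linear V -> W}, forall v, tau v = T v.
  pose T : {linear V -> W} := HB.pack tau (GRing.isLinear.Build k V W *:%R tau tauL).
  by exists T.
have hd d (b : 'I_d -> V) : basis_mod setT I b -> d = (\dim {:W} - \dim U)%N.
  move=> [_ hb].
  have TS (c : 'I_d -> k) : T (\sum_i c i *: b i) = \sum_i c i *: T (b i).
    by rewrite linear_sum; apply: eq_bigr => i _; rewrite linearZ.
  have cU (c c' : 'I_d -> k) : (\sum_i c i *: tau (b i) - \sum_i c' i *: tau (b i)) \in U -> c = c'.
    under eq_bigr do rewrite TE; under [X in _ - X]eq_bigr do rewrite TE.
    move=> h; pose v := \sum_i c i *: b i.
    have [c0 [_ uq]] := hb v Logic.I.
    have e1 : c0 = \row_i c i.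
      apply: uq; apply/IU; rewrite (_ : _ - _ = 0) ?TE ?linear0 ?mem0v //.
      by apply/eqP; rewrite subr_eq0; apply/eqP/eq_bigr => i _; rewrite mxE.
    have e2 : c0 = \row_i c' i.
      apply: uq; apply/IU; rewrite TE linearB /= TS TS.
      by rewrite [X in _ - X](eq_bigr (fun i => c' i *: T (b i))) // => i _; rewrite mxE.
    by apply/funext => i; have /rowP/(_ i) := e1; rewrite e2 !mxE.
  pose S := (\sum_(i < d) <[tau (b i)]>)%VS.
  have dimS : \dim S = d.
    rewrite -[RHS]card_ord; apply: (@dim_unique_coords W _ (tau \o b)).
    - by move=> c; apply: memv_sumr => i _; apply: memvZ; apply: memv_line.
    - move=> u /memv_sumP[f fi ->].
      have : forall i, exists a, f i = a *: tau (b i).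
        by move=> i; have /vlineP[a ->] := fi i isT; exists a.
      by move=> /choice[a aE]; exists a; apply: eq_bigr => i _; rewrite aE.
    - move=> c c0 i; have := cU c (fun=> 0); rewrite /= in c0; rewrite c0 big1; last first.
        by move=> j _; rewrite scale0r.
      by rewrite subr0 mem0v => /(_ isT) ->.
  have capUS : (U :&: S = 0)%VS.
    apply/eqP; rewrite -subv0; apply/subvP => u; rewrite memv_cap => /andP[uU /memv_sumP[f fi uE]].
    have : forall i, exists a, f i = a *: tau (b i).
      by move=> i; have /vlineP[a ->] := fi i isT; exists a.
    move=> /choice[a aE]; rewrite uE in uU *.
    have := cU a (fun=> 0); rewrite [X in _ - X]big1 ?subr0; last by move=> j _; rewrite scale0r.
    rewrite -(eq_bigr _ (fun i _ => aE i)) => /(_ uU) a0.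
    by rewrite big1 ?mem0v // => i _; rewrite aE a0 scale0r.
  have US : (U + S = fullv)%VS.
    apply/vspaceP => w; rewrite memvf; have [v <-] := tauS w.
    have [c [/IU cU' _]] := hb v Logic.I.
    rewrite -[v](subrK (\sum_i c 0 i *: b i)) TE linearD /=.
    apply: memv_add; first by rewrite -TE.
    rewrite (TS (c 0)) /S; apply: memv_sumr => i _.
    by rewrite TE; apply: memvZ; apply: memv_line.
  by rewrite -US dimv_disjoint_sum // dimS addKn.
rewrite /dim_quot; case: xgetP => [d _ [b /hd] //|hN].
set d := (_ - _)%N in hN *.
have dC : d = \dim (U^C)%VS.
  by rewrite /d -(addv_complf U) dimv_disjoint_sum ?capv_compl // addKn.
have : forall i : 'I_d, exists v, tau v = (vbasis (U^C)%VS)`_i by move=> i; apply: tauS.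
move=> /choice[b bE]; case: (hN d); exists b; split=> // v _.
have /memv_addP[u uU [w wC vE]] : tau v \in (U + U^C)%VS by rewrite addv_complf memvf.
rewrite dC in b bE *.
pose c0 : 'rV[k]_(\dim (U^C)%VS) := \row_i coord (vbasis (U^C)%VS) i w.
have sumE (c : 'rV[k]_(\dim (U^C)%VS)) :
    tau (v - \sum_i c 0 i *: b i) = u + (w - \sum_i c 0 i *: (vbasis (U^C)%VS)`_i).
  rewrite TE linearB linear_sum /= -TE vE -addrA; congr (_ + (_ - _)).
  by apply: eq_bigr => i _; rewrite linearZ /= -TE bE.
exists c0; split.
  apply/IU; rewrite sumE {1}(coord_vbasis wC) [X in _ + X](_ : _ = 0) ?addr0 //.
  by apply/eqP; rewrite subr_eq0; apply/eqP/eq_bigr => i _; rewrite mxE.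
move=> c /IU; rewrite sumE rpredDl // => hU.
have hC : w - \sum_i c 0 i *: (vbasis (U^C)%VS)`_i \in (U^C)%VS.
  apply: rpredB => //; apply: rpred_sum => i _; apply/memvZ/vbasis_mem/mem_nth.
  by rewrite size_tuple.
have : w - \sum_i c 0 i *: (vbasis (U^C)%VS)`_i \in (U :&: U^C)%VS.
  by rewrite memv_cap hU.
rewrite capv_compl memv0 subr_eq0 => /eqP wE.
apply/rowP => i; rewrite mxE wE linear_sum /=.
rewrite (bigD1 i) //= linearZ /= coord_free ?(basis_free (vbasisP _)) // eqxx mulr1.
rewrite big1 ?addr0 // => j ji; rewrite linearZ /= coord_free ?(basis_free (vbasisP _)) //.
by rewrite (negPf ji) mulr0.
Qed.

End SemilinearDimension.

(** Coordinates along the diagonals (a, b), (a - 1, b - 1), ... : this is the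
    shape taken by modules over k[u, v] / (u^q, v^q) decomposed over k[uv]. *)
Section Tower.
Variables (k : fieldType) (V : vectType k) (Q : nat) (P : nat -> 'End(V)).
Hypothesis P0 : forall v, P 0%N v = v.
Hypothesis PD : forall i j v, P (i + j)%N v = P i (P j v).

Definition grid := {ffun 'I_Q.+1 * 'I_Q.+1 -> V}.
Definition at_ (w : grid) (a b : nat) : V := w (inord a, inord b).

(** An element of K is determined by its values on the edge max(a, b) = Q, as
    P_i maps the value at the end of a diagonal to the one i steps before; the
    corner (Q, Q) lies once on the edge, the other minima twice. *)
Lemma dim_tower (K : {vspace grid}) (U : nat -> {vspace V}) :
  (forall w, w \in K <->
     (forall a b, (a < Q)%N -> (b < Q)%N -> P 1 (at_ w a.+1 b.+1) = at_ w a b) /\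
     (forall s, (s <= Q)%N -> at_ w Q s \in U s /\ at_ w s Q \in U s)) ->
  \dim K = (\dim (U Q) + 2 * \sum_(s < Q) \dim (U s))%N.
Proof.
move=> hK.
pose UU (e : 'I_Q.+1 * 'I_Q.+1) : {vspace V} :=
  if maxn e.1 e.2 == Q then U (minn e.1 e.2) else 0%VS.
pose Psi (x : {ffun 'I_Q.+1 * 'I_Q.+1 -> V}) : grid := [ffun e : 'I_Q.+1 * 'I_Q.+1 =>
  let i := (Q - maxn e.1 e.2)%N in P i (at_ x (e.1 + i) (e.2 + i))].
have PsiE x a b : (a <= Q)%N -> (b <= Q)%N -> at_ (Psi x) a b =
    P (Q - maxn a b)%N (at_ x (a + (Q - maxn a b)) (b + (Q - maxn a b))).
  by move=> aQ bQ; rewrite /at_ ffunE /= !inordK.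
have Psitop x a b : (a <= Q)%N -> (b <= Q)%N -> maxn a b = Q -> at_ (Psi x) a b = at_ x a b.
  by move=> aQ bQ ab; rewrite PsiE // ab subnn P0 !addn0.
have UUE (x : grid) : (forall e, x e \in UU e) -> forall a b, (a <= Q)%N -> (b <= Q)%N ->
    at_ x a b \in if maxn a b == Q then U (minn a b) else 0%VS.
  by move=> hx a b aQ bQ; have := hx (inord a, inord b); rewrite /UU /= !inordK.
have -> : (\dim (U Q) + 2 * \sum_(s < Q) \dim (U s))%N = (\sum_e \dim (UU e))%N.
  rewrite -(pair_bigA _ (fun a b => \dim (UU (a, b)))) /= [RHS]big_ord_recr /=.
  rewrite [X in _ = (_ + X)%N]big_ord_recr /= /UU /= maxnn eqxx minnn.
  rewrite [X in (_ = X + _)%N](_ : _ = \sum_(s < Q) \dim (U s))%N; last first.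
    apply: eq_bigr => a _; rewrite big_ord_recr /= big1 => [|b _].
      by rewrite add0n (maxn_idPr _) ?eqxx ?(minn_idPl _) // ltnW.
    rewrite ifF ?dimv0 //; apply/negbTE; rewrite neq_ltn gtn_max.
    by rewrite !ltn_ord.
  rewrite [X in (_ = _ + (X + _))%N](_ : _ = \sum_(s < Q) \dim (U s))%N; last first.
    by apply: eq_bigr => a _; rewrite (maxn_idPl _) ?eqxx ?(minn_idPr _) // ltnW.
  by rewrite [RHS]addnA [RHS]addnC mul2n -addnn.
apply: (@dim_semilinear_param k V grid _ idfun UU K Psi).
- by move=> c; exists c.
- by move=> x y; apply/ffunP => e; rewrite !ffunE /at_ ffunE linearD.
- by move=> c x; apply/ffunP => e; rewrite !ffunE /at_ ffunE linearZ.
- move=> x hx /ffunP hP; apply/ffunP => -[a b].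
  have := hx (a, b); rewrite /UU /=; case: ifP => [/eqP ab _|_].
    have := Psitop x a b (leq_ord a) (leq_ord b) ab.
    by rewrite /at_ !inord_val hP.
  by rewrite memv0 ffunE => /eqP.
- move=> x hx; apply/hK; split=> [a b aQ bQ|s sQ].
    rewrite !PsiE ?(ltnW aQ) ?(ltnW bQ) // -PD maxnSS.
    have mQ : (maxn a b < Q)%N by rewrite gtn_max aQ.
    have -> : (1 + (Q - (maxn a b).+1) = Q - maxn a b)%N by lia.
    by congr (P _ (at_ x _ _)); lia.
  rewrite !Psitop ?(maxn_idPl sQ) ?(maxn_idPr sQ) //.
  have := UUE x hx Q s (leqnn _) sQ; have := UUE x hx s Q sQ (leqnn _).
  by rewrite (maxn_idPl sQ) (maxn_idPr sQ) (minn_idPr sQ) (minn_idPl sQ) eqxx.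
- move=> u /hK[uP uU].
  have uPi i a b : (a + i <= Q)%N -> (b + i <= Q)%N -> P i (at_ u (a + i) (b + i)) = at_ u a b.
    elim: i a b => [|i IH] a b ai bi; first by rewrite P0 !addn0.
    by rewrite !addnS -addn1 PD uP ?IH; rewrite // -?addnS; lia.
  exists [ffun e : 'I_Q.+1 * 'I_Q.+1 => if maxn e.1 e.2 == Q then u e else 0].
    move=> [a b]; rewrite ffunE /UU /=; case: ifP => [/eqP ab|_]; last by rewrite mem0v.
    have [aQ bQ] := (leq_ord a, leq_ord b).
    case: (leqP a b) => hab.
      rewrite (maxn_idPr hab) in ab.
      have [_] := uU a aQ; rewrite /at_ inord_val.
      by have -> : inord Q = b; first by apply/val_inj; rewrite /= inordK.
    rewrite (maxn_idPl (ltnW hab)) in ab.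
    have [+ _] := uU b bQ; rewrite /at_ inord_val.
    by have -> : inord Q = a; first by apply/val_inj; rewrite /= inordK.
  apply/ffunP => -[a b]; rewrite ffunE /=.
  have [aQ bQ] := (leq_ord a, leq_ord b).
  have mQ : (maxn a b <= Q)%N by rewrite geq_max aQ.
  rewrite /at_ ffunE /= !inordK ?ltnS; try lia.
  rewrite ifT; last by apply/eqP; lia.
  by rewrite -/(at_ u _ _) uPi; [rewrite /at_ !inord_val|lia|lia].
Qed.

End Tower.

(** * Truncation to the box and the functions e_n *)

Section BoxModel.
Variables (n : nat) (k : fieldType) (e : nat).
Local Notation q := (2 ^ e)%N.
Implicit Types (f g h : fps n k).

Definition boxV := {ffun box n e -> k^o}.

Definition tau f : boxV := [ffun b => f (mnm_of_box b)].

Lemma mnm_of_box_lt (b : box n e) i : (mnm_of_box b i < q)%N.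
Proof. by rewrite mnmE. Qed.

Lemma mnm_of_box_surj (m : 'X_{1..n}) :
  (forall i, m i < q)%N -> exists b : box n e, m = mnm_of_box b.
Proof.
move=> hm; exists [ffun i => Ordinal (hm i)].
by apply/mnmP => i; rewrite mnmE ffunE.
Qed.

Lemma mnm_of_box_inj : injective (@mnm_of_box n e).
Proof.
move=> b c /mnmP bc; apply/ffunP => i; apply/val_inj.
by have := bc i; rewrite !mnmE.
Qed.

Lemma tau_eq0 f : tau f = 0 <-> Jq q f.
Proof.
split=> [/ffunP h m /mnm_of_box_surj[b ->]|h].
  by have := h b; rewrite !ffunE.
by apply/ffunP => b; rewrite !ffunE h // => i; apply: mnm_of_box_lt.
Qed.

Lemma tauB f g : tau (f - g) = tau f - tau g.
Proof. by apply/ffunP => b; rewrite !ffunE. Qed.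

Lemma tauD f g : tau (f + g) = tau f + tau g.
Proof. by apply/ffunP => b; rewrite !ffunE. Qed.

Lemma tauZ c f : tau (fpsC c * f) = c *: tau f.
Proof. by apply/ffunP => b; rewrite !ffunE fps_coefCM. Qed.

Lemma tau_eq f g : tau f = tau g <-> Jq q (f - g).
Proof.
rewrite -tau_eq0 tauB; split=> [->|/eqP]; first by rewrite subrr.
by rewrite subr_eq0 => /eqP.
Qed.

Definition ext_poly (w : boxV) : {mpoly k[n]} :=
  \sum_b w b *: 'X_[mnm_of_box b].
Definition ext (w : boxV) : fps n k := fps_of_mpoly (ext_poly w).

Lemma tau_ext w : tau (ext w) = w.
Proof.
apply/ffunP => b; rewrite ffunE /ext fps_of_mpolyE raddf_sum /=.
rewrite (bigD1 b) //= mcoeffZ mcoeffX eqxx mulr1 big1 ?addr0 // => c cb.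
rewrite mcoeffZ mcoeffX (inj_eq mnm_of_box_inj) (negPf cb); exact: mulr0.
Qed.

Lemma tauM_eq f g h : tau g = tau h -> tau (f * g) = tau (f * h).
Proof. by move=> /tau_eq gh; apply/tau_eq; rewrite -mulrBr; apply: JqM. Qed.

Definition act_fun f (w : boxV) : boxV := tau (f * ext w).

Fact act_is_linear f : linear (act_fun f).
Proof.
move=> c x y; rewrite /act_fun -[c *: tau _]tauZ -tauD.
rewrite mulrCA -mulrDr; apply: tauM_eq.
by rewrite tauD tauZ !tau_ext.
Qed.

HB.instance Definition _ f :=
  GRing.isLinear.Build k boxV boxV *:%R (act_fun f) (act_is_linear f).

(** Multiplication by f on the quotient by the q-th powers of the variables. *)
Definition act f : 'End(boxV) := linfun (act_fun f).

Lemma act_tau f h : act f (tau h) = tau (f * h).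
Proof. by rewrite lfunE; apply: tauM_eq; rewrite tau_ext. Qed.

Lemma actM f g w : act (f * g) w = act f (act g w).
Proof. by rewrite -[w]tau_ext !act_tau mulrA. Qed.

Lemma act1 w : act 1 w = w.
Proof. by rewrite -[w]tau_ext !act_tau mul1r. Qed.

Lemma dim_boxV : \dim {:boxV} = (q ^ n)%N.
Proof.
rewrite (@dim_unique_coords k _ (box n e) (fun b => [ffun c => (c == b)%:R])).
- by rewrite card_ffun !card_ord.
- by move=> c; rewrite memvf.
- move=> u _; exists u; apply/ffunP => b; rewrite sum_ffunE (bigD1 b) //= !ffunE eqxx.
  rewrite big1 ?addr0; first by rewrite /GRing.scale /= mulr1.
  by move=> c /negPf cb; rewrite !ffunE eq_sym cb; apply: mulr0.
- move=> c /ffunP hc b; have := hc b; rewrite sum_ffunE (bigD1 b) //= !ffunE eqxx.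
  rewrite big1 ?addr0; first by rewrite /GRing.scale /= mulr1.
  by move=> d /negPf db; rewrite !ffunE eq_sym db; apply: mulr0.
Qed.

Lemma rank_act f : (\dim (limg (act f)) + \dim (lker (act f)) = q ^ n)%N.
Proof. by rewrite -dim_boxV -(limg_ker_dim (act f) fullv) addnC capfv. Qed.

(** Modulo f, a polynomial may be corrected to have no monomial in the box, and
    every monomial outside the box is a multiple of some X_i^q. *)
Lemma e_ideal (p f : {mpoly k[n]}) :
  ideal_gen (range (fun i : 'I_n => 'X_i ^+ q) `|` [set f]) p <->
  tau (fps_of_mpoly p) \in limg (act (fps_of_mpoly f)).
Proof.
set I := ideal_gen _.
have [I0 ID IM] : is_ideal I.
  split=> [A [[A0 _ _] _] //|x y hx hy A [hA SA]|a x hx A [hA SA]].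
    by have [_ AD _] := hA; apply: AD; [apply: hx|apply: hy].
  by have [_ _ AM] := hA; apply: AM; apply: hx.
have Igen x : (range (fun i : 'I_n => 'X_i ^+ q) `|` [set f]) x -> I x.
  by move=> hx A [_]; apply.
split=> [hp|/memv_imgP[w _ hw]].
  apply: (hp [set p | tau (fps_of_mpoly p) \in limg (act (fps_of_mpoly f))]).
  split; [split=> /= [|x y hx hy|a x /memv_imgP[w _ hw]]|].
  - by rewrite rmorph0 (_ : tau 0 = 0) ?mem0v //; apply/tau_eq0.
  - by rewrite rmorphD /= tauD rpredD.
  - rewrite rmorphM /=; apply/memv_imgP; exists (act (fps_of_mpoly a) w); rewrite ?memvf //.
    by rewrite -act_tau hw -!actM mulrC.
  - move=> x [[i _ <-]|->] /=.
      rewrite (_ : tau _ = 0) ?mem0v //; apply/tau_eq0 => m hm.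
      rewrite fps_of_mpolyE mcoeffXn; case: eqP => // mE.
      by have := hm i; rewrite -mE mulmnE mnm1E eqxx mul1n ltnn.
    apply/memv_imgP; exists (tau 1); rewrite ?memvf //.
    by rewrite act_tau mulr1.
have -> : p = (p - f * ext_poly w) + ext_poly w * f by ring.
apply: (ID); last by apply: IM; apply: Igen; right.
set r := _ - _.
have rJ : Jq q (fps_of_mpoly r).
  apply/tau_eq0; rewrite rmorphB rmorphM /= tauB hw -{1}[w]tau_ext act_tau.
  by rewrite subrr.
rewrite (mpolyE r); apply: (big_ind (fun x => I x)) => [||m _]; [exact: I0|exact: ID|].
have [hm|] := pselect (forall i, m i < q)%N.
  by rewrite -[r@_m]/(fps_of_mpoly r m) rJ // scale0r; exact: I0.
move=> /existsNP[i /negP]; rewrite -leqNgt => qm.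
rewrite -mul_mpolyC; apply: (IM).
have -> : 'X_[m] = 'X_[m - U_(i) *+ q] * 'X_i ^+ q :> {mpoly k[n]}.
  rewrite mpolyXn -mpolyXD submK //; apply/mnm_lepP => j.
  by rewrite mulmnE mnm1E; case: eqP => [<-|]; rewrite ?mul1n ?mul0n.
by apply: IM; apply: Igen; left; exists i.
Qed.

Lemma e_E (f : {mpoly k[n]}) : e_ e f = \dim (lker (act (fps_of_mpoly f))).
Proof.
rewrite /e_ (@dim_quotE k {mpoly k[n]} _ (tau \o (@fps_of_mpoly n k))
  (limg (act (fps_of_mpoly f)))).
- by rewrite dim_boxV -(rank_act (fps_of_mpoly f)) addKn.
- by move=> c x y /=; rewrite rmorphD /= fpsCZ tauD tauZ.
- by move=> w; exists (ext_poly w); apply: tau_ext.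
- by move=> p; apply: e_ideal.
Qed.

End BoxModel.

(** Flatness of the Frobenius: the coordinates for q = 2 identify the quotient
    at level n + 1, with f^2 acting, with 2^n copies of the Frobenius twist of
    the quotient at level n, with f acting. The twist makes the identification
    semilinear only. *)
Lemma e_sqr (n : nat) (k : closedFieldType) (char2 : 2%N \in [pchar k]) (e : nat)
    (f : {mpoly k[n]}) : e_ e.+1 (f ^+ 2) = (2 ^ n * e_ e f)%N.
Proof.
rewrite !e_E rmorphXn /=; set F := fps_of_mpoly f.
pose E := box n 1.
pose lift (x : {ffun E -> boxV n k e}) : fps n k :=
  \sum_c ext (x c) ^+ (2 ^ 1) * fps_of_mpoly 'X_[mnm_of_box c].
have Jsum (h : E -> fps n k) : (forall c, Jq (2 ^ e) (h c)) ->
    Jq (2 ^ e.+1) (\sum_c h c ^+ (2 ^ 1) * fps_of_mpoly 'X_[mnm_of_box c]).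
  by move=> hh; apply: Jq_sum => c _; rewrite mulrC; apply: JqM; exact: (@Jq_frobS n k char2 1 e).
have sumB (h h' : E -> fps n k) :
    \sum_c h c ^+ (2 ^ 1) * fps_of_mpoly 'X_[mnm_of_box c] -
    \sum_c h' c ^+ (2 ^ 1) * fps_of_mpoly 'X_[mnm_of_box c] =
    \sum_c (h c - h' c) ^+ (2 ^ 1) * fps_of_mpoly 'X_[mnm_of_box c].
  rewrite -sumrB; apply: eq_bigr => c _; rewrite -mulrBl; congr (_ * _).
  rewrite exprDq; last exact: fps_pchar2.
  by rewrite -[X in _ = _ + X]oppr2 ?oppr2 //; exact: fps_pchar2.
have liftE (h : E -> fps n k) : (forall c, Jq (2 ^ e) (h c - ext (tau e (h c)))).
  by move=> c; apply/tau_eq; rewrite tau_ext.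
rewrite (@dim_semilinear_param k (boxV n k e) (boxV n k e.+1) E
  (pFrobenius_aut char2) (fun=> lker (act e F)) _ (fun x => tau e.+1 (lift x))).
- by rewrite sum_nat_const card_ffun !card_ord.
- by move=> c; exists (root_q 1 c); rewrite /= pFrobenius_autE -[2%N]/(2 ^ 1)%N root_qK.
- move=> x y; rewrite -tauD; apply/tau_eq; rewrite /lift -big_split /=.
  under [X in _ - X]eq_bigr do rewrite -mulrDl -exprDq ?fps_pchar2 //.
  rewrite sumB; apply: Jsum => c; apply/tau_eq.
  by rewrite tauD !tau_ext ffunE.
- move=> c x; rewrite -tauZ; apply/tau_eq; rewrite /lift mulr_sumr.
  rewrite [X in _ - X](eq_bigr (fun b => (fpsC c * ext (x b)) ^+ (2 ^ 1) *
     fps_of_mpoly 'X_[mnm_of_box b])); last first.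
    move=> b _; rewrite exprMn mulrA /fpsC /=.
    by rewrite -!rmorphXn /= pFrobenius_autE.
  rewrite sumB; apply: Jsum => b; apply/tau_eq.
  by rewrite tauZ !tau_ext ffunE.
- move=> x _ /tau_eq0 hx; apply/ffunP => c.
  have := @Jq_piS n k char2 1%N e _ c hx; rewrite pi_sum //.
  by rewrite -tau_eq0 tau_ext ffunE.
- move=> x hx; rewrite memv_ker act_tau; apply/eqP/tau_eq0.
  rewrite /lift mulr_sumr; under eq_bigr do rewrite mulrA -exprMn.
  apply: Jsum => c; apply/tau_eq0; rewrite -act_tau tau_ext.
  by apply/eqP; rewrite -memv_ker.
- move=> u; rewrite memv_ker => /eqP hu.
  exists [ffun c => tau e (pi_ c (ext u) : fps n k)].
    move=> c; rewrite ffunE memv_ker act_tau; apply/eqP/tau_eq0.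
    rewrite -(pi_frobM char2 (e := 1)); apply: (@Jq_piS n k char2 1%N e).
    by apply/tau_eq0; rewrite -act_tau tau_ext.
  rewrite -[RHS]tau_ext; apply/tau_eq.
  rewrite [X in _ - X](pi_decomp char2 1) /lift sumB; apply: Jsum => c.
  rewrite ffunE -[_ - _]opprB; apply: JqN; exact: (liftE (fun c => pi_ c (ext u))).
Qed.

(** * The hypersurface over k[[x, y, z]] *)

(** The polynomial g as an expression in an arbitrary ring, so that it can be
    transported between polynomials, series in three and series in five
    variables. *)
Definition g_form (R : comNzRingType) (d x y z : R) : R :=
  d * (x ^+ 2 * y ^+ 2) + z ^+ 4 + x * y * z ^+ 2 + (x ^+ 3 + y ^+ 3) * z.

Lemma g_form_rmorph (A B : comNzRingType) (phi : {rmorphism A -> B}) d x y z :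
  phi (g_form d x y z) = g_form (phi d) (phi x) (phi y) (phi z).
Proof. by rewrite /g_form !(rmorphD, rmorphM, rmorphXn). Qed.

Lemma g_form_semilinear (A B : comNzRingType) (S : A -> B) (d x y z : A) (d' x' y' z' : B) :
  (forall f h, S (f + h) = S f + S h) ->
  (forall f, S (d * f) = d' * S f) -> (forall f, S (x * f) = x' * S f) ->
  (forall f, S (y * f) = y' * S f) -> (forall f, S (z * f) = z' * S f) ->
  forall f, S (g_form d x y z * f) = g_form d' x' y' z' * S f.
Proof.
move=> SD Sd Sx Sy Sz f.
have SX i (w : A) (w' : B) : (forall f, S (w * f) = w' * S f) ->
    forall f, S (w ^+ i * f) = w' ^+ i * S f.
  by move=> hw; elim: i => [|i IH] h; rewrite ?expr0 ?mul1r // !exprS -!mulrA hw IH.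
by rewrite /g_form !mulrDl -!mulrA !(SD, Sd, Sx, Sy, Sz, SX _ _ _ Sx, SX _ _ _ Sy, SX _ _ _ Sz).
Qed.

(** The monomial x^c u^a v^b. *)
Definition mnm_join (c : 'X_{1..3}) (a b : nat) : 'X_{1..5} :=
  [multinom if (i < 3)%N then c (inord i) else if i == 3 :> nat then a else b | i < 5].

Lemma mnm_joinK (m : 'X_{1..5}) :
  m = mnm_join [multinom m (inord i) | i < 3] (m (inord 3)) (m (inord 4)).
Proof.
apply/mnmP => i; rewrite mnmE; case: ltnP => i3.
  by rewrite mnmE inordK // inord_val.
by case: eqP => i3'; congr (m _); apply/val_inj; rewrite /= inordK //;
  have := ltn_ord i; lia.
Qed.

Section Slices.
Variables (k : closedFieldType) (alpha : k).
Implicit Types (f h : fps 5 k) (c : 'X_{1..3}) (a b : nat).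

(** The coefficient of u^a v^b, as a series in x, y, z. *)
Definition slice a b f : fps 3 k := fun c => f (mnm_join c a b).

Definition x5 (j : nat) : fps 5 k := fps_of_mpoly 'X_(inord j).
Definition x3 (j : nat) : fps 3 k := fps_of_mpoly 'X_(inord j).

Lemma slice_x5 a b j f : (j < 3)%N -> slice a b (x5 j * f) = x3 j * slice a b f.
Proof.
move=> j3; apply: fpsP => c; rewrite /slice /x5 /x3 !fps_coefXM !lep1mP mnmE.
have jE : (inord j : 'I_5) = j :> nat by rewrite inordK // (ltn_trans j3).
rewrite jE j3; case: ifP => // _; congr f.
apply/mnmP => i; rewrite mnmBE !mnmE; case: ltnP => i3.
  congr (_ - nat_of_bool _)%N.
  by rewrite -!val_eqE /= jE !inordK.
by rewrite -val_eqE /= jE (ltn_eqF (leq_trans j3 i3)) subn0.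
Qed.

Lemma slice_uv a b f : slice a b (x5 3 * x5 4 * f) =
  if (0 < a)%N && (0 < b)%N then slice a.-1 b.-1 f else 0.
Proof.
apply: fpsP => c; rewrite /slice /x5 -mulrA !fps_coefXM !lep1mP.
rewrite mnmBE !mnmE !inordK //= -val_eqE /= !inordK //= subn0 !lt0n.
case: (a == 0%N) => //=; case: (b == 0%N) => //=; congr f.
apply/mnmP => i; rewrite !mnmBE !mnmE -!val_eqE /= !inordK //.
case: i => -[|[|[|[|[|//]]]]] hi /=; rewrite ?subn0 ?subn1 //.
Qed.

Lemma sliceD a b f h : slice a b (f + h) = slice a b f + slice a b h.
Proof. by []. Qed.

Lemma slice_sum a b (I : Type) (r : seq I) (P : pred I) (F : I -> fps 5 k) :
  slice a b (\sum_(i <- r | P i) F i) = \sum_(i <- r | P i) slice a b (F i).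
Proof. by apply: (big_morph (slice a b)) => //; apply: sliceD. Qed.

Lemma sliceC a b (d : k) f : slice a b (fpsC d * f) = fpsC d * slice a b f.
Proof. by apply: fpsP => c; rewrite /slice !fps_coefCM. Qed.

Definition g3 : fps 3 k := fps_of_mpoly (g alpha).
Definition G5 : fps 5 k := fps_of_mpoly (G alpha).
Definition g5 : fps 5 k := g_form (fpsC alpha) (x5 0) (x5 1) (x5 2).

Lemma g3E : g3 = g_form (fpsC alpha) (x3 0) (x3 1) (x3 2).
Proof.
have -> : g3 = fps_of_mpoly (g_form alpha%:MP 'X_(inord 0) 'X_(inord 1) 'X_(inord 2)).
  by rewrite /g3 /g -mul_mpolyC.
by rewrite g_form_rmorph.
Qed.

Lemma G5E : G5 = x5 3 * x5 4 + g5.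
Proof.
have -> : G5 = fps_of_mpoly ('X_(inord 3) * 'X_(inord 4) +
    g_form alpha%:MP 'X_(inord 0) 'X_(inord 1) 'X_(inord 2)).
  by rewrite /G5 /G -mul_mpolyC /g_form; congr fps_of_mpoly; rewrite -!addrA.
by rewrite rmorphD rmorphM g_form_rmorph.
Qed.

Lemma slice_g5 a b f : slice a b (g5 * f) = g3 * slice a b f.
Proof.
rewrite g3E; apply: g_form_semilinear => [h h'|h|h|h|h].
- exact: sliceD.
- exact: sliceC.
- exact: slice_x5.
- exact: slice_x5.
- exact: slice_x5.
Qed.

Lemma slice_g5X a b i f : slice a b (g5 ^+ i * f) = g3 ^+ i * slice a b f.
Proof.
by elim: i f => [|i IH] f; rewrite ?expr0 ?mul1r // !exprSr -!mulrA IH slice_g5.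
Qed.

Lemma slice_G5 a b f : slice a b (G5 * f) = g3 * slice a b f +
  if (0 < a)%N && (0 < b)%N then slice a.-1 b.-1 f else 0.
Proof. by rewrite G5E mulrDl sliceD slice_uv slice_g5 addrC. Qed.

Lemma slice_uvX a b i f : slice a b ((x5 3 * x5 4) ^+ i * f) =
  if (i <= a)%N && (i <= b)%N then slice (a - i) (b - i) f else 0.
Proof.
elim: i a b => [|i IH] a b; first by rewrite expr0 mul1r !subn0.
rewrite exprS -[_ * _ * f]mulrA slice_uv; case: a => [|a] //; case: b => [|b] //=.
by rewrite andbF.
Qed.

Lemma G5_neq0 : G5 != 0.
Proof.
have c1 (m : 'X_{1..5}) : (1 : fps 5 k) m = (m == 0%MM)%:R by [].
have s1 : slice 1 1 1 = 0.
  apply: fpsP => c; rewrite /slice c1 (_ : (_ == _) = false) //.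
  by apply/eqP => /mnmP/(_ (inord 3 : 'I_5)); rewrite mnmE inordK // mnm0E.
apply/eqP => G0; have : slice 1 1 (G5 * 1) 0%MM = 1.
  rewrite slice_G5 /= s1 mulr0 add0r /slice c1.
  suff -> : mnm_join 0 0 0 = 0%MM by rewrite eqxx.
  by apply/mnmP => i; rewrite mnmE !mnm0E !if_same.
by rewrite G0 mul0r => /esym/eqP; rewrite oner_eq0.
Qed.

(** The sum times uv + g is (uv)^q + g^q = (uv + g)^q, signs being irrelevant in
    characteristic 2, and uv + g can be cancelled: equivalently, the binomial
    coefficients of exponent 2^e - 1 are all odd. *)
Lemma G5X e Q (char2 : 2%N \in [pchar k]) : (Q.+1 = 2 ^ e)%N ->
  G5 ^+ Q = \sum_(i < Q.+1) (x5 3 * x5 4) ^+ i * g5 ^+ (Q - i).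
Proof.
move=> Qq; have p2 := fps_pchar2 5 char2.
have sub2 (x y : fps 5 k) : x - y = x + y by rewrite (oppr2 p2 y).
apply: (fps_mulIf G5_neq0); rewrite -exprSr Qq {1}G5E exprDq // -sub2 subrXX -Qq.
rewrite sub2 -G5E mulrC; congr (_ * _).
rewrite (reindex_inj rev_ord_inj) /=; apply: eq_bigr => i _.
by rewrite subSS /= ?subSS subKn ?leq_ord.
Qed.

End Slices.

(** * Kernel of uv + g and image of its power *)

Section HypersurfaceRank.
Variables (k : closedFieldType) (char2 : 2%N \in [pchar k]) (alpha : k).
Variables (e Q : nat) (Qq : (Q.+1 = 2 ^ e)%N).
Local Notation q := (2 ^ e)%N.
Local Notation V := (boxV 3 k e).
Local Notation g3 := (g3 alpha).
Local Notation G5 := (G5 alpha).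
Implicit Types (f h : fps 5 k) (a b : nat).

Definition g_act (i : nat) : 'End(V) := act e (g3 ^+ i).

Lemma g_act0 v : g_act 0 v = v. Proof. exact: act1. Qed.

Lemma g_actD i j v : g_act (i + j) v = g_act i (g_act j v).
Proof. by rewrite /g_act exprD actM. Qed.

Lemma g_actSr i v : g_act i.+1 v = g_act i (g_act 1 v).
Proof. by rewrite -g_actD addn1. Qed.

Lemma g_actSl i v : g_act i.+1 v = g_act 1 (g_act i v).
Proof. by rewrite -g_actD add1n. Qed.

Lemma e_gX i : e_ e (g alpha ^+ i) = \dim (lker (g_act i)).
Proof. by rewrite e_E rmorphXn. Qed.

(** The coefficient of u^a v^b, modulo x^q, y^q, z^q. *)
Definition tau_slice f a b : V := tau e (slice a b f).

Lemma tau_sliceD f h a b : tau_slice (f + h) a b = tau_slice f a b + tau_slice h a b.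
Proof. exact: tauD. Qed.

Lemma g_act_slice i f a b : g_act i (tau_slice f a b) = tau e (g3 ^+ i * slice a b f).
Proof. exact: act_tau. Qed.

Definition tau5 f : grid V Q := [ffun p : 'I_Q.+1 * 'I_Q.+1 => tau_slice f p.1 p.2].

Lemma at_tau5 f a b : (a <= Q)%N -> (b <= Q)%N -> at_ (tau5 f) a b = tau_slice f a b.
Proof. by move=> aQ bQ; rewrite /at_ ffunE /= !inordK. Qed.

Lemma Jq_slices f : Jq q f <-> (forall a b, (a <= Q)%N -> (b <= Q)%N -> tau_slice f a b = 0).
Proof.
split=> [hf a b aQ bQ|hf m hm].
  apply/tau_eq0 => c hc; apply: hf => i; rewrite mnmE -Qq ltnS.
  by case: ltnP => _; [rewrite -ltnS Qq|case: eqP].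
have hQ i : (m i <= Q)%N by rewrite -ltnS Qq.
have /tau_eq0 := hf _ _ (hQ (inord 3)) (hQ (inord 4)).
rewrite [m in X in _ -> X]mnm_joinK; apply=> i; rewrite mnmE; exact: hm.
Qed.

Lemma slices_surj (v : nat -> nat -> V) :
  exists f, forall a b, (a <= Q)%N -> (b <= Q)%N -> tau_slice f a b = v a b.
Proof.
exists (fun m => ext (v (m (inord 3)) (m (inord 4))) [multinom m (inord i) | i < 3]).
move=> a b aQ bQ; rewrite -[RHS]tau_ext /tau_slice; congr tau; apply: fpsP => c.
rewrite /slice !mnmE !inordK //=; congr (ext _ _); apply/mnmP => i.
have i5 := ltn_trans (ltn_ord i) (isT : (3 < 5)%N).
by rewrite !mnmE inordK // ltn_ord inord_val.
Qed.

Lemma tau5_iso : exists J : 'Hom(boxV 5 k e, grid V Q),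
  (forall f, J (tau e f) = tau5 f) /\ lker J = 0%VS.
Proof.
have tau5_eq0 f : tau5 f = 0 <-> Jq q f.
  rewrite Jq_slices; split=> [/ffunP hf a b aQ bQ|hf].
    by rewrite -at_tau5 // /at_ hf ffunE.
  by apply/ffunP => -[a b]; rewrite !ffunE hf // leq_ord.
have tau5D f h : tau5 (f + h) = tau5 f + tau5 h.
  by apply/ffunP => p; rewrite !ffunE tau_sliceD.
have tau5Z c f : tau5 (fpsC c * f) = c *: tau5 f.
  by apply/ffunP => p; rewrite !ffunE /tau_slice sliceC tauZ.
have tau5_eq f h : Jq q (f - h) -> tau5 f = tau5 h.
  by rewrite -tau5_eq0 => E; rewrite -[f](subrK h) tau5D E add0r.
have JL : linear (fun w : boxV 5 k e => tau5 (ext w)).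
  move=> c x y; rewrite -tau5Z -tau5D; apply: tau5_eq; apply/tau_eq.
  by rewrite tauD tauZ !tau_ext.
have [J JE] := linear_lfun JL; exists J; split=> [f|].
  by rewrite JE; apply: tau5_eq; apply/tau_eq; rewrite tau_ext.
apply/eqP; rewrite -subv0; apply/subvP => w; rewrite memv_ker JE => /eqP /tau5_eq0.
by rewrite -tau_eq0 tau_ext memv0 => ->.
Qed.

(** Transport of the count along diagonals from grids to the box in five
    variables, by the isomorphism taking coefficients in u and v. *)
Lemma dim_diagonal (W : {vspace boxV 5 k e}) (U : nat -> {vspace V}) :
  (forall f, tau e f \in W <->
     (forall a b, (a < Q)%N -> (b < Q)%N -> g_act 1 (tau_slice f a.+1 b.+1) = tau_slice f a b) /\
     (forall s, (s <= Q)%N -> tau_slice f Q s \in U s /\ tau_slice f s Q \in U s)) ->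
  \dim W = (\dim (U Q) + 2 * \sum_(s < Q) \dim (U s))%N.
Proof.
move=> hW; have [J [JE kerJ]] := tau5_iso.
have := limg_ker_dim J W; rewrite kerJ capv0 dimv0 add0n => <-.
apply: (dim_tower g_act0 g_actD) => w.
transitivity (exists2 f, tau e f \in W & w = tau5 f).
  split=> [/memv_imgP[u uW ->]|[f fW ->]].
    by exists (ext u); rewrite ?tau_ext // -JE tau_ext.
  by rewrite -JE memv_img.
split=> [[f /hW[h1 h2] ->]|[h1 h2]].
  split=> [a b aQ bQ|s sQ]; first by rewrite !at_tau5 ?h1 // ltnW.
  by rewrite !at_tau5 //; apply: h2.
have [f fE] := slices_surj (at_ w); exists f.
  apply/hW; split=> [a b aQ bQ|s sQ]; first by rewrite !fE ?h1 // ltnW.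
  by rewrite !fE //; apply: h2.
by apply/ffunP => -[a b]; rewrite ffunE /= fE ?leq_ord // /at_ !inord_val.
Qed.

Lemma tau_slice_G5 f a b : tau_slice (G5 * f) a b = g_act 1 (tau_slice f a b) +
  if (0 < a)%N && (0 < b)%N then tau_slice f a.-1 b.-1 else 0.
Proof.
by rewrite /tau_slice slice_G5 tauD g_act_slice expr1; case: ifP => // _; congr (_ + _); apply/tau_eq0.
Qed.

Lemma add_eq0_char2 (v w : V) : (v + w == 0) = (v == w).
Proof.
have v2 : v + v = 0.
  rewrite -mulr2n -scaler_nat; move: char2 => /andP[_ /eqP ->]; exact: scale0r.
by rewrite -{2}(addKr v w) -[in RHS]subr_eq0 opprD opprK addrA v2 add0r oppr_eq0.
Qed.

(** Compare coefficients of u^a v^b in (uv + g) f = 0: g times the coefficient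
    at (a, b) is the one at (a - 1, b - 1), or 0 if there is none. *)
Lemma diagonal_ker f : Jq q (G5 * f) <->
  (forall a b, (a < Q)%N -> (b < Q)%N -> g_act 1 (tau_slice f a.+1 b.+1) = tau_slice f a b) /\
  (forall s, (s <= Q)%N -> g_act 1 (tau_slice f s 0) = 0 /\ g_act 1 (tau_slice f 0 s) = 0).
Proof.
rewrite Jq_slices; split=> [hf|[h1 h2] a b aQ bQ].
  split=> [a b aQ bQ|s sQ].
    by apply/eqP; rewrite -add_eq0_char2 -(hf a.+1 b.+1) // tau_slice_G5.
  have := hf s 0%N sQ isT; have := hf 0%N s isT sQ.
  by rewrite !tau_slice_G5 andbF !addr0.
rewrite tau_slice_G5; case: a aQ => [|a] aQ; first by rewrite /= addr0; have [] := h2 b bQ.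
case: b bQ => [|b] bQ; first by rewrite /= addr0; have [] := h2 a.+1 aQ.
by apply/eqP; rewrite add_eq0_char2 h1.
Qed.

Lemma diagonal_iter f i a b :
  (forall a b, (a < Q)%N -> (b < Q)%N -> g_act 1 (tau_slice f a.+1 b.+1) = tau_slice f a b) ->
  (a + i <= Q)%N -> (b + i <= Q)%N -> g_act i (tau_slice f (a + i) (b + i)) = tau_slice f a b.
Proof.
move=> hf; elim: i a b => [|i IH] a b ai bi; first by rewrite g_act0 !addn0.
rewrite !addnS in ai bi *.
by rewrite g_actSr hf // IH // ltnW.
Qed.

(** The kernel has free coordinates on the edge max(a, b) = q - 1; such a
    coordinate, at distance s + 1 from the end of its diagonal, is only subject
    to being killed by g^(s+1). *)
Lemma dim_ker_G5 : \dim (lker (act e G5)) =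
  (e_ e (g alpha ^+ Q.+1) + 2 * \sum_(s < Q) e_ e (g alpha ^+ s.+1))%N.
Proof.
rewrite (dim_diagonal (U := fun s => lker (g_act s.+1))).
  by rewrite !e_gX; congr (_ + 2 * _)%N; apply: eq_bigr => s _; rewrite e_gX.
move=> f; rewrite memv_ker act_tau.
transitivity (Jq q (G5 * f)); first by rewrite -tau_eq0; split=> /eqP.
rewrite diagonal_ker; split=> -[h1 h2]; split=> // s sQ.
  rewrite !memv_ker !(g_actSl s).
  have h := @diagonal_iter f s; have [] := h2 (Q - s)%N (leq_subr _ _).
  rewrite -(h (Q - s)%N 0%N) ?subnK // -(h 0%N (Q - s)%N) ?subnK // !add0n.
  by move=> -> ->.
have h := @diagonal_iter f (Q - s); have := h2 (Q - s)%N (leq_subr _ _).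
rewrite -(h s 0%N) ?subnKC ?leq_subr // -(h 0%N s) ?subnKC ?leq_subr // !add0n.
by rewrite !memv_ker !(g_actSl (Q - s)) => -[/eqP -> /eqP ->].
Qed.

(** The image of (uv + g)^(q-1) lies in the kernel of uv + g, so the relations
    along diagonals are the same; on the edge, all the terms (uv)^i g^(q-1-i)
    that contribute at minimum s have i <= s, whence the factor g^(q-1-s), and
    the term i = s shows that every multiple of it occurs. *)
Lemma dim_img_G5 : \dim (limg (act e (G5 ^+ Q))) =
  (\dim (limg (g_act 0)) + 2 * \sum_(s < Q) \dim (limg (g_act (Q - s))))%N.
Proof.
have YGQ h s : (s <= Q)%N -> forall a b, s = minn a b ->
  tau_slice (G5 ^+ Q * h) a b = g_act (Q - s) (\sum_(i < s.+1) g_act (s - i) (tau_slice h (a - i) (b - i))).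
  move=> sQ a b sE; rewrite (G5X alpha char2 Qq) mulr_suml.
  have tau0 : tau e 0 = 0 :> V by apply/tau_eq0.
  rewrite /tau_slice slice_sum (big_morph _ (@tauD 3 k e) tau0) linear_sum /=.
  rewrite (big_ord_widen Q.+1 (fun i => g_act (Q - s) (g_act (s - i) (tau_slice h (a - i) (b - i))))) //.
  rewrite [RHS]big_mkcond; apply: eq_bigr => i _ /=.
  rewrite -mulrA slice_uvX slice_g5X ltnS sE leq_min; case: ifP => // /andP[ia ib].
  by rewrite -g_actD -/(tau_slice _ _ _) addnBA ?subnK ?g_act_slice -?sE // sE leq_min ia.
rewrite (dim_diagonal (U := fun s => limg (g_act (Q - s)))) ?subnn //.
move=> f; split=> [/memv_imgP[w _ fE]|[h1 h2]].
  have {fE} : tau e f = tau e (G5 ^+ Q * ext w) by rewrite fE -{1}[w]tau_ext act_tau.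
  set h := ext w => fE.
  have YE a b : (a <= Q)%N -> (b <= Q)%N -> tau_slice f a b = tau_slice (G5 ^+ Q * h) a b.
    move=> aQ bQ; apply/eqP; rewrite -subr_eq0 -tauB.
    by have /tau_eq/Jq_slices/(_ a b aQ bQ) := fE => <-.
  have /diagonal_ker[h1 h2] : Jq q (G5 * (G5 ^+ Q * h)).
    rewrite mulrA -exprS Qq mulrC; apply/JqM/Jq_frob => //.
    exact: G_coef0.
  split=> [a b aQ bQ|s sQ]; first by rewrite !YE ?h1 // ltnW.
  rewrite !YE // !(YGQ h s) ?(minn_idPr sQ) ?(minn_idPl sQ) //.
  by rewrite !memv_img ?memvf.
pose v s := (g_act (Q - s))^-1%VF (tau_slice f Q s); pose v' s := (g_act (Q - s))^-1%VF (tau_slice f s Q).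
have vE s : (s <= Q)%N -> g_act (Q - s) (v s) = tau_slice f Q s /\ g_act (Q - s) (v' s) = tau_slice f s Q.
  by move=> sQ; have [m1 m2] := h2 s sQ; rewrite !limg_lfunVK.
have vv' : v Q = v' Q by [].
(* A preimage supported on the two axes, where each diagonal starts. *)
have [h hE] := slices_surj (fun a b => if b == 0%N then v (Q - a)%N
                         else if a == 0%N then v' (Q - b)%N else 0).
have [m1 m2] : (forall s, (s <= Q)%N -> tau_slice (G5 ^+ Q * h) Q s = tau_slice f Q s /\
    tau_slice (G5 ^+ Q * h) s Q = tau_slice f s Q) /\ True.
  split=> // s sQ; have [<- <-] := vE s sQ.
  rewrite !(YGQ h s) ?(minn_idPr sQ) ?(minn_idPl sQ) // !big_ord_recr /=.
  have sQ0 i : (i < s)%N -> ((s - i)%N == 0%N) = false /\ ((Q - i)%N == 0%N) = false.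
    by move=> is_; split; apply/negbTE; rewrite subn_eq0 -ltnNge // (leq_trans is_).
  rewrite !subnn !g_act0 !hE ?leq_subr //=.
  rewrite !big1 ?add0r => [|i _|i _].
  - rewrite subKn //; split=> //; case: ifP => // /eqP sQE.
    have -> : s = Q by apply/eqP; rewrite eqn_leq sQ -subn_eq0 sQE.
    by rewrite subn0 vv'.
  - by have [s0 Q0] := sQ0 i (ltn_ord i);
      rewrite hE ?s0 ?Q0 ?linear0 ?leq_subr // (leq_trans (leq_subr _ _)).
  - by have [s0 Q0] := sQ0 i (ltn_ord i);
      rewrite hE ?s0 ?Q0 ?linear0 ?leq_subr // (leq_trans (leq_subr _ _)).
have /diagonal_ker[c1 _] : Jq q (G5 * (G5 ^+ Q * h)).
  by rewrite mulrA -exprS Qq mulrC; apply/JqM/Jq_frob => //; exact: G_coef0.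
apply/memv_imgP; exists (tau e h); rewrite ?memvf // act_tau; apply/tau_eq/Jq_slices => a b aQ bQ.
rewrite /tau_slice tauB -!/(tau_slice _ _ _); apply/eqP; rewrite subr_eq0; apply/eqP.
have mQ : (maxn a b <= Q)%N by rewrite geq_max aQ.
rewrite -(@diagonal_iter f (Q - maxn a b)) //; try lia.
rewrite -(@diagonal_iter (G5 ^+ Q * h) (Q - maxn a b)) //; try lia.
congr (g_act _ _); case: (leqP a b) => ab in mQ *.
  by rewrite (subnKC bQ); have [_ ->] := m1 (a + (Q - b))%N ltac:(lia).
by rewrite (subnKC aQ); have [-> _] := m1 (b + (Q - a))%N ltac:(lia).
Qed.

End HypersurfaceRank.

(** * Length as a dimension *)

Section Length.
Variables (rT : realType) (n : nat) (k : closedFieldType) (e : nat).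
Variables (A : comNzRingType) (pi : {rmorphism fps n k -> A}).
Hypotheses (n_gt0 : (0 < n)%N) (piS : forall x : A, exists f, pi f = x).
Local Notation W := (boxV n k e).
Implicit Types (f h : fps n k) (U : {vspace W}).

Definition stable U := forall f h, tau e h \in U -> tau e (f * h) \in U.

(** Non-zero socle: otherwise an element outside U could be multiplied by
    non-units for ever, but series of large order lie in U. *)
Lemma socle_neq0 U : ~ (forall h, tau e h \in U) ->
  exists2 h, tau e h \notin U & forall f, f 0%MM = 0 -> tau e (f * h) \in U.
Proof.
move=> /existsNP[h0 /negP h0U]; apply: contrapT => hN.
have step h : tau e h \notin U -> exists2 f : fps n k, f 0%MM = 0 & tau e (f * h) \notin U.
  move=> hU; apply: contrapT => hN'; apply: hN; exists h => // f f0.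
  by apply/negPn/negP => fU; apply: hN'; exists f.
have [h hU hord] : exists2 h, tau e h \notin U &
    forall m : 'X_{1..n}, (mdeg m < n * 2 ^ e)%N -> (h : fps n k) m = 0.
  elim: (n * 2 ^ e)%N => [|N [h hU hord]]; first by exists h0.
  have [f f0 fU] := step h hU; exists (f * h) => // m mN.
  exact: (fps_coefM_orderS f0 hord).
have /tau_eq0 h0' : Jq (2 ^ e) h by apply: Jq_order; rewrite ?q_gt0.
by rewrite h0' mem0v in hU.
Qed.

(** Adjoining a socle element to U raises the dimension by one. *)
Lemma stable_chain d U : stable U -> (\dim {:W} - \dim U)%N = d ->
  exists Us : nat -> {vspace W}, [/\ Us 0%N = U,
    forall i, (i <= d)%N -> stable (Us i),
    forall i, (i <= d)%N -> (U <= Us i)%VS &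
    forall i, (i < d)%N -> (Us i <= Us i.+1)%VS /\ exists2 h, tau e h \in Us i.+1 & tau e h \notin Us i].
Proof.
elim: d U => [|d IH] U sU dU.
  by exists (fun=> U); split.
have UN : ~ (forall h, tau e h \in U).
  move=> hU; have UT : U = fullv.
    by apply/vspaceP => w; rewrite memvf -[w]tau_ext hU.
  by rewrite UT subnn in dU.
have [h hU hm] := socle_neq0 UN.
pose U' := (U + <[tau e h]>)%VS.
have UU' : (U <= U')%VS by apply: addvSl.
have hU' : tau e h \in U' by rewrite memvE addvSr.
have sU' : stable U'.
  move=> f h' /memv_addP[u uU [w /vlineP[c ->] h'E]].
  have -> : tau e (f * h') = tau e (f * ext u) + (c * f 0%MM) *: tau e h +
      c *: tau e ((f - fpsC (f 0%MM)) * h).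
    rewrite -!tauZ -!tauD (@tauM_eq _ _ _ f h' (ext u + fpsC c * h)).
      by congr tau; rewrite /fpsC mpolyCM rmorphM /=; ring.
    by rewrite tauD tauZ tau_ext h'E.
  rewrite !rpredD //.
  - by apply: (subvP UU'); apply: sU; rewrite tau_ext.
  - exact: memvZ.
  - apply/memvZ/(subvP UU')/hm.
    by rewrite fps_coefB fps_coefC eqxx mulr1 subrr.
have dU' : (\dim {:W} - \dim U')%N = d.
  have h0 : tau e h != 0 by apply: contraNneq hU => ->; apply: mem0v.
  suff : \dim U' = (\dim U).+1 by move=> ->; rewrite subnS dU.
  rewrite dimv_disjoint_sum ?dim_vline ?h0 ?addn1 //.
  apply/eqP; rewrite -subv0; apply/subvP => w; rewrite memv_cap => /andP[wU /vlineP[c wE]].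
  rewrite memv0 wE; case: (eqVneq c 0) => [->|c0]; first by rewrite scale0r.
  case/negP: hU; rewrite -[tau e h](scalerK c0) -wE; exact: memvZ.
have [Us [Us0 Ust UsU Usl]] := IH U' sU' dU'.
exists (fun i => if i is i'.+1 then Us i' else U); split=> //.
- by case=> // i id; apply: Ust.
- by case=> // i id; apply: subv_trans UU' (UsU _ _).
- case=> [_|i id]; last exact: Usl.
  by rewrite Us0; split=> //; exists h.
Qed.

(** The residue field is k: a chain of ideals gives a strict chain of
    subspaces, and [stable_chain] gives one that cannot be refined. *)
Lemma quot_length_dim (I : set A) U : is_ideal I ->
  (forall f, I (pi f) <-> tau e f \in U) ->
  quot_length rT I = ((\dim {:W} - \dim U)%N%:R)%:E.
Proof.
move=> [I0 ID IM] IU; set d := (_ - _)%N.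
apply/eqP; rewrite eq_le; apply/andP; split.
  apply: ge_ereal_sup => _ [m [J [Jid Jlt]] <-]; rewrite lee_fin ler_nat.
  suff [U' [dU' _]] : exists U', (\dim U + m <= \dim U')%N /\
      forall f, tau e f \in U' -> J m (pi f).
    have := dimvS (subvf U'); rewrite /d; lia.
  have : (m <= m)%N by []. move: {1 3 4}m; elim=> [|i IH] im.
    exists U; rewrite addn0; split=> // f /IU; have [_] := Jid 0%N im; exact.
  have [U' [dU' hU']] := IH (ltnW im).
  have [[Ji0 JiD JiM] _] := Jid i.+1 im.
  have [Jsub /existsNP[x /not_implyP[Jx nJx]]] := Jlt i im.
  have [f fx] := piS x.
  exists (U' + <[tau e f]>)%VS; split=> [|f' /memv_addP[u uU [w /vlineP[c ->] f'E]]].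
    rewrite addnS; apply: leq_ltn_trans dU' _; rewrite ltnNge; apply/negP => hd.
    have /eqP E : (U' == U' + <[tau e f]>)%VS by rewrite eqEdim addvSl.
    by apply: nJx; rewrite -fx; apply: hU'; rewrite E memvE addvSr.
  rewrite -[f'](subrK (fpsC c * f)) rmorphD rmorphM fx; apply: JiD; last exact: JiM.
  by apply: Jsub; apply: hU'; rewrite tauB tauZ f'E addrK.
have sU : stable U by move=> f h /IU hI; apply/IU; rewrite rmorphM; apply: IM.
have [Us [Us0 Ust UsU Usl]] := stable_chain sU (erefl d).
apply: ereal_sup_ubound; exists d => //.
have UsE i f f' : (i <= d)%N -> pi f = pi f' -> tau e f \in Us i -> tau e f' \in Us i.
  move=> id ff' fU; rewrite -[f'](subrK f) tauD rpredD //; apply: (subvP (UsU i id)).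
  by apply/IU; rewrite rmorphB ff' subrr.
exists (fun i => [set x | exists2 f, pi f = x & tau e f \in Us i]); split=> i id.
  split; first split.
  - by exists 0; rewrite ?rmorph0 // (_ : tau e 0 = 0) ?mem0v //; apply/tau_eq0.
  - move=> _ _ [f <- fU] [h <- hU]; exists (f + h); first by rewrite rmorphD.
    by rewrite tauD rpredD.
  - move=> x _ [f <- fU]; have [h <-] := piS x; exists (h * f); first by rewrite rmorphM.
    exact: Ust.
  - move=> x; have [f <-] := piS x => /IU fU; exists f => //; exact: (subvP (UsU i id)).
have [sub [h hU hN]] := Usl i id; split=> [_ [f <- fU]|].
  by exists f => //; apply: (subvP sub).
move=> /(_ (pi h)) []; first by exists h.
move=> f fh fU; case/negP: hN; apply: UsE fU => //; exact: ltnW.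
Qed.

End Length.

(** * The ring R and the Frobenius powers of its maximal ideal *)

Section Quotient.
Variables (k : closedFieldType) (char2 : 2%N \in [pchar k]) (alpha : k).
Local Notation G5 := (G5 alpha).
Implicit Types (f h : fps 5 k).

Definition piR : fps 5 k -> R_ alpha := \pi_(R_ alpha)%qT.

HB.instance Definition _ := GRing.RMorphism.copy piR (\pi_(R_ alpha)%qT : _ -> R_ alpha).

Lemma piR_surj (x : R_ alpha) : exists f, piR f = x.
Proof. by exists (repr x); rewrite /piR reprK. Qed.

Lemma piR_eq f h : piR f = piR h <-> exists t, f - h = t * G5.
Proof.
split=> [/eqP|[t E]].
  by rewrite /piR -Quotient.idealrBE => /asboolP.
by apply/eqP; rewrite /piR -Quotient.idealrBE; apply/asboolP; exists t.
Qed.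

Lemma G5_coef0 : G5 0%MM = 0.
Proof. exact: G_coef0. Qed.

Lemma piR1_coef0 f : piR f = 1 -> f 0%MM = 1.
Proof.
rewrite -(rmorph1 (@piR)) => /piR_eq[t /(congr1 (@^~ 0%MM))].
rewrite fps_mul_coef0 G5_coef0 mulr0 => /eqP; rewrite subr_eq0 => /eqP ->.
by rewrite -[LHS]/((0%MM == 0%MM :> 'X_{1..5})%:R) eqxx.
Qed.

Lemma max_ideal_piR f : max_ideal (piR f) <-> f 0%MM = 0.
Proof.
split=> [hf|f0 [y]].
  apply/eqP/negPn/negP => /fps_unit[h fh]; apply: hf; exists (piR h).
  by rewrite -rmorphM fh rmorph1.
have [h <-] := piR_surj y; rewrite -rmorphM => /piR1_coef0.
by rewrite fps_mul_coef0 f0 mul0r => /eqP; rewrite eq_sym oner_eq0.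
Qed.

Lemma ideal_gen_ideal (A : comNzRingType) (S : set A) : is_ideal (ideal_gen S).
Proof.
split=> [I [[I0 _ _] _] //|x y hx hy I hI|a x hx I hI].
  by have [[_ ID _] _] := hI; apply: ID; [apply: hx|apply: hy].
by have [[_ _ IM] _] := hI; apply: IM; apply: hx.
Qed.

Lemma stable_is_ideal e (I : set (R_ alpha)) (U : {vspace boxV 5 k e}) :
  stable U -> (forall f, I (piR f) <-> tau e f \in U) -> is_ideal I.
Proof.
move=> sU IU; split=> [|x y|x y].
- rewrite -(rmorph0 (@piR)); apply/IU.
  by rewrite (_ : tau e 0 = 0) ?mem0v //; apply/tau_eq0.
- have [f <-] := piR_surj x; have [h <-] := piR_surj y.
  by move=> /IU fU /IU hU; rewrite -rmorphD; apply/IU; rewrite tauD rpredD.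
- have [f <-] := piR_surj x; have [h <-] := piR_surj y.
  by move=> /IU hU; rewrite -rmorphM; apply/IU/sU.
Qed.

Lemma stable_limg e F : stable (limg (act e F : 'End(boxV 5 k e))).
Proof.
move=> f h /memv_imgP[w _ hw]; apply/memv_imgP; exists (act e f w); rewrite ?memvf //.
by rewrite -act_tau hw -!actM mulrC.
Qed.

Lemma stable_lker e F : stable (lker (act e F : 'End(boxV 5 k e))).
Proof.
move=> f h; rewrite !memv_ker => /eqP hw.
by rewrite -act_tau -actM mulrC actM hw linear0.
Qed.

(** An element of Jq is a sum of terms a_b^q X^b with non-units a_b. *)
Lemma frobenius_power_piR e f :
  frobenius_power (@max_ideal (R_ alpha)) (2 ^ e) (piR f) <->
  tau e f \in limg (act e G5).
Proof.
have [I0 ID IM] : is_ideal (frobenius_power (@max_ideal (R_ alpha)) (2 ^ e)).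
  exact: ideal_gen_ideal.
split=> [hf|/memv_imgP[w _ fw]].
  have sU := @stable_limg e G5.
  pose I : set (R_ alpha) := [set x | exists2 f, piR f = x & tau e f \in limg (act e G5)].
  have IU f' : I (piR f') <-> tau e f' \in limg (act e G5).
    split=> [[h /piR_eq[t hf'] hU]|hU]; last by exists f'.
    have -> : f' = h - t * G5 by rewrite -hf'; ring.
    rewrite tauB rpredB //; apply/memv_imgP; exists (tau e t); rewrite ?memvf //.
    by rewrite act_tau mulrC.
  apply/IU; apply: hf; split; first exact: stable_is_ideal sU IU.
  move=> _ [x + <-]; have [h <-] := piR_surj x => /max_ideal_piR h0.
  rewrite -rmorphXn; apply/IU; rewrite (_ : tau _ _ = 0) ?mem0v //.
  exact/tau_eq0/Jq_frob.
have /tau_eq fJ : tau e f = tau e (G5 * ext w) by rewrite fw -{1}[w]tau_ext act_tau.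
have -> : piR f = piR (f - G5 * ext w).
  by apply/piR_eq; exists (ext w); ring.
rewrite (pi_decomp char2 e (f - _)) rmorph_sum; apply: (big_ind _ I0 ID) => b _.
rewrite rmorphM mulrC; apply: (IM) => J [_]; apply; rewrite rmorphXn.
by exists (piR (pi_ b (f - G5 * ext w))) => //; apply/max_ideal_piR/Jq_pi0.
Qed.

End Quotient.

(** * The splitting ideals *)

Section Fedder.
Variables (k : closedFieldType) (char2 : 2%N \in [pchar k]) (alpha : k).
Variables (e Q : nat) (Qq : (Q.+1 = 2 ^ e)%N).
Local Notation q := (2 ^ e)%N.
Local Notation G5 := (G5 alpha).
Local Notation piR := (@piR k alpha).
Implicit Types (f h : fps 5 k) (b c : box 5 e).

Local Notation mon b := (fps_of_mpoly 'X_[mnm_of_box b] : fps 5 k).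
Definition co_mon b : fps 5 k := fps_of_mpoly 'X_[[multinom (Q - b i)%N | i < 5]].
Definition top_box : box 5 e := [ffun=> cast_ord Qq ord_max].

(** The functional taking the coordinate on the top monomial is a trace: the
    monomials and their complements are dual bases for it. *)
Lemma pi_top_dual b c : pi_ top_box (co_mon b * mon c) = (b == c)%:R.
Proof.
apply: fpsP => m; rewrite /pi_ /co_mon -rmorphM /= -mpolyXD fps_of_mpolyE mcoeffX.
have bQ i : (b i <= Q)%N by rewrite -ltnS Qq.
have cq i : (c i < q)%N by [].
have -> : ([multinom (Q - b i)%N | i < 5] + mnm_of_box c == m *+ q + mnm_of_box top_box)%MM
   = (b == c) && (m == 0%MM).
  apply/eqP/andP => [/mnmP E|[/eqP-> /eqP->]]; last first.
    by apply/mnmP => i; rewrite !mnmDE mulmnE !mnmE ffunE /= mul0n subnK // -ltnS Qq.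
  have Ei i : (m i = 0 /\ b i = c i :> nat)%N.
    have := E i; rewrite !mnmDE mulmnE !mnmE ffunE /= => Ei.
    have m0 : m i = 0%N.
      apply/eqP; rewrite -leqn0 leqNgt; apply/negP => m1.
      have : (q <= m i * q)%N by rewrite leq_pmull.
      by have := cq i; have := bQ i; lia.
    by rewrite m0 in Ei *; split=> //; have := bQ i; lia.
  split; first by apply/eqP/ffunP => i; apply/val_inj; have [] := Ei i.
  by apply/eqP/mnmP => i; rewrite mnm0E; have [] := Ei i.
have root_q1 : root_q e (1 : k) = 1 by have := root_qE char2 e (1 : k); rewrite expr1n.
case: (b == c) => /=; last by rewrite root_q0.
rewrite -[RHS]/((m == 0%MM)%:R).
by case: (m == 0%MM); rewrite ?root_q0.
Qed.

Lemma pi_sumE (I : Type) (r : seq I) (P : pred I) (F : I -> fps 5 k) b :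
  pi_ b (\sum_(i <- r | P i) F i) = \sum_(i <- r | P i) pi_ b (F i).
Proof.
apply: (big_morph _ (pi_D char2 b)).
by apply: fpsP => m; rewrite /pi_ root_q0.
Qed.

(** The form on the right, with arbitrary values c_b on the basis of bounded
    monomials, is the trace premultiplied by a series built on the dual basis. *)
Lemma pi_top_form (c : box 5 e -> fps 5 k) f :
  pi_ top_box ((\sum_b c b ^+ q * co_mon b) * f) = \sum_b c b * pi_ b f.
Proof.
rewrite mulr_suml pi_sumE; apply: eq_bigr => b _.
rewrite -mulrA (pi_frobM char2); congr (_ * _).
rewrite {1}(pi_decomp char2 e f) mulr_sumr pi_sumE (bigD1 b) //=.
rewrite mulrCA (pi_frobM char2) pi_top_dual eqxx mulr1 big1 ?addr0 // => d db.
by rewrite mulrCA (pi_frobM char2) pi_top_dual eq_sym (negPf db) mulr0.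
Qed.

Lemma pi_top_comon b f : pi_ top_box (f * co_mon b) = pi_ b f.
Proof.
have := pi_top_form (fun c => (c == b)%:R) f.
rewrite (bigD1 b) //= eqxx expr1n mul1r big1 ?addr0 => [|c /negPf ->]; last first.
  by rewrite expr0n gtn_eqF ?q_gt0 // mul0r.
rewrite mulrC => ->; rewrite (bigD1 b) //= eqxx mul1r big1 ?addr0 // => c /negPf ->.
by rewrite mul0r.
Qed.

Local Notation froot := (frobenius_root (R_pchar alpha char2) e).

(** A retraction h lifts to the series as the trace premultiplied by some C.
    Since h kills the multiples of G, all coordinates of C G are multiples of G,
    so C G is a multiple of G^q and C one of G^(q-1); then h r is a non-unit. *)
Lemma not_splits_Jq r :
  Jq q (G5 ^+ Q * r) -> splitting_ideal (R_pchar alpha char2) e (piR r).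
Proof.
move=> hJ [h hK]; pose H (f : fps 5 k) : R_ alpha := h (piR f : froot).
have HD f f' : H (f + f') = H f + H f'.
  by rewrite /H rmorphD -[LHS]/(h ((piR f : froot) + (piR f' : froot))) linearD.
have HM a f : H (a ^+ q * f) = piR a * H f.
  rewrite /H rmorphM rmorphXn.
  by rewrite -[LHS]/(h (piR a *: (piR f : froot))) linearZ.
have Hsum (F : box 5 e -> fps 5 k) : H (\sum_b F b) = \sum_b H (F b).
  apply: (big_morph _ HD); rewrite /H rmorph0; exact: linear0.
have /choice[c cE] : forall b, exists f, piR f = H (mon b) by move=> b; apply: piR_surj.
pose C := \sum_b c b ^+ q * co_mon b.
have HE f : H f = piR (pi_ top_box (C * f)).
  rewrite {1}(pi_decomp char2 e f) Hsum /C pi_top_form rmorph_sum; apply: eq_bigr => b _.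
  by rewrite HM rmorphM /= cE mulrC.
have Hr : H r = 1.
  have := hK 1; rewrite -[LHS]/(h (1 *: root_of _ e (piR r))) scale1r; exact.
have HG f : H (G5 * f) = 0.
  rewrite /H (_ : piR (G5 * f) = 0); first exact: linear0.
  by rewrite -(rmorph0 piR); apply/piR_eq; exists f; rewrite subr0 mulrC.
have /choice[t tE] : forall b, exists t, pi_ b (C * G5) = t * G5.
  move=> b; have := HG (co_mon b); rewrite HE mulrA pi_top_comon -(rmorph0 piR).
  by move=> /piR_eq[t]; rewrite subr0 => ->; exists t.
have CE : C = G5 ^+ Q * \sum_b t b ^+ q * mon b.
  apply: (fps_mulIf (G5_neq0 alpha)); rewrite mulrAC -exprSr Qq.
  rewrite {1}(pi_decomp char2 e (C * G5)) mulr_sumr; apply: eq_bigr => b _.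
  by rewrite tE exprMn; ring.
have := piR1_coef0 (etrans (esym (HE r)) Hr).
rewrite CE mulrAC (Jq_pi0 char2); first by move/eqP; rewrite eq_sym oner_eq0.
by rewrite mulrC; apply: JqM.
Qed.

(** Some coordinate b of G^(q-1) r is a unit w^-1. The map taking f to w times
    the coordinate b of G^(q-1) f sends multiples of G to multiples of G, because
    G^(q-1) G = G^q, and r to 1. *)
Lemma splits_not_Jq r :
  ~ Jq q (G5 ^+ Q * r) -> ~ splitting_ideal (R_pchar alpha char2) e (piR r).
Proof.
move=> hJ; apply; have [b b0] : exists b : box 5 e, pi_ b (G5 ^+ Q * r) 0%MM != 0.
  apply: contrapT => hN; apply: hJ; apply: (pi0_Jq char2) => b.
  by apply/eqP/negPn/negP => b0; apply: hN; exists b.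
have [w wE] := fps_unit b0.
pose hS f := w * pi_ b (G5 ^+ Q * f).
have hSG f f' : piR f = piR f' -> piR (hS f) = piR (hS f').
  move=> /piR_eq[t ff']; apply/piR_eq; exists (w * pi_ b t).
  have -> : f = G5 * t + f' by rewrite -[LHS](subrK f') ff' mulrC.
  rewrite /hS mulrDr mulrA -exprSr Qq (pi_D char2) (pi_frobM char2); ring.
pose hR (x : froot) : (R_ alpha)^o := piR (hS (repr (x : R_ alpha))).
have hRE f : hR (piR f : froot) = piR (hS f).
  by apply: hSG; rewrite /piR reprK.
have hL : linear hR.
  move=> a x y; have [a' aE] := piR_surj a.
  have [f fE] := piR_surj (x : R_ alpha); have [f' f'E] := piR_surj (y : R_ alpha).
  rewrite -[x]/((x : R_ alpha) : froot) -fE -[y]/((y : R_ alpha) : froot) -f'E !hRE.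
  rewrite -[LHS](_ : hR (piR (a' ^+ q * f + f') : froot) = _); last first.
    by rewrite rmorphD rmorphM rmorphXn /= aE.
  rewrite hRE -aE -[_ *: _]rmorphM -rmorphD; congr piR.
  rewrite /hS mulrDr (pi_D char2) mulrCA (pi_frobM char2); ring.
pose hL' : {linear froot -> (R_ alpha)^o} :=
  HB.pack hR (GRing.isLinear.Build (R_ alpha) froot (R_ alpha)^o *:%R hR hL).
exists hL' => a.
rewrite linearZ /= -[X in _ *: X]/(hR (piR r : froot)) hRE /hS mulrC wE rmorph1.
exact: mulr1.
Qed.

(** Fedder's criterion: the splitting ideal is (Jq : G^(q-1)) modulo G. *)
Lemma splitting_ideal_piR r :
  splitting_ideal (R_pchar alpha char2) e (piR r) <->
  tau e r \in lker (act e (G5 ^+ Q)).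
Proof.
rewrite memv_ker act_tau; split=> [hr|/eqP/tau_eq0]; last exact: not_splits_Jq.
apply/eqP/tau_eq0; apply: contrapT => hJ; exact: splits_not_Jq hJ hr.
Qed.

End Fedder.

(** * Substitution in power series *)

Section Order.
Variables (n : nat) (R : comNzRingType).
Implicit Types (p r : {mpoly R[n]}).

Definition ord_ge (d : nat) p := forall m, (mdeg m < d)%N -> p@_m = 0.

Lemma ord_geM a b p r : ord_ge a p -> ord_ge b r -> ord_ge (a + b) (p * r).
Proof.
move=> hp hr m md; rewrite mcoeffM big1 // => -[c d] /= /eqP mE.
have := mE => /(congr1 (@mdeg n)); rewrite mdegD => dE.
case: (ltnP (mdeg c) a) => ca; first by rewrite hp ?mul0r.
by rewrite hr ?mulr0 //; rewrite dE in md; lia.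
Qed.

Lemma ord_geX a i p : ord_ge a p -> ord_ge (a * i) (p ^+ i).
Proof.
move=> hp; elim: i => [|i IH]; first by rewrite muln0.
by rewrite mulnS exprS; apply: ord_geM.
Qed.

Lemma ord_ge_prod (I : Type) (r : seq I) (F : I -> {mpoly R[n]}) (c : I -> nat) :
  (forall i, ord_ge (c i) (F i)) -> ord_ge (\sum_(i <- r) c i) (\prod_(i <- r) F i).
Proof.
move=> hF; elim/big_rec2: _ => [|i d p _ IH]; first by [].
exact: ord_geM.
Qed.

End Order.

(** Substitution of polynomials without constant term in power series: each
    coefficient of the result only depends on a truncation of the series. *)
Section Substitution.
Variables (n m : nat) (R : comNzRingType) (s : n.-tuple {mpoly R[m]}).
Hypothesis s0 : forall i, (tnth s i)@_0%MM = 0.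
Implicit Types (f g : fps n R) (p : {mpoly R[n]}).

Definition subst f : fps m R := fun b => (fps_trunc (mdeg b).+1 f \mPo s)@_b.

Lemma ord_ge_comp d p : ord_ge d p -> ord_ge d (p \mPo s).
Proof.
move=> hp b bd; rewrite comp_mpolyE raddf_sum /=; apply: big1_seq => c /= cp.
rewrite mcoeffZ; case: (ltnP (mdeg c) d) => cd; first by rewrite hp ?mul0r.
suff -> : (\prod_(i < n) tnth s i ^+ c i)@_b = 0 by rewrite mulr0.
apply: (@ord_ge_prod _ _ _ _ _ (fun i => 1 * c i)%N) => [i|].
  apply: ord_geX => a; rewrite ltnS leqn0 mdeg_eq0 => /eqP ->; exact: s0.
by under eq_bigr do rewrite mul1n; rewrite -mdegE (leq_trans bd).
Qed.

Lemma comp_local d p p' : (forall a, (mdeg a < d)%N -> p@_a = p'@_a) ->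
  forall b, (mdeg b < d)%N -> (p \mPo s)@_b = (p' \mPo s)@_b.
Proof.
move=> pp' b bd; apply/eqP; rewrite -subr_eq0 -mcoeffB -raddfB.
by rewrite (@ord_ge_comp d) // => a ad; rewrite mcoeffB pp' ?subrr.
Qed.

Lemma subst_coef d f b : (mdeg b < d)%N -> subst f b = (fps_trunc d f \mPo s)@_b.
Proof.
move=> bd; apply: (@comp_local (mdeg b).+1) => // a ab.
by rewrite !fps_truncE // (leq_trans ab).
Qed.

Lemma subst_poly p : subst (fps_of_mpoly p) = fps_of_mpoly (p \mPo s).
Proof.
apply: fpsP => b; rewrite /subst.
by apply: (@comp_local (mdeg b).+1) => // a ab; rewrite fps_truncE.
Qed.

Lemma substB f g : subst (f - g) = subst f - subst g.
Proof.
apply: fpsP => b; rewrite fps_coefB /subst -mcoeffB -raddfB.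
apply: (@comp_local (mdeg b).+1) => // a ab.
by rewrite mcoeffB !fps_truncE.
Qed.

Lemma substM f g : subst (f * g) = subst f * subst g.
Proof.
apply: fpsP => b; rewrite (@fps_coefM _ _ (mdeg b).+1) // {1}/subst.
rewrite (@comp_local (mdeg b).+1 _
  (fps_trunc (mdeg b).+1 f * fps_trunc (mdeg b).+1 g)) //; last first.
  by move=> a ab; rewrite fps_truncE // (fps_coefM _ _ ab).
rewrite rmorphM; apply: mcoeffM_local => a ab.
  by rewrite fps_truncE // (@subst_coef (mdeg b).+1).
by rewrite fps_truncE // (@subst_coef (mdeg b).+1).
Qed.

Lemma subst1 : subst 1 = 1.
Proof.
rewrite -(rmorph1 (@fps_of_mpoly n R)) subst_poly.
by rewrite -mpolyC1 comp_mpolyC mpolyC1 rmorph1.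
Qed.

Lemma subst0 : subst 0 = 0.
Proof. by rewrite -(subrr 0) substB subrr. Qed.

Lemma substD f g : subst (f + g) = subst f + subst g.
Proof.
have -> : f + g = f - (0 - g) by rewrite sub0r opprK.
by rewrite !substB subst0 sub0r opprK.
Qed.

Lemma subst_X i : subst (fps_of_mpoly 'X_i) = fps_of_mpoly (tnth s i).
Proof. by rewrite subst_poly comp_mpolyXU -tnth_nth. Qed.

End Substitution.

Definition comp_tuple n m l (R : comNzRingType) (s : n.-tuple {mpoly R[m]})
  (t : m.-tuple {mpoly R[l]}) : n.-tuple {mpoly R[l]} := [tuple tnth s i \mPo t | i < n].

Lemma comp_comp n m l (R : comNzRingType) (s : n.-tuple {mpoly R[m]})
    (t : m.-tuple {mpoly R[l]}) p :
  (p \mPo s) \mPo t = p \mPo comp_tuple s t.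
Proof.
rewrite !(comp_mpolyE p) raddf_sum /=; apply: eq_bigr => a _.
rewrite comp_mpolyZ rmorph_prod /=; congr (_ *: _); apply: eq_bigr => i _.
by rewrite rmorphXn /= tnth_mktuple.
Qed.

(** The coefficients up to a given degree only see a truncation, where this is
    the associativity of polynomial composition. *)
Lemma subst_subst n m l (R : comNzRingType) (s : n.-tuple {mpoly R[m]})
    (t : m.-tuple {mpoly R[l]}) (f : fps n R) :
  (forall i, (tnth s i)@_0%MM = 0) -> (forall i, (tnth t i)@_0%MM = 0) ->
  subst t (subst s f) = subst (comp_tuple s t) f.
Proof.
move=> s0 t0; apply: fpsP => b; rewrite {1}/subst [RHS]/subst -comp_comp.
apply: (comp_local t0 (d := (mdeg b).+1)) => // a ab.
by rewrite fps_truncE // (subst_coef s0 f ab).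
Qed.

Lemma subst_id n (R : comNzRingType) (s : n.-tuple {mpoly R[n]}) (f : fps n R) :
  (forall i, tnth s i = 'X_i) -> subst s f = f.
Proof.
move=> sX; have -> : s = [tuple 'X_i | i < n].
  by apply: eq_from_tnth => i; rewrite sX tnth_mktuple.
by apply: fpsP => b; rewrite /subst comp_mpoly_id fps_truncE.
Qed.

(** * Weierstrass division *)

Section Subrings.
Variables (n : nat) (k : fieldType).
Implicit Types (f g h x y q : fps n k) (m a b : 'X_{1..n}).

Definition involves_ge (e : nat) m := [exists i : 'I_n, (e <= i)%N && (m i != 0%N)].

Lemma involves_geD e a b : involves_ge e (a + b)%MM = involves_ge e a || involves_ge e b.
Proof.
apply/existsP/orP => [[i /andP[ei]]|[|] /existsP[i /andP[ei h]]].
- rewrite mnmDE addn_eq0 negb_and => /orP[h|h].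
    by left; apply/existsP; exists i; rewrite ei.
  by right; apply/existsP; exists i; rewrite ei.
- by exists i; rewrite ei mnmDE addn_eq0 negb_and h.
- by exists i; rewrite ei mnmDE addn_eq0 negb_and h orbT.
Qed.

Lemma involves_geP e m : ~~ involves_ge e m -> forall i : 'I_n, (e <= i)%N -> m i = 0%N.
Proof.
move=> /existsPn h i ei; have := h i; rewrite ei /= negbK; exact: eqP.
Qed.

Lemma involves_ge_le e e' m : (e <= e')%N -> involves_ge e' m -> involves_ge e m.
Proof.
move=> ee /existsP[i /andP[ei h]]; apply/existsP; exists i.
by rewrite (leq_trans ee ei).
Qed.

Definition cut (e : nat) f : fps n k := fun m => if involves_ge e m then 0 else f m.

Definition vars_lt (e : nat) : {pred fps n k} := fun f => `[< forall m, involves_ge e m -> f m = 0 >].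

Lemma vars_ltP e f : reflect (forall m, involves_ge e m -> f m = 0) (f \in vars_lt e).
Proof. exact: asboolP. Qed.

Lemma cut_vars_lt e f : cut e f \in vars_lt e.
Proof. by apply/vars_ltP => m hm; rewrite /cut hm. Qed.

Lemma cut_id e f : f \in vars_lt e -> cut e f = f.
Proof. by move=> /vars_ltP hf; apply: fpsP => m; rewrite /cut; case: ifP => // /hf. Qed.

Lemma cutM e q f : f \in vars_lt e -> cut e (q * f) = cut e q * f.
Proof.
move=> /vars_ltP hf; apply: fpsP => m; rewrite {1}/cut.
rewrite -[q * f]/(fps_mul q f) -[cut e q * f]/(fps_mul (cut e q) f) /fps_mul.
case: ifP => hm.
  rewrite big1 // => -[a b] /= /eqP mE; rewrite /cut.
  have := congr1 (involves_ge e) mE; rewrite hm involves_geD => /esym/orP[->|/hf ->]; first by rewrite mul0r.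
  by rewrite mulr0.
apply: eq_bigr => -[a b] /= /eqP mE; rewrite /cut.
by have := congr1 (involves_ge e) mE; rewrite hm involves_geD => /esym/negbT; rewrite negb_or => /andP[/negPf-> _].
Qed.

Lemma cutD e x y : cut e (x + y) = cut e x + cut e y.
Proof.
by apply: fpsP => m; rewrite fps_coefD /cut; case: ifP => //; rewrite addr0.
Qed.

Fact vars_lt_subring e : subring_closed (vars_lt e).
Proof.
split.
- apply/vars_ltP => m /existsP[i /andP[_ mi]].
  rewrite -[LHS]/((m == 0%MM)%:R) (_ : (m == 0%MM) = false) //.
  by apply/eqP => m0; rewrite m0 mnm0E in mi.
- by move=> x y /vars_ltP hx /vars_ltP hy; apply/vars_ltP => m hm; rewrite fps_coefB hx ?hy ?subrr.
- move=> x y hx hy; rewrite -(cut_id hx) -cutM //; exact: cut_vars_lt.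
Qed.

HB.instance Definition _ e := GRing.isSubringClosed.Build (fps n k) (vars_lt e) (vars_lt_subring e).

Lemma vars_lt_le e e' f : (e <= e')%N -> f \in vars_lt e -> f \in vars_lt e'.
Proof. by move=> ee /vars_ltP hf; apply/vars_ltP => m /(involves_ge_le ee)/hf. Qed.

End Subrings.

Section Weierstrass.
Variables (n : nat) (k : fieldType) (z : 'I_n).
Implicit Types (f g x y q r : fps n k) (m a b : 'X_{1..n}).

Local Notation Z j := (U_(z) *+ j)%MM.

Lemma Zz j : (Z j) z = j.
Proof. by rewrite mulmnE mnm1E eqxx mul1n. Qed.

Lemma Zle j m : (Z j <= m)%MM = (j <= m z)%N.
Proof.
apply/mnm_lepP/idP => [/(_ z)|jm i]; first by rewrite Zz.
by rewrite mulmnE mnm1E; case: eqP => [<-|]; rewrite ?mul1n ?mul0n.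
Qed.

(** The degree in the other variables, which is the level of contraction. *)
Definition lev m := (\sum_(i | i != z) m i)%N.

Lemma levD a b : lev (a + b)%MM = (lev a + lev b)%N.
Proof. by rewrite /lev -big_split; apply: eq_bigr => i _; rewrite mnmDE. Qed.

Lemma levZ j : lev (Z j) = 0%N.
Proof.
rewrite /lev big1 // => i iz.
by rewrite mulmnE mnm1E eq_sym (negPf iz).
Qed.

Lemma lev0 m : lev m = 0%N -> m = Z (m z).
Proof.
move=> /eqP; rewrite /lev sum_nat_eq0 => /forallP h; apply/mnmP => i.
have := h i; rewrite mulmnE mnm1E; case: (eqVneq i z) => [-> _|iz /eqP ->].
  by rewrite mul1n.
by rewrite mul0n.
Qed.

(** The quotient of f by z^j, the low part being the remainder. *)
Definition shift j f : fps n k := fun m => f (m + Z j)%MM.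
Definition low j f : fps n k := fun m => if (m z < j)%N then f m else 0.

Lemma low_shift j f : f = low j f + fps_of_mpoly 'X_[Z j] * shift j f.
Proof.
apply: fpsP => m; rewrite fps_coefD fps_coefXM /low Zle /shift; case: ltnP => mj.
  by rewrite addr0.
by rewrite submK ?Zle // add0r.
Qed.

Lemma shiftB j f g : shift j (f - g) = shift j f - shift j g.
Proof. by []. Qed.

Lemma shiftD j f g : shift j (f + g) = shift j f + shift j g.
Proof. by []. Qed.

Lemma shiftXM j f : shift j (fps_of_mpoly 'X_[Z j] * f) = f.
Proof.
apply: fpsP => m; rewrite /shift fps_coefXM Zle mnmDE Zz leq_addl.
by rewrite addmK.
Qed.

Lemma shiftXMl j f g : shift j (g * (fps_of_mpoly 'X_[Z j] * f)) = g * f.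
Proof. by rewrite mulrCA shiftXM. Qed.

Lemma vanishM N g x : (forall m, (lev m < N)%N -> x m = 0) ->
  forall m, (lev m < N)%N -> (g * x) m = 0.
Proof.
move=> hx m mN; rewrite -[g * x]/(fps_mul g x) /fps_mul big1 // => -[a b] /= /eqP mE.
have := congr1 lev mE; rewrite levD => lE.
by rewrite hx ?mulr0 //; lia.
Qed.

(** For f regular of order h in z, the part of f of z-degree < h lies in the
    ideal of the other variables, so it raises the level. *)
Lemma vanish_lowM h f N x : (forall j, (j < h)%N -> f (Z j) = 0) ->
  (forall m, (lev m < N)%N -> x m = 0) ->
  forall m, (lev m <= N)%N -> (x * low h f) m = 0.
Proof.
move=> f0 hx m mN; rewrite -[x * _]/(fps_mul x (low h f)) /fps_mul.
rewrite big1 // => -[a b] /= /eqP mE.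
have := congr1 lev mE; rewrite levD => lE.
case: (posnP (lev b)) => [b0|b0]; last by rewrite hx ?mul0r //; lia.
rewrite /low; case: ifP => bh; rewrite ?mulr0 //.
by rewrite (lev0 b0) f0 ?mulr0.
Qed.

(** The quotient solves shift (q f) = shift g. The shift of f is a unit, with
    inverse v; moving the low part of f to the right-hand side gives a
    contraction for q. *)
Lemma weierstrass_division f h g : (forall j, (j < h)%N -> f (Z j) = 0) ->
  f (Z h) != 0 ->
  exists q r, g = q * f + r /\ forall m, (h <= m z)%N -> r m = 0.
Proof.
move=> f0 fh.
have [v vE] : exists v, shift h f * v = 1.
  by apply: fps_unit; rewrite /shift add0m.
have [|q qE] := @fps_contraction_fixpoint n k lev
  (fun q => v * (shift h g - shift h (q * low h f))).
  move=> N q q' qq' m mN; apply/eqP; rewrite -subr_eq0 -fps_coefB -mulrBr.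
  rewrite [X in v * X](_ : _ = shift h ((q' - q) * low h f)); last first.
    by rewrite mulrBl shiftB; ring.
  apply/eqP; apply: (@vanishM N.+1) => // a aN; rewrite /shift.
  apply: (@vanish_lowM h f N) => // [b bN|]; last by rewrite levD levZ addn0.
  by rewrite fps_coefB qq' ?subrr.
exists q, (g - q * f); split; first by ring.
move=> m hm; have : shift h (g - q * f) = 0.
  rewrite shiftB [X in q * X](low_shift h f) mulrDr shiftD shiftXMl.
  rewrite -[X in X * shift h f]qE mulrAC [v * _]mulrC vE; ring.
by move=> /(congr1 (@^~ (m - Z h)%MM)); rewrite /shift submK ?Zle.
Qed.

Lemma low_expand h r : (forall m, (h <= m z)%N -> r m = 0) -> r \in vars_lt z.+1 ->
  exists2 c : 'I_h -> fps n k, (forall j, c j \in vars_lt z) &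
    r = \sum_j c j * fps_of_mpoly 'X_z ^+ j.
Proof.
move=> rh /vars_ltP rS.
exists (fun j m => if m z == 0%N then r (m + Z j)%MM else 0).
  move=> j; apply/vars_ltP => m /existsP[i /andP[zi mi]]; case: eqP => // mz.
  apply: rS; apply/existsP; exists i; rewrite mnmDE addn_eq0 negb_and mi andbT.
  rewrite ltn_neqAle zi andbT; apply: contraNneq mi => zi'.
  by rewrite -(val_inj zi') mz.
apply: fpsP => m; rewrite fps_coef_sum.
under eq_bigr => j _ do rewrite -rmorphXn /= mpolyXn mulrC fps_coefXM Zle mnmBE Zz.
case: (ltnP (m z) h) => mh.
  rewrite (bigD1 (Ordinal mh)) //= leqnn subnn eqxx submK ?Zle // big1 ?addr0 // => j jm.
  case: ifP => // jz; case: eqP => // /eqP; rewrite subn_eq0 => zj.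
  by case/eqP: jm; apply/val_inj/eqP; rewrite /= eqn_leq jz.
rewrite rh // big1 // => j _; case: ifP => // jz; case: eqP => // /eqP.
by rewrite subn_eq0 => zj; have := ltn_ord j; lia.
Qed.

(** Modulo a series regular in z, the series in the variables up to z are
    integral over those in the variables before z. *)
Lemma monic_relation f h (b : fps n k) : f \in vars_lt z.+1 -> b \in vars_lt z.+1 ->
  (forall j, (j < h)%N -> f (Z j) = 0) -> f (Z h) != 0 ->
  exists N (c : nat -> fps n k), [/\ forall i, c i \in vars_lt z &
    exists2 q, q \in vars_lt z.+1 & \sum_(i < N) c i * b ^+ i + b ^+ N = q * f].
Proof.
move=> fS bS f0 fh.
pose zz : fps n k := fps_of_mpoly 'X_z.
have zS : zz \in vars_lt z.+1.
  apply/vars_ltP => m /existsP[i /andP[zi mi]]; rewrite /zz fps_of_mpolyE mcoeffX.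
  case: eqP => // mE; have zni : (z == i) = false by rewrite -val_eqE ltn_eqF.
  by move: mi; rewrite -mE mnm1E zni.
have div g : g \in vars_lt z.+1 -> exists q (c : 'I_h -> fps n k),
    (forall j, c j \in vars_lt z) /\ g = q * f + \sum_j c j * zz ^+ j.
  move=> gS; have [q [r [gE rh]]] := weierstrass_division g f0 fh.
  have [|c cS cE] := @low_expand h (cut z.+1 r) _ (cut_vars_lt _ _).
    by move=> m hm; rewrite /cut rh ?if_same.
  by exists (cut z.+1 q), c; split=> //; rewrite -cE -cutM // -cutD -gE cut_id.
case: h f0 fh div => [|h] f0 fh div.
  have [q [c [_]]] := div 1 (rpred1 _); rewrite big_ord0 addr0 => E.
  exists 0%N, (fun=> 0); split; first by move=> _; apply: rpred0.
  exists (cut z.+1 q); first exact: cut_vars_lt.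
  by rewrite big_ord0 add0r expr0 -cutM // -E cut_id ?rpred1.
have : forall j : 'I_h.+1, exists qc : fps n k * ('I_h.+1 -> fps n k),
    (forall j, qc.2 j \in vars_lt z) /\ b * zz ^+ j = qc.1 * f + \sum_j qc.2 j * zz ^+ j.
  move=> j; have [q [c cE]] := div (b * zz ^+ j) (rpredM bS (rpredX _ zS)).
  by exists (q, c).
move=> /choice[qc qcE].
pose C : 'M[fps n k]_h.+1 := \matrix_(i, j) (qc i).2 j.
pose v : 'cV[fps n k]_h.+1 := \col_j zz ^+ j.
pose w : 'cV[fps n k]_h.+1 := \col_j (qc j).1.
(* The determinant trick: C is the matrix of b on 1, z, ..., z^h modulo f, and
   its characteristic polynomial vanishes at b modulo f. *)
have Mv : (b%:M - C) *m v = f *: w.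
  rewrite mulmxBl mul_scalar_mx; apply/matrixP => i j; rewrite !mxE.
  have [_ ->] := qcE i; rewrite [X in _ - X](eq_bigr (fun l => (qc i).2 l * zz ^+ l)).
    by rewrite addrK mulrC.
  by move=> l _; rewrite !mxE.
pose p := char_poly C.
have pE : p.[b] = \det (b%:M - C).
  rewrite /p /char_poly -horner_evalE -det_map_mx; congr (\det _).
  apply/matrixP => i j; rewrite !mxE rmorphB rmorphMn /=.
  by rewrite /horner_eval hornerX hornerC.
have pS : p \is a polyOver (vars_lt z).
  rewrite /p /char_poly /determinant; apply: rpred_sum => s _.
  rewrite rpredMsign; apply: rpred_prod => i _; rewrite !mxE.
  rewrite rpredB ?rpredMn ?polyOverX // polyOverC.
  by have [] := qcE i.
have pb : p.[b] = f * (\adj (b%:M - C) *m w) ord0 ord0.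
  have := congr1 (mulmx (\adj (b%:M - C))) Mv; rewrite mulmxA mul_adj_mx -pE.
  rewrite mul_scalar_mx -scalemxAr => /matrixP/(_ ord0 ord0).
  by rewrite !mxE expr0 mulr1.
have pm : p \is monic := char_poly_monic C.
have sp : size p = h.+2 := size_char_poly C.
exists h.+1, (fun i => p`_i); split; first by move=> i; apply: (polyOverP pS).
exists (cut z.+1 ((\adj (b%:M - C) *m w) ord0 ord0)); first exact: cut_vars_lt.
rewrite -cutM // [X in cut _ X]mulrC -pb.
have pE' : p.[b] = \sum_(i < h.+1) p`_i * b ^+ i + b ^+ h.+1.
  rewrite horner_coef sp big_ord_recr /=; congr (_ + _).
  by move/monicP: pm; rewrite /lead_coef sp /= => ->; rewrite mul1r.
rewrite -pE' cut_id // pE' rpredD ?rpredX // rpred_sum // => i _.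
rewrite rpredM ?rpredX // (vars_lt_le (leqnSn z)) //; exact: (polyOverP pS).
Qed.

End Weierstrass.

(** * Making a series regular in one variable *)

Section Regularisation.
Variables (n : nat) (k : fieldType) (z : 'I_n).
Implicit Types (f g x y q r : fps n k) (m a b : 'X_{1..n}).
Local Notation Z j := (U_(z) *+ j)%MM.

(** By induction on t: among the monomials of f that agree with a before t, take
    one whose exponent at t is least. *)
Lemma lex_min f t : f != 0 -> exists2 a, f a != 0 & forall b, f b != 0 ->
  (forall l : 'I_n, (l < t)%N -> b l = a l) \/
  exists j : 'I_n, [/\ (j < t)%N, (a j < b j)%N & forall l : 'I_n, (l < j)%N -> b l = a l].
Proof.
move=> f0; elim: t => [|t [a fa ha]].
  by have [a fa _] := fps_min_supp f0; exists a => // b _; left.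
case: (ltnP t n) => tn; last first.
  exists a => // b /ha[h|[j [jt ab h]]]; last by right; exists j; split=> //; exact: leqW.
  by left=> l _; apply: h; apply: leq_trans (ltn_ord l) tn.
pose tt := Ordinal tn.
pose P v := `[< exists b, [/\ f b != 0, forall l : 'I_n, (l < t)%N -> b l = a l & b tt = v] >].
have exP : exists v, P v by exists (a tt); apply/asboolP; exists a.
case: (ex_minnP exP) => v /asboolP[a' [fa' a'a a'v]] vmin; exists a' => // b fb.
have [h|[j [jt ab h]]] := ha b fb; last first.
  right; exists j; split; [exact: leqW|by rewrite a'a|].
  by move=> l lj; rewrite h // a'a // (ltn_trans lj).
have : (v <= b tt)%N by apply: vmin; apply/asboolP; exists b.
rewrite leq_eqVlt => /orP[/eqP vb|vb]; [left|right].
  move=> l; rewrite ltnS leq_eqVlt => /orP[/eqP lt|lt]; last by rewrite h // a'a.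
  have -> : l = tt by apply/val_inj.
  by rewrite a'v vb.
exists tt; split=> //; first by rewrite a'v.
by move=> l lt; rewrite h // a'a.
Qed.

(** Weights for which the lexicographic order on the monomials with exponents
    smaller than K is the order by weight; the variable z has weight 1. *)
Definition wt (K : nat) (i : 'I_n) : nat := K ^ (z - i).
Definition weight K a := (\sum_(i < n | (i <= z)%N) a i * wt K i)%N.

(** The base K exceeds every exponent of a, so the first difference dominates. *)
Lemma weight_lt a b (j : 'I_n) : (j <= z)%N -> (a j < b j)%N ->
  (forall l : 'I_n, (l < j)%N -> b l = a l) ->
  (weight (mdeg a).+1 a < weight (mdeg a).+1 b)%N.
Proof.
move=> jz ab h; set K := (mdeg a).+1.
rewrite /weight (bigID (fun i : 'I_n => (i < j)%N)) /= [X in (_ < X)%N](bigID (fun i : 'I_n => (i < j)%N)) /=.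
rewrite [X in (_ < X + _)%N](eq_bigr (fun i => a i * wt K i)%N); last first.
  by move=> i /andP[_ ij]; rewrite h.
rewrite ltn_add2l (bigD1 j) /= ?ltnn ?jz // [X in (_ < X)%N](bigD1 j) /= ?ltnn ?jz //.
apply: (@leq_trans (a j * wt K j + wt K j)%N); last first.
  by rewrite -mulSnr (leq_trans _ (leq_addr _ _)) // leq_mul2r ab orbT.
rewrite ltn_add2l; case: (ltngtP j z) jz => // [jz _|jz _]; last first.
  rewrite big1 ?expn_gt0 // => i /andP[/andP[iz]]; rewrite -leqNgt => ji.
  by rewrite -val_eqE /= eqn_leq ji jz iz.
apply: (@leq_ltn_trans (\sum_i a i * K ^ (z - j.+1))%N).
  rewrite big_mkcond; apply: leq_sum => i _; case: ifP => // /andP[/andP[iz]].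
  rewrite -leqNgt => ji ij; rewrite leq_mul2l leq_pexp2l ?orbT // leq_sub2l //.
  by rewrite ltn_neqAle ji andbT eq_sym.
rewrite -big_distrl -mdegE /= /wt -(subnSK jz) expnS ltn_pmul2r ?expn_gt0 //.
Qed.

(** The map X^a -> z^(weight of a), to the series in z alone. *)
Definition plane (K : nat) : n.-tuple {mpoly k[n]} :=
  [tuple if (i <= z)%N then 'X_z ^+ wt K i else 0 | i < n].

Lemma plane0 K : (0 < K)%N -> forall i, (tnth (plane K) i)@_0%MM = 0.
Proof.
move=> K0 i; rewrite tnth_mktuple; case: ifP => _; last exact: mcoeff0.
rewrite mcoeffXn (_ : (_ == _) = false) //; apply/eqP => /mnmP/(_ z).
by rewrite Zz mnm0E => /eqP; rewrite expn_eq0 eqn0Ngt K0.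
Qed.

Lemma plane_mon K a : ~~ involves_ge z.+1 a ->
  'X_[a] \mPo plane K = 'X_[Z (weight K a)].
Proof.
move=> /involves_geP aS; rewrite comp_mpolyX -mpolyXn /weight expr_sum [RHS]big_mkcond /=.
apply: eq_bigr => i _; rewrite tnth_mktuple; case: ifP => iz.
  by rewrite -exprM mulnC.
by rewrite aS ?expr0 // ltnNge iz.
Qed.

Lemma subst_sum (s : n.-tuple {mpoly k[n]}) f d m :
  (forall i, (tnth s i)@_0%MM = 0) -> (mdeg m < d)%N ->
  subst s f m = \sum_(a : 'X_{1..n < d}) f a * ('X_[a] \mPo s)@_m.
Proof.
move=> s0 md; rewrite (subst_coef s0 f md) /fps_trunc.
rewrite (raddf_sum (comp_mpoly s)) (raddf_sum (mcoeff m)) /=.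
by apply: eq_bigr => a _; rewrite comp_mpolyZ mcoeffZ.
Qed.

(** For the lexicographically least monomial a, no other monomial of f has the
    weight of a. *)
Lemma subst_plane f : f \in vars_lt z.+1 -> f != 0 -> exists2 a,
  f a != 0 & subst (plane (mdeg a).+1) f (Z (weight (mdeg a).+1 a)) = f a.
Proof.
move=> /vars_ltP fS /(lex_min z.+1)[a fa ha]; exists a => //; set K := (mdeg a).+1.
set h := weight K a; pose d := (h + mdeg a).+1.
have hd : (mdeg (Z h) < d)%N by rewrite mdegMn mdeg1 mul1n /d; lia.
have ad : (mdeg a < d)%N by rewrite /d; lia.
have goodP b : f b != 0 -> ~~ involves_ge z.+1 b by apply: contraNN => /fS ->.
rewrite (subst_sum _ (@plane0 K _) hd) // (bigD1 (BMultinom ad)) //=.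
rewrite plane_mon ?goodP // mcoeffX eqxx mulr1 big1 ?addr0 // => b ba.
case: (eqVneq (f b) 0) => [->|fb]; first by rewrite mul0r.
rewrite plane_mon ?goodP // mcoeffX (_ : (_ == _) = false) ?mulr0 //.
apply/negP => /eqP/mnmP/(_ z); rewrite !Zz => hE.
have [E|[j [jz ab E]]] := ha b fb.
  case/eqP: ba; apply/val_inj/mnmP => l /=.
  case: (ltnP l z.+1) => lz; first exact: E.
  by rewrite (involves_geP (goodP _ fb) lz) (involves_geP (goodP _ fa) lz).
by have := weight_lt jz ab E; rewrite -/K hE ltnn.
Qed.

Definition axis : n.-tuple {mpoly k[n]} := [tuple if i == z then 'X_z else 0 | i < n].

Lemma axis0 i : (tnth axis i)@_0%MM = 0.
Proof.
by rewrite tnth_mktuple; case: ifP => _; rewrite ?mcoeff0 // mcoeffX mnm1_eq0.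
Qed.

Lemma subst_axis f h : subst axis f (Z h) = f (Z h).
Proof.
have hd : (mdeg (Z h) < h.+1)%N by rewrite mdegMn mdeg1 mul1n.
rewrite (subst_sum _ axis0 hd) (bigD1 (BMultinom hd)) //= big1 => [|a ah].
  rewrite addr0 comp_mpolyX (bigD1 z) //= tnth_mktuple eqxx Zz big1 => [|i /negPf iz].
    by rewrite mulr1 mpolyXn mcoeffX eqxx mulr1.
  by rewrite tnth_mktuple iz mulmnE mnm1E eq_sym iz mul0n expr0.
suff -> : ('X_[a] \mPo axis)@_(Z h) = 0 by rewrite mulr0.
rewrite comp_mpolyX (bigD1 z) //= tnth_mktuple eqxx.
case: (posnP (lev z a)) => [/lev0 aE|].
  rewrite big1 => [|i /negPf iz]; last first.
    by rewrite tnth_mktuple iz aE mulmnE mnm1E eq_sym iz mul0n expr0.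
  rewrite mulr1 mcoeffXn (_ : (_ == _) = false) //; apply/eqP => E.
  by case/eqP: ah; apply/val_inj; rewrite /= aE.
rewrite lt0n /lev sum_nat_eq0 negb_forall => /existsP[i].
rewrite negb_imply => /andP[iz ai].
by rewrite (bigD1 i) //= tnth_mktuple (negPf iz) expr0n (negPf ai) mul0r mulr0 mcoeff0.
Qed.

(** For eps = 1 the shear X_i -> X_i + X_z^(w_i), for eps = -1 its inverse. *)
Definition shear (eps : k) (K : nat) : n.-tuple {mpoly k[n]} :=
  [tuple if (i < z)%N then 'X_i + eps *: 'X_z ^+ wt K i else 'X_i | i < n].

Lemma shear0 eps K : (0 < K)%N -> forall i, (tnth (shear eps K) i)@_0%MM = 0.
Proof.
move=> K0 i; rewrite tnth_mktuple; case: ifP => _; last by rewrite mcoeffX mnm1_eq0.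
rewrite mcoeffD mcoeffX mnm1_eq0 add0r mcoeffZ mcoeffXn (_ : (_ == _) = false) ?mulr0 //.
apply/eqP => /mnmP/(_ z).
by rewrite Zz mnm0E => /eqP; rewrite expn_eq0 eqn0Ngt K0.
Qed.

Lemma comp_XU (s : n.-tuple {mpoly k[n]}) i : 'X_i \mPo s = tnth s i.
Proof. by rewrite comp_mpolyXU -tnth_nth. Qed.

Lemma shearK eps K f : (0 < K)%N -> subst (shear (- eps) K) (subst (shear eps K) f) = f.
Proof.
move=> K0; rewrite subst_subst; [|exact: shear0|exact: shear0].
apply: subst_id => i; rewrite !tnth_mktuple; case: ifP => iz; last first.
  by rewrite comp_XU tnth_mktuple iz.
rewrite raddfD /= comp_XU tnth_mktuple iz comp_mpolyZ rmorphXn /= comp_XU.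
by rewrite tnth_mktuple ltnn scaleNr subrK.
Qed.

Lemma shear_axis K : comp_tuple (shear 1 K) axis = plane K.
Proof.
apply: eq_from_tnth => i; rewrite !tnth_mktuple; case: (ltngtP i z) => iz.
- rewrite raddfD /= comp_XU tnth_mktuple -val_eqE /= (ltn_eqF iz) add0r.
  by rewrite scale1r rmorphXn /= comp_XU tnth_mktuple eqxx.
- by rewrite comp_XU tnth_mktuple -val_eqE /= (gtn_eqF iz).
- by rewrite comp_XU tnth_mktuple -val_eqE /= iz eqxx /wt iz subnn expr1.
Qed.

Lemma shear_vars_lt eps K f : (0 < K)%N -> f \in vars_lt z.+1 -> subst (shear eps K) f \in vars_lt z.+1.
Proof.
move=> K0 /vars_ltP fS; apply/vars_ltP => m hm.
rewrite (subst_sum f (shear0 eps K0) (ltnSn _)) big1 // => a _.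
have [/fS->|/involves_geP aS] := boolP (involves_ge z.+1 a); first by rewrite mul0r.
suff /vars_ltP/(_ m hm) : fps_of_mpoly ('X_[a] \mPo shear eps K) \in vars_lt z.+1.
  by rewrite fps_of_mpolyE => ->; rewrite mulr0.
rewrite comp_mpolyX rmorph_prod /=; apply: rpred_prod => i _; rewrite rmorphXn /=.
case: (ltnP i z.+1) => iz; last by rewrite aS // expr0 rpred1.
apply: rpredX; have XS (j : 'I_n) : (j <= z)%N -> fps_of_mpoly 'X_j \in vars_lt (n := n) (k := k) z.+1.
  move=> jz; apply/vars_ltP => b /existsP[l /andP[zl bl]]; rewrite fps_of_mpolyE mcoeffX.
  case: eqP => // bE; move: bl; rewrite -bE mnm1E.
  by have -> : (j == l) = false by rewrite -val_eqE ltn_eqF // (leq_ltn_trans jz).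
rewrite tnth_mktuple; case: ifP => _; last exact: XS.
rewrite rmorphD /= fpsCZ rmorphXn /= rpredD ?rpredM ?rpredX ?XS //.
by apply/vars_ltP => b /existsP[l /andP[zl bl]]; rewrite fps_coefC; case: eqP => [b0|_]; rewrite ?mulr0 //; rewrite b0 mnm0E in bl.
Qed.

(** Restricting the sheared series to the axis of z gives [plane]. *)
Lemma shear_regular f : f \in vars_lt z.+1 -> f != 0 -> exists K h, [/\ (0 < K)%N,
  forall j, (j < h)%N -> subst (shear 1 K) f (Z j) = 0 &
  subst (shear 1 K) f (Z h) != 0].
Proof.
move=> fS f0; have [a fa aE] := subst_plane fS f0; set K := (mdeg a).+1 in aE.
have exh : exists h, subst (shear 1 K) f (Z h) != 0.
  exists (weight K a).
  by rewrite -subst_axis subst_subst ?shear_axis ?aE //; [exact: shear0|exact: axis0].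
case: (ex_minnP exh) => h fh hmin; exists K, h; split=> // j jh.
by apply/eqP/negPn/negP => /hmin; rewrite leqNgt jh.
Qed.

End Regularisation.

(** * Chains of primes in power series rings *)

Section DimensionBound.
Variables (n : nat) (k : fieldType).
Implicit Types (f g x y : fps n k) (P : set (fps n k)).

(** Prime ideals of the subring of the series in the first e variables: keeping
    these subrings inside one ring makes the induction on e free of coercions. *)
Definition prime_in (e : nat) P :=
  [/\ forall x, P x -> x \in vars_lt e, P 0 /\ ~ P 1, forall x y, P x -> P y -> P (x + y),
      forall a x, a \in vars_lt e -> P x -> P (a * x) &
      forall x y, x \in vars_lt e -> y \in vars_lt e -> P (x * y) -> P x \/ P y].

(** Incomparability for integral extensions: b in P' but not in P satisfies a
    monic relation modulo P; its constant term is in the trace of P', hence in P,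
    and after division by b the degree drops. *)
Lemma incomparability (z : 'I_n) f h P P' :
  prime_in z.+1 P -> prime_in z.+1 P' -> P f ->
  (forall j, (j < h)%N -> f (U_(z) *+ j)%MM = 0) -> f (U_(z) *+ h)%MM != 0 ->
  P `<=` P' -> (forall c, c \in vars_lt z -> P' c -> P c) -> P' `<=` P.
Proof.
move=> [PS [P0 P1] PD PM Pp] [PS' [P0' P1'] PD' PM' _] Pf f0 fh PP' tr b P'b.
apply: contrapT => nPb; have bS := PS' b P'b.
have [N [c [cS [q qS E]]]] := monic_relation (PS f Pf) bS f0 fh.
have : P (\sum_(i < N) c i * b ^+ i + b ^+ N) by rewrite E; apply: PM.
have Sle (x : fps n k) : x \in vars_lt z -> x \in vars_lt z.+1 by apply: vars_lt_le.
move: cS {E}; elim: N c => [|N IH] c cS; first by rewrite big_ord0 add0r expr0.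
rewrite big_ord_recl expr0 mulr1 -addrA => hP.
set T := (X in c _ + X) in hP.
have TE : T = b * (\sum_(i < N) c i.+1 * b ^+ i + b ^+ N).
  rewrite /T exprS mulrDr mulr_sumr; congr (_ + _); apply: eq_bigr => i _.
  by rewrite /bump /= exprS mulrCA.
have TS : \sum_(i < N) c i.+1 * b ^+ i + b ^+ N \in vars_lt z.+1.
  by rewrite rpredD ?rpredX // rpred_sum // => i _; rewrite rpredM ?rpredX // Sle.
have P'T : P' T by rewrite TE mulrC; apply: PM'.
have Pc : P (c 0%N).
  apply: tr => //; rewrite -[c 0%N](addrK T); apply: PD'; first exact: PP'.
  by rewrite -mulN1r; apply: PM' => //; rewrite rpredN rpred1.
have PT : P T.
  rewrite -[T](addKr (c 0%N)); apply: PD => //.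
  by rewrite -mulN1r; apply: PM => //; rewrite rpredN rpred1.
rewrite TE in PT; have [//|] := Pp _ _ bS TS PT.
by apply: (IH (fun i => c i.+1)) => i; apply: cS.
Qed.

(** After a shear, the non-zero element f of the first prime is regular in the
    last variable z; the traces on the series without z then form a strict
    chain, whose second term contains a non-zero element. *)
Lemma prime_chain_bound e N (P : nat -> set (fps n k)) f : (e <= n)%N ->
  (forall i, (i <= N)%N -> prime_in e (P i)) ->
  (forall i, (i < N)%N -> P i `<` P i.+1) ->
  P 0%N f -> f != 0 -> (N < e)%N.
Proof.
elim: e N P f => [|e IH] N P f en Pp Plt Pf f0.
  have [PS [_ P1] _ PM _] := Pp 0%N isT; case: P1.
  have fS := PS f Pf.
  have fC : f = fpsC (f 0%MM).
    apply: fpsP => m; rewrite fps_coefC; case: eqP => [->|/eqP m0]; first by rewrite mulr1.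
    rewrite mulr0; apply: (vars_ltP _ _ fS); apply: contraNT m0 => /involves_geP hm.
    by apply/eqP/mnmP => i; rewrite hm // mnm0E.
  have fn0 : f 0%MM != 0.
    by apply: contraNneq f0 => f00; rewrite fC f00 /fpsC mpolyC0 rmorph0.
  have -> : (1 : fps n k) = fpsC (f 0%MM)^-1 * f.
    by rewrite [X in _ * X]fC /fpsC -rmorphM /= -mpolyCM mulVf // mpolyC1 rmorph1.
  apply: PM => //; apply/vars_ltP => m /existsP[i /andP[_ mi]].
  by rewrite fps_coefC; case: eqP => [m0|_]; rewrite ?mulr0 //; rewrite m0 mnm0E in mi.
pose z := Ordinal en.
have fS : f \in vars_lt z.+1 by have [PS _ _ _ _] := Pp 0%N isT; apply: PS.
have [K [h [K0 reg0 regh]]] := shear_regular fS f0.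
pose th := subst (shear (k := k) z 1 K); pose th' := subst (shear (k := k) z (- 1) K).
have s0 := shear0 z (1 : k) K0; have s0' := shear0 z (- 1 : k) K0.
have thK x : th' (th x) = x by apply: shearK.
have thK' x : th (th' x) = x.
  by rewrite /th -{1}[1]opprK; apply: shearK.
have thS x : x \in vars_lt z.+1 -> th x \in vars_lt z.+1 by apply: shear_vars_lt.
have thS' x : x \in vars_lt z.+1 -> th' x \in vars_lt z.+1 by apply: shear_vars_lt.
pose P' i : set (fps n k) := [set x | P i (th' x)].
have Pp' i : (i <= N)%N -> prime_in z.+1 (P' i).
  move=> iN; have [PS [P0 P1] PD PM Pr] := Pp i iN; split.
  - by move=> x /PS/thS; rewrite thK'.
  - by rewrite /P' /= /th' subst0 // subst1.
  - by move=> x y hx hy; rewrite /P' /= /th' substD //; apply: PD.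
  - by move=> a x aS hx; rewrite /P' /= /th' substM //; apply: PM => //; apply: thS'.
  - by move=> x y xS yS; rewrite /P' /= /th' substM //; apply: Pr; apply: thS'.
pose p i : set (fps n k) := [set x | x \in vars_lt z /\ P' i x].
have Plt' i : (i < N)%N -> P' i `<=` P' i.+1 /\ ~ (P' i.+1 `<=` P' i).
  move=> iN; have [sub nsub] := Plt i iN; split=> [x|h']; first exact: sub.
  by apply: nsub => x Px; rewrite -[x]thK; apply: h'; rewrite /P' /= thK.
have P'f i : (i <= N)%N -> P' i (th f).
  elim: i => [|i IHi] iN; first by rewrite /P' /= thK.
  by have [sub _] := Plt' i iN; apply/sub/IHi/ltnW.
have pp i : (i <= N)%N -> prime_in e (p i).
  move=> iN; have [PS [P0 P1] PD PM Pr] := Pp' i iN; split.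
  - by move=> x [].
  - by split; [split=> //; apply: rpred0|case].
  - by move=> x y [xS hx] [yS hy]; split; [apply: rpredD|apply: PD].
  - move=> a x aS [xS hx]; split; first exact: rpredM.
    by apply: PM => //; apply: vars_lt_le aS.
  - move=> x y xS yS [_ hxy]; have [||hx|hy] := Pr x y _ _ hxy.
    + exact: vars_lt_le xS.
    + exact: vars_lt_le yS.
    + by left.
    + by right.
have plt i : (i < N)%N -> p i `<` p i.+1.
  move=> iN; have [sub nsub] := Plt' i iN; split=> [x [xS hx]|h'].
    by split=> //; apply: sub.
  apply: nsub; apply: (incomparability (Pp' i (ltnW iN)) (Pp' i.+1 iN)
    (P'f i (ltnW iN)) reg0 regh sub) => c cS hc.
  by have [] := h' c (conj cS hc).
(* The induction applies to the traces from the second one on. *)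
case: N Pp Plt Pp' Plt' P'f pp plt => [|N] _ _ _ _ _ pp plt //; rewrite ltnS.
have [sub /existsNP[x /not_implyP[p1x np0x]]] := plt 0%N isT.
apply: (IH N (fun i => p i.+1) x (ltnW en)) => [i iN|i iN||].
- exact: pp.
- exact: plt.
- exact: p1x.
- apply: contra_notN np0x => /eqP ->.
  by have [_ [p0 _] _ _ _] := pp 0%N isT.
Qed.

End DimensionBound.

(** * The Krull dimension of R *)

Section KrullDimension.
Variables (k : closedFieldType) (char2 : 2%N \in [pchar k]) (alpha : k).
Local Notation G5 := (G5 alpha).
Local Notation piR := (@piR k alpha).
Implicit Types (f h : fps 5 k).

(** A chain in R is a chain of primes of k[[x, y, z, u, v]] containing G. *)
Lemma prime_chain_R_le n : prime_chain (R_ alpha) n -> (n <= 4)%N.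
Proof.
move=> [P [Pp Plt]].
pose P' i : set (fps 5 k) := [set f | P i (piR f)].
have S5 f : f \in vars_lt 5.
  by apply/vars_ltP => m /existsP[i]; rewrite leqNgt ltn_ord.
rewrite -ltnS; apply: (@prime_chain_bound 5 k 5 n P' G5) => //.
- move=> i /Pp[[P0 PD PM] P1 Pr]; split => //.
  + by split; rewrite /P' /= ?rmorph0 ?rmorph1.
  + by move=> x y hx hy; rewrite /P' /= rmorphD; apply: PD.
  + by move=> a x _ hx; rewrite /P' /= rmorphM; apply: PM.
  + by move=> x y _ _; rewrite /P' /= rmorphM; apply: Pr.
- move=> i /Plt[sub nsub]; split=> [f|h]; first exact: sub.
  by apply: nsub => x; have [f <-] := piR_surj x; apply: h.
- rewrite /P' /= (_ : piR G5 = piR 0).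
    by rewrite rmorph0; have [[]] := Pp 0%N isT.
  by apply/piR_eq; exists 1; rewrite subr0 mul1r.
- exact: G5_neq0.
Qed.

Local Notation X i := ('X_(inord i%N) : {mpoly k[5]}).

(** On the chart x = u x', y = u y', z = u z' of a blowup the equation can be
    solved for v, so R maps to a power series ring in u, x', y', z'. *)
Definition chart : 5.-tuple {mpoly k[5]} :=
  [tuple if (i < 3)%N then X 3 * 'X_i else if (i == 3 :> nat) then X 3
         else X 3 ^+ 3 * g_form alpha%:MP (X 0) (X 1) (X 2) | i < 5].

(** Sends the first t of the variables x', y', z', u to 0. *)
Definition kill (t : nat) : 5.-tuple {mpoly k[5]} :=
  [tuple if (i < t)%N then 0 else 'X_i | i < 5].

Lemma X_coef0 (i : 'I_5) : ('X_i : {mpoly k[5]})@_0%MM = 0.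
Proof. by rewrite mcoeffX mnm1_eq0. Qed.

Lemma mcoeff0M (p r : {mpoly k[5]}) : (p * r)@_0%MM = p@_0%MM * r@_0%MM.
Proof. exact: rmorphM. Qed.

Lemma chart0 i : (tnth chart i)@_0%MM = 0.
Proof.
rewrite tnth_mktuple; case: ifP => _; first by rewrite mcoeff0M X_coef0 mul0r.
case: ifP => _; first exact: X_coef0.
by rewrite exprS -mulrA mcoeff0M X_coef0 mul0r.
Qed.

Lemma kill0 t i : (tnth (kill t) i)@_0%MM = 0.
Proof. by rewrite tnth_mktuple; case: ifP; rewrite ?mcoeff0 ?X_coef0. Qed.

Lemma tnth_chart (j : nat) : (j < 5)%N -> tnth chart (inord j) =
  if (j < 3)%N then X 3 * X j else if j == 3 then X 3
  else X 3 ^+ 3 * g_form alpha%:MP (X 0) (X 1) (X 2).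
Proof. by move=> j5; rewrite tnth_mktuple inordK. Qed.

Lemma subst_chart_G5 : subst chart G5 = 0.
Proof.
rewrite subst_poly; last exact: chart0.
have -> : G alpha = X 3 * X 4 + g_form alpha%:MP (X 0) (X 1) (X 2).
  by rewrite /G -mul_mpolyC /g_form -!addrA.
rewrite rmorphD rmorphM g_form_rmorph /= comp_mpolyC !comp_XU !tnth_chart //=.
rewrite (_ : _ + _ = 2%:R * (X 3 ^+ 4 * g_form alpha%:MP (X 0) (X 1) (X 2))); last first.
  rewrite /g_form; ring.
have /andP[_ /eqP ->] : 2%N \in [pchar {mpoly k[5]}] by apply: mpoly_pchar.
by rewrite mul0r rmorph0.
Qed.

Lemma subst_kill_kill s t f : (s <= t)%N -> subst (kill t) (subst (kill s) f) = subst (kill t) f.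
Proof.
move=> st; rewrite subst_subst; [|exact: kill0|exact: kill0].
congr (subst _ f); apply: eq_from_tnth => i; rewrite !tnth_mktuple.
case: ifP => is_; last by rewrite comp_XU tnth_mktuple.
by rewrite raddf0 (leq_trans is_ st).
Qed.

(** The kernels of the chart followed by killing successively x', y', z', u are
    primes, as the target is a domain; the images of x, y, z, u in turn show that
    the inclusions are strict. *)
Lemma prime_chain_R4 : prime_chain (R_ alpha) 4.
Proof.
pose phi t f := subst (kill t) (subst chart f).
have phi0 t : phi t 0 = 0.
  by rewrite /phi !subst0 //; [exact: kill0|exact: chart0].
have phiD t f h : phi t (f + h) = phi t f + phi t h.
  by rewrite /phi !substD //; [exact: kill0|exact: chart0].
have phiM t f h : phi t (f * h) = phi t f * phi t h.
  by rewrite /phi !substM //; [exact: kill0|exact: chart0].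
have phiG t f : phi t (f * G5) = 0.
  by rewrite /phi substM ?subst_chart_G5 ?mulr0 ?subst0 //; [exact: kill0|exact: chart0].
pose P t : set (R_ alpha) := [set x | exists2 f, piR f = x & phi t f = 0].
have PE t f : P t (piR f) <-> phi t f = 0.
  split=> [[h /piR_eq[c hE] h0]|h0]; last by exists f.
  have : phi t h = phi t (c * G5) + phi t f by rewrite -phiD -hE subrK.
  by rewrite phiG add0r h0 => /esym.
have phiS t f : phi t.+1 f = subst (kill t.+1) (phi t f).
  exact: esym (subst_kill_kill _ (leqnSn t)).
have phiX t j : (j < 5)%N ->
    phi t (fps_of_mpoly (X j)) = fps_of_mpoly (tnth chart (inord j) \mPo kill t).
  by move=> j5; rewrite /phi subst_X ?subst_poly //; [exact: kill0|exact: chart0].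
have killX t j : (j < 5)%N -> X j \mPo kill t = if (j < t)%N then 0 else X j.
  by move=> j5; rewrite comp_XU tnth_mktuple inordK.
have X_neq0 j : X j != 0.
  apply/eqP => /(congr1 (mcoeff U_(inord j))) /eqP.
  by rewrite mcoeffX eqxx mcoeff0 oner_eq0.
have phiXt t : (t < 4)%N -> phi t (fps_of_mpoly (X t)) != 0.
  move=> t4; have t5 : (t < 5)%N := leqW t4.
  rewrite phiX // tnth_chart //.
  have of_neq0 (p : {mpoly k[5]}) : p != 0 -> fps_of_mpoly p != 0.
    apply: contraNN => /eqP p0; apply/eqP/mpolyP => m.
    by rewrite mcoeff0 -fps_of_mpolyE p0.
  apply: of_neq0; case: (ltnP t 3) => t3.
    rewrite rmorphM /= (killX t 3) // (killX t t) // ltnn ltnNge.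
    by rewrite (ltnW t3) mulf_neq0.
  have -> : t = 3 by lia.
  by rewrite eqxx killX // ltnn.
have phiXS t : (t < 4)%N -> phi t.+1 (fps_of_mpoly (X t)) = 0.
  move=> t4; have t5 : (t < 5)%N := leqW t4.
  rewrite phiX // tnth_chart //.
  case: (ltnP t 3) => t3.
    by rewrite rmorphM /= (killX t.+1 t) // ltnSn mulr0 rmorph0.
  have -> : t = 3 by lia.
  by rewrite eqxx killX // rmorph0.
exists P; split=> t t4.
  split; first split.
  - by exists 0; [exact: rmorph0|exact: phi0].
  - by move=> _ _ [f <- f0] [h <- h0]; exists (f + h);
      [exact: rmorphD|rewrite phiD f0 h0; exact: addr0].
  - move=> a _ [f <- f0]; have [h <-] := piR_surj a.
    by exists (h * f); [exact: rmorphM|rewrite phiM f0; exact: mulr0].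
  - rewrite -(rmorph1 piR) PE /phi (subst1 chart0) (subst1 (kill0 t)).
    by move=> /eqP; rewrite oner_eq0.
  - move=> x y; have [f <-] := piR_surj x; have [h <-] := piR_surj y.
    rewrite -rmorphM !PE phiM => fh0.
    case: (eqVneq (phi t f) 0) => [|f0]; first by left.
    case: (eqVneq (phi t h) 0) => [|h0]; first by right.
    by have := fps_mulf_neq0 f0 h0; rewrite fh0 eqxx.
split=> [_ [f <- f0]|].
  apply/PE; rewrite phiS f0; exact: subst0 (kill0 _).
move=> /(_ (piR (fps_of_mpoly (X t)))); rewrite !PE phiXS // => /(_ erefl).
by apply/eqP/phiXt.
Qed.

Lemma krull_dim_R : has_krull_dim (R_ alpha) 4.
Proof. by split; [exact: prime_chain_R4|exact: prime_chain_R_le]. Qed.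

End KrullDimension.

(** * The sum of the brackets *)

(** The elements f(n, j) are all of the form s + c C with s a single symbol A_n
    or B_n, or 0; a state records s and c. *)
Section BracketSum.
Variables (m : nat) (P : bool).

Definition state := (option bool * nat)%type.

Definition state_elt (n : nat) (s : state) : Gamma :=
  (match s.1 with
   | None => 0
   | Some b => << if b then GB n else GA n >>
   end + << GC >> *+ s.2)%R.

Definition step (i : bool) (n : nat) (s : state) : state :=
  let parity := if i then ~~ P else P in
  match s.1 with
  | None => s
  | Some false => (Some ((m %| n.+1)%N && (odd (n.+1 %/ m) == parity)), s.2)
  | Some true => if (m %| n)%N && (odd (n %/ m) == parity) then (None, s.2)
                 else (Some false, s.2.+1)
  end.

Fixpoint state_of (n j : nat) : state :=
  if n is n'.+1 then
    if n' is 0 then (if odd j then None else Some false, 2)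
    else step (odd j) n' (state_of n' j./2)
  else (None, 2).

Fact sigmaB i : {morph sigma m P i : x y / x - y}.
Proof. exact: lift_is_additive. Qed.

Fact sigma0 i : sigma m P i 0 = 0.
Proof. by have := sigmaB i 0 0; rewrite !subrr. Qed.

Fact sigmaD i : {morph sigma m P i : x y / x + y}.
Proof.
move=> x y; have -> : x + y = x - (0 - y) by rewrite sub0r opprK.
by rewrite !sigmaB sigma0 sub0r opprK.
Qed.

Lemma sigmaC i c : sigma m P i (<< GC >> *+ c) = << GC >> *+ c.
Proof.
elim: c => [|c IH]; first by rewrite !mulr0n sigma0.
by rewrite !mulrS sigmaD IH /sigma liftU scale1r.
Qed.

Lemma sigma_elt i n s : sigma m P i (state_elt n s) = state_elt n.+1 (step i n s).
Proof.
case: s => [[[]|] c]; rewrite /state_elt /= sigmaD sigmaC ?sigma0 //.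
- rewrite /sigma liftU scale1r /step /=; case: ifP => _ //=.
  by rewrite mulrS addrA.
- rewrite /sigma liftU scale1r /step /=.
  by case: ifP.
Qed.

Lemma bracket_eltE n j : (0 < n)%N -> bracket_elt m P n j = state_elt n (state_of n j).
Proof.
elim: n j => // n IH j _; case: n IH => [|n] IH.
  rewrite /= sigmaD sigmaC /sigma liftU scale1r /state_elt /= addrC.
  by case: (odd j).
by rewrite -sigma_elt -IH.
Qed.

Definition weightA (s : state) : nat := (if s.1 == Some false then 2 ^ s.2 else 0)%N.
Definition weightB (s : state) : nat := (if s.1 == Some true then 2 ^ s.2 else 0)%N.

Lemma coeff_elt n s x : coeff x (state_elt n s) =
  match s.1 with None => 0 | Some b => ((if b then GB n else GA n) == x)%:R end
  + (GC == x)%:R *+ s.2.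
Proof.
rewrite /state_elt coeffD coeffMn coeffU mul1r; congr (_ + _).
by case: s.1 => [b|]; rewrite ?coeff0 // coeffU mul1r.
Qed.

Lemma elt_value n s :
  (3 * coeff (GA n) (state_elt n s) + 5 * coeff (GB n) (state_elt n s) + coeff GD (state_elt n s))%:~R
    * 2 ^ coeff GC (state_elt n s) = (3 * weightA s + 5 * weightB s)%N%:R :> rat.
Proof.
have eqE (x y : gamma_symbol) : (x == y) = (gamma_symbol_code x == gamma_symbol_code y).
  by rewrite (can_eq gamma_symbol_codeK).
rewrite !coeff_elt !eqE /= !mul0rn !addr0.
have c2 c : 2 ^ ((1 : int) *+ c) = (2 ^ c)%:R :> rat.
  by rewrite -mulr_natr mul1r natz -exprnP natrX.
case: s => [[[]|] c]; rewrite /weightA /weightB /= ?eqE /=.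
- by rewrite eqxx !mulr0 mulr1 !add0r addr0 c2 muln0 add0n natrM.
- by rewrite eqxx !mulr0 mulr1 add0r !addr0 c2 muln0 addn0 natrM.
- by rewrite !mulr0 !addr0 mul0r !muln0.
Qed.

Hypothesis m_ge2 : (2 <= m)%N.

Definition totA n := (\sum_(j < 2 ^ n) weightA (state_of n j))%N.
Definition totB n := (\sum_(j < 2 ^ n) weightB (state_of n j))%N.

Lemma sum_halves n (F : nat -> nat) :
  (\sum_(j < 2 ^ n.+1) F j = \sum_(j < 2 ^ n) (F j.*2 + F j.*2.+1))%N.
Proof.
rewrite expnS mul2n -(big_mkord xpredT F) -(big_mkord xpredT (fun j => F j.*2 + F j.*2.+1)%N).
elim: (2 ^ n)%N => [|N IH]; first by rewrite !big_geq.
by rewrite doubleS !big_nat_recr //= IH addnA.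
Qed.

(** Where m divides the index, one of sigma_0 and sigma_1 is exceptional and the
    other is not, whatever the parity P; so the totals of 2^c over the states of
    each kind obey a linear recursion. As m >= 2, no state B follows a state B. *)
Lemma totals n : (0 < n)%N ->
  totA n = (if m %| n then 2 ^ n else 2 ^ n.+1)%N /\
  totB n = (if m %| n then 2 ^ n else 0)%N.
Proof.
elim: n => // n IH _; case: n IH => [_|n /(_ isT)[IA IB]].
  rewrite /totA /totB !big_ord_recl !big_ord0 /= dvdn1.
  by rewrite (_ : (m == 1%N) = false) //; apply/eqP => m1; have := m_ge2; rewrite m1.
have stepA s N : (weightA (step false N s) + weightA (step true N s) =
    (if m %| N.+1 then 1 else 2) * weightA s + (if m %| N then 2 else 4) * weightB s)%N.
  case: s => [[[]|] c]; rewrite /step /weightA /weightB /=.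
  - by case: (m %| N)%N; case: (odd _); case: P => //=; rewrite !expnS; lia.
  - by case: (m %| N.+1)%N; case: (odd _); case: P => //=; lia.
  - by rewrite !muln0.
have stepB s N : (weightB (step false N s) + weightB (step true N s) =
    (if m %| N.+1 then 1 else 0) * weightA s)%N.
  case: s => [[[]|] c]; rewrite /step /weightA /weightB /=.
  - by case: (m %| N)%N; case: (odd _); case: P => //=; rewrite !muln0.
  - by case: (m %| N.+1)%N; case: (odd _); case: P => //=; lia.
  - by rewrite !muln0.
have stateS N j (b : bool) : state_of N.+2 (b + j.*2) = step b N.+1 (state_of N.+1 j).
  by rewrite [LHS]/= half_bit_double oddD odd_double addbF; case: b.
have AS : totA n.+2 = ((if m %| n.+2 then 1 else 2) * totA n.+1 +
    (if m %| n.+1 then 2 else 4) * totB n.+1)%N.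
  rewrite /totA /totB (sum_halves n.+1 (fun j => weightA (state_of n.+2 j))).
  rewrite !big_distrr /= -big_split /=; apply: eq_bigr => j _.
  by rewrite -stepA -(stateS n j false) -(stateS n j true).
have BS : totB n.+2 = ((if m %| n.+2 then 1 else 0) * totA n.+1)%N.
  rewrite /totA /totB (sum_halves n.+1 (fun j => weightB (state_of n.+2 j))).
  rewrite !big_distrr /=; apply: eq_bigr => j _.
  by rewrite -stepB -(stateS n j false) -(stateS n j true).
rewrite AS BS IA IB; case: (boolP (m %| n.+1)%N) => mn.
  have -> : (m %| n.+2)%N = false.
    apply/negP => mn2; have := dvdn_sub mn2 mn; rewrite subSnn dvdn1 => /eqP m1.
    by have := m_ge2; rewrite m1.
  by rewrite !expnS; split; lia.
by case: (m %| n.+2)%N; rewrite !expnS; split; lia.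
Qed.

End BracketSum.

Lemma sum_bracket (k : fieldType) (char2 : 2%N \in [pchar k]) (alpha : k) n :
  (0 < n)%N -> (2 <= m_ char2 alpha)%N ->
  \sum_(j < 2 ^ n) bracket char2 n j alpha =
  (6 * 2 ^ n + if m_ char2 alpha %| n then 2 * 2 ^ n else 0)%N%:R.
Proof.
move=> n0 m2; rewrite /bracket; set m := m_ char2 alpha; set P := (_ == _).
have [tA tB] := totals P m2 n0.
under eq_bigr do rewrite bracket_eltE // elt_value.
rewrite -natr_sum big_split /= -!big_distrr /= -/(totA m P n) -/(totB m P n) tA tB.
by congr _%:R; case: ifP => _; rewrite ?expnS; lia.
Qed.

(** * The recursion for the lengths *)

Section Lengths.
Variables (k : closedFieldType) (char2 : 2%N \in [pchar k]) (alpha : k).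
Local Notation E n i := (e_ n (g alpha ^+ i)).

Lemma e_Jq n (f : {mpoly k[3]}) : Jq (2 ^ n) (fps_of_mpoly f) -> e_ n f = ((2 ^ n) ^ 3)%N.
Proof.
move=> fJ; rewrite e_E -[in RHS](dim_boxV 3 k n); congr (\dim _).
apply/vspaceP => w; rewrite memvf memv_ker -[w]tau_ext act_tau mulrC.
by apply/eqP/tau_eq0/JqM.
Qed.

Lemma x3_coef0 j : (x3 k j) 0%MM = 0.
Proof. by rewrite /x3 fps_of_mpolyE mcoeffX mnm1_eq0. Qed.

(** Every monomial of g is divisible by the square of a variable. *)
Lemma g3_Jq2 : Jq (2 ^ 1) (g3 alpha).
Proof.
have sq j : Jq (2 ^ 1) (x3 k j ^+ (2 ^ 1)) by apply: (Jq_frob char2); apply: x3_coef0.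
rewrite g3E; set x := x3 k 0; set y := x3 k 1; set z := x3 k 2; set d := fpsC _.
have -> : g_form d x y z = (d * y ^+ 2 + x * z) * x ^+ 2 + (y * z) * y ^+ 2 + (z ^+ 2 + x * y) * z ^+ 2.
  by rewrite /g_form; ring.
by apply: JqD; [apply: JqD|]; apply: JqM; apply: sq.
Qed.

Lemma g3_coef0 : (g3 alpha) 0%MM = 0.
Proof. by apply: g3_Jq2 => i; rewrite mnm0E. Qed.

Lemma e_g_full n : E n (2 ^ n) = ((2 ^ n) ^ 3)%N.
Proof.
apply: e_Jq; rewrite rmorphXn; apply: (Jq_frob char2); exact: g3_coef0.
Qed.

Lemma e_g0 n : E n 0 = 0%N.
Proof.
rewrite e_gX; apply/eqP; rewrite dimv_eq0 -subv0; apply/subvP => v.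
by rewrite memv_ker g_act0 memv0.
Qed.

Lemma e_g_double n j : E n.+1 j.*2 = (8 * E n j)%N.
Proof. by rewrite -mul2n mulnC exprM (e_sqr char2). Qed.

(** The length of R / m^[q] for q = 2^n, written as a trapezoidal sum in order
    that the brackets appear as its defects of linearity. *)
Definition hk_len n := (\sum_(i < 2 ^ n) (E n i + E n i.+1))%N.

Lemma hk_lenE n Q : (Q.+1 = 2 ^ n)%N ->
  hk_len n = (E n Q.+1 + 2 * \sum_(s < Q) E n s.+1)%N.
Proof.
move=> Qq; rewrite /hk_len -Qq big_split /= big_ord_recl e_g0 add0n.
rewrite [X in (_ + X)%N]big_ord_recr /= mul2n -addnn.
under eq_bigr do rewrite /bump /= add1n.
by rewrite addnA addnC.
Qed.

Lemma hk_len_ker n : hk_len n = \dim (lker (act n (G5 alpha))).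
Proof.
have Qq : ((2 ^ n).-1.+1 = 2 ^ n)%N by rewrite prednK ?expn_gt0.
by rewrite (dim_ker_G5 char2 alpha Qq) (hk_lenE Qq).
Qed.

(** The finite form of s = 2 - eHK: on the edge, the rank of g^i and its corank
    add up to q^3. *)
Lemma hk_len_img n Q : (Q.+1 = 2 ^ n)%N ->
  (hk_len n + \dim (limg (act n (G5 alpha ^+ Q))) = 2 * (2 ^ n) ^ 4)%N.
Proof.
move=> Qq; rewrite (dim_img_G5 char2 alpha Qq) (hk_lenE Qq).
have r i : (\dim (limg (g_act alpha n i)) + E n i = (2 ^ n) ^ 3)%N.
  by rewrite e_gX rank_act.
have -> : (\sum_(s < Q) \dim (limg (g_act alpha n (Q - s))) =
    \sum_(s < Q) \dim (limg (g_act alpha n s.+1)))%N.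
  by rewrite (reindex_inj rev_ord_inj); apply: eq_bigr => s _; rewrite /= subKn.
have -> : (\dim (limg (g_act alpha n 0)) = (2 ^ n) ^ 3)%N by rewrite -(r 0%N) e_g0 addn0.
rewrite {1}Qq e_g_full.
have : (\sum_(s < Q) E n s.+1 + \sum_(s < Q) \dim (limg (g_act alpha n s.+1)) = Q * (2 ^ n) ^ 3)%N.
  rewrite -big_split /= -[Q in RHS]card_ord -sum_nat_const; apply: eq_bigr => s _.
  by rewrite addnC r.
set a := (\sum_(s < Q) E n _)%N; set b := (\sum_(s < Q) \dim _)%N.
move: a b => a b; rewrite -Qq (expnS _ 3); set c := (Q.+1 ^ 3)%N; nia.
Qed.

Lemma hk_len1 : hk_len 1 = 24%N.
Proof.
rewrite /hk_len !big_ord_recl big_ord0 /= /bump /= e_g0 (e_g_full 1).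
by rewrite (e_Jq (n := 1) (f := g alpha ^+ 1)) // expr1; exact: g3_Jq2.
Qed.

(** Doubling the number of nodes: at even nodes the values are multiplied by 8,
    at odd nodes they differ from the mean of their neighbours by a bracket. *)
Lemma hk_lenS n :
  (forall j, (j < 2 ^ n)%N -> bracket char2 n j alpha =
       (E n.+1 (2 * j + 1))%:R - 2^-1 * ((E n.+1 (2 * j))%:R + (E n.+1 (2 * j + 2))%:R)) ->
  (0 < n)%N -> (2 <= m_ char2 alpha)%N ->
  hk_len n.+1 = (16 * hk_len n + (12 * 2 ^ n + if m_ char2 alpha %| n then 4 * 2 ^ n else 0))%N.
Proof.
move=> bE n0 m2; apply/eqP; rewrite -(eqr_nat rat) natrD natrM.
have -> : ((12 * 2 ^ n + if m_ char2 alpha %| n then 4 * 2 ^ n else 0)%N%:R : rat) =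
    2 * \sum_(j < 2 ^ n) bracket char2 n j alpha.
  rewrite sum_bracket // -[2 * _]natrM; congr _%:R; case: ifP => _; lia.
rewrite /hk_len (sum_halves n (fun i => E n.+1 i + E n.+1 i.+1)%N) !natr_sum !mulr_sumr -big_split /=.
apply/eqP/eq_bigr => j _; rewrite bE // addn1 addn2 mul2n -doubleS !e_g_double.
have natrD4 (a b c d : nat) : (a + b + (c + d))%N%:R = a%:R + b%:R + (c%:R + d%:R) :> rat.
  by rewrite !natrD.
by rewrite natrD4 natrD !natrM; field.
Qed.

End Lengths.

(** * Limits *)

Import numFieldNormedType.Exports.

(** The recursion for the lengths telescopes to a sum of two geometric series,
    of ratios 1/8 and 1/8^m, whose remainders are explicit; c is n/m rounded up. *)
Lemma normalised_remainder (R : realType) (l : nat -> nat) (m n : nat) :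
  (2 <= m)%N -> l 1%N = 24%N ->
  (forall n, (0 < n)%N ->
     l n.+1 = (16 * l n + (12 * 2 ^ n + if m %| n then 4 * 2 ^ n else 0))%N) ->
  (0 < n)%N ->
  exists c : nat, [/\ (n <= c * m)%N, (c * m < n + m)%N &
   (l n)%:R / (2 ^ (n * 4))%:R =
   (45 * 2 ^+ (3 * m) - 38) / (7 * 2 ^+ (3 * m + 2) - 28)
   - (6 / 7 / 8 ^+ n + 4^-1 * (8 ^+ m / (8 ^+ m - 1)) / 8 ^+ (c * m)) :> R].
Proof.
move=> m2 l1 lS; have N8 : 1 < 8 ^+ m :> R by rewrite exprn_egt1 ?ltr1n //; lia.
have NE : 2 ^+ (3 * m) = 8 ^+ m :> R by rewrite exprM -natrX.
have NE2 : 2 ^+ (3 * m + 2) = 4 * 8 ^+ m :> R.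
  by rewrite exprD NE mulrC -natrX.
rewrite NE NE2; set N := 8 ^+ m in N8 *.
have N1 : N - 1 != 0 by rewrite subr_eq0 gt_eqF.
have N0 : N != 0 by rewrite gt_eqF // (lt_trans _ N8).
have N28 : 7 * (4 * N) - 28 != 0.
  by rewrite (_ : _ - _ = 28 * (N - 1)); [rewrite mulf_neq0 // pnatr_eq0|ring].
elim: n => // n IH _; case: n IH => [_|n /(_ isT)[c [nc cn lE]]].
  exists 1%N; split; [by lia|by lia|].
  rewrite l1 (mul1n m) -/N expr1 (_ : (2 ^ (1 * 4) = 16)%N) //; field.
  by rewrite N0 N1 N28.
have q0 : 8 ^+ n.+1 != 0 :> R by rewrite expf_neq0 // pnatr_eq0.
have dE : (2 ^ (n.+2 * 4))%:R = 16 * (2 ^ (n.+1 * 4))%:R :> R.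
  by rewrite -natrM mulSn expnD.
have d2 : (2 ^ (n.+1 * 4))%:R = 8 ^+ n.+1 * (2 ^ n.+1)%:R :> R.
  rewrite mulnC expnM -natrX -[8%N]/(2 ^ 3)%N -!expnM -natrM -expnD.
  by congr (_ ^ _)%:R; lia.
have t0 : (2 ^ n.+1)%:R != 0 :> R by rewrite pnatr_eq0 expn_eq0.
have d0 : (2 ^ (n.+1 * 4))%:R != 0 :> R by rewrite pnatr_eq0 expn_eq0.
have step : (l n.+2)%:R / (2 ^ (n.+2 * 4))%:R = (l n.+1)%:R / (2 ^ (n.+1 * 4))%:R +
   (3 / 4 + if (m %| n.+1)%N then 4^-1 else 0) / 8 ^+ n.+1 :> R.
  have natE (a b c' : nat) : (16 * a + (12 * b + c'))%N%:R = 16 * a%:R + (12 * b%:R + c'%:R) :> R.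
    by rewrite natrD natrM (natrD _ (12 * b)%N) natrM.
  rewrite lS // dE natE.
  have -> : ((if (m %| n.+1)%N then 4 * 2 ^ n.+1 else 0)%N%:R : R) =
    (if (m %| n.+1)%N then 4 else 0) * (2 ^ n.+1)%:R.
    by case: ifP => _; rewrite ?natrM ?mul0r.
  rewrite d2; case: ifP => _; field; by rewrite t0 q0.
rewrite step lE; case: (boolP (m %| n.+1)%N) => mn.
  have cE : (c * m = n.+1)%N.
    have /dvdnP[d dE'] := mn; rewrite [RHS]dE'; have : (d <= c)%N by rewrite -(leq_pmul2r (m := m)) ?(ltnW m2) // -dE'.
    have : (c < d.+1)%N by rewrite -(ltn_pmul2r (m := m)) ?(ltnW m2) // mulSn -dE' addnC.
    by move=> h1 h2; have <- : c = d by lia.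
  exists c.+1; rewrite mulSn cE; split; [by lia|by lia|].
  rewrite exprD -/N (exprS _ n.+1); field.
  by rewrite N0 N1 N28 q0.
exists c; split; [|by lia|].
  by rewrite ltn_neqAle nc andbT; apply: contraNneq mn => ->; apply: dvdn_mull.
rewrite (exprS _ n.+1); field.
by rewrite N1 N28 q0 expf_neq0 // pnatr_eq0.
Qed.

Lemma normalised_limit (R : realType) (l : nat -> nat) (m : nat) :
  (2 <= m)%N -> l 1%N = 24%N ->
  (forall n, (0 < n)%N ->
     l n.+1 = (16 * l n + (12 * 2 ^ n + if m %| n then 4 * 2 ^ n else 0))%N) ->
  (fun n => (l n)%:R / (2 ^ (n * 4))%:R : R) @ \oo -->
   ((45 * 2 ^+ (3 * m) - 38) / (7 * 2 ^+ (3 * m + 2) - 28) : R).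
Proof.
move=> m2 l1 lS; set L := (X in _ --> X).
pose C : R := 6 / 7 + 4^-1 * (8 ^+ m / (8 ^+ m - 1)).
have N8 : 1 < 8 ^+ m :> R by rewrite exprn_egt1 ?ltr1n //; lia.
have C0 : 0 <= 4^-1 * (8 ^+ m / (8 ^+ m - 1)) :> R.
  by rewrite mulr_ge0 ?invr_ge0 // divr_ge0 ?exprn_ge0 // subr_ge0 ltW.
apply: (@squeeze_cvgr _ _ _ _ (fun n => L - C * 8^-1 ^+ n) (fun=> L)).
- exists 1%N => // n /= n1.
  have [c [nc _ ->]] := normalised_remainder R m2 l1 lS n1.
  have p0 j : 0 < 8 ^+ j :> R by rewrite exprn_gt0.
  apply/andP; split.
    rewrite lerD2l lerN2 /C exprVn [X in _ <= X]mulrDl lerD2l ler_wpM2l //.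
    by rewrite lef_pV2 ?posrE // ler_eXn2l // ltr1n.
  by rewrite gerBl addr_ge0 ?divr_ge0 ?ler0n // ltW.
- rewrite -[X in _ --> X]subr0 -[X in _ --> _ - X](mulr0 C).
  apply: cvgB; first exact: cvg_cst.
  apply: cvgM; first exact: cvg_cst.
  apply: cvg_expr; rewrite ger0_norm ?invr_ge0 // invf_lt1 // ltr1n //.
- exact: cvg_cst.
Qed.

(** * The two invariants *)

Section Limits.
Variables (rT : realType) (k : closedFieldType) (char2 : 2%N \in [pchar k]) (alpha : k).

Lemma quot_length_frobenius_power e :
  quot_length rT (frobenius_power (@max_ideal (R_ alpha)) (2 ^ e)) =
  ((hk_len alpha e)%:R)%:E.
Proof.
rewrite (quot_length_dim rT (pi := @piR k alpha) isT (@piR_surj k alpha)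
  (ideal_gen_ideal _) (frobenius_power_piR char2 alpha e)).
rewrite dim_boxV -(rank_act e (G5 alpha)) addKn (hk_len_ker char2) //.
Qed.

Lemma quot_length_splitting_ideal e :
  quot_length rT (splitting_ideal (R_pchar alpha char2) e) =
  ((2 * (2 ^ e) ^ 4 - hk_len alpha e)%N%:R)%:E.
Proof.
have Qq : ((2 ^ e).-1.+1 = 2 ^ e)%N by rewrite prednK ?expn_gt0.
have IU := splitting_ideal_piR char2 alpha Qq.
rewrite (quot_length_dim rT (pi := @piR k alpha) isT (@piR_surj k alpha)
  (stable_is_ideal (@stable_lker k e _) IU) IU).
by rewrite dim_boxV -(rank_act e (G5 alpha ^+ (2 ^ e).-1)) addnK -(hk_len_img char2 alpha Qq) addKn.
Qed.

Lemma hk_len_le e : (hk_len alpha e <= 2 * (2 ^ e) ^ 4)%N.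
Proof.
have Qq : ((2 ^ e).-1.+1 = 2 ^ e)%N by rewrite prednK ?expn_gt0.
by rewrite -(hk_len_img char2 alpha Qq) leq_addr.
Qed.

Lemma cvg_real_ereal (u : nat -> rT) (c : rT) :
  u @ \oo --> c -> (fun n => (u n)%:E) @ \oo --> c%:E.
Proof. by move=> uc; apply: cvg_EFin => //; near=> n. Unshelve. all: by end_near. Qed.

End Limits.

Theorem theoremA (rT : realType) (k : closedFieldType)
  (char2 : 2%N \in [pchar k])
  (algk : forall x : k, algebraicOver (in_alg (pPrimeCharType char2)) x)
  (bracketE : forall (alpha : k) (n j : nat),
     alpha != 0 -> (1 <= n)%N -> (j < 2 ^ n)%N ->
     bracket char2 n j alpha =
       (e_ n.+1 (g alpha ^+ (2 * j + 1)))%:R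
       - 2^-1 * ((e_ n.+1 (g alpha ^+ (2 * j)))%:R
                 + (e_ n.+1 (g alpha ^+ (2 * j + 2)))%:R))
  (alpha : k) (alpha_neq0 : alpha != 0) (m_ge2 : (2 <= m_ char2 alpha)%N) :
  has_eHK (R_ alpha) 2
    ((45 * 2 ^+ (3 * m_ char2 alpha) - 38)
       / (7 * 2 ^+ (3 * m_ char2 alpha + 2) - 28) : rT) /\
  has_F_signature (R_pchar alpha char2)
    ((11 * 2 ^+ (3 * m_ char2 alpha) - 18)
       / (7 * 2 ^+ (3 * m_ char2 alpha + 2) - 28) : rT).
Proof.
set m := m_ char2 alpha in m_ge2 *.
have lim := @normalised_limit rT (hk_len alpha) m m_ge2 (hk_len1 char2 alpha)
  (fun n n0 => hk_lenS (fun j => bracketE alpha n j alpha_neq0 n0) n0 m_ge2).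
split; exists 4%N; try exact: (krull_dim_R char2).
  under eq_fun do rewrite quot_length_frobenius_power // -EFinM.
  exact: cvg_real_ereal.
under eq_fun do rewrite quot_length_splitting_ideal // -EFinM.
apply: cvg_real_ereal.
have -> : (fun n => (2 * (2 ^ n) ^ 4 - hk_len alpha n)%:R / (2 ^ (n * 4))%:R) =
    (fun n => 2 - (hk_len alpha n)%:R / (2 ^ (n * 4))%:R) :> (nat -> rT).
  apply/funext => n; rewrite natrB ?(hk_len_le char2) // mulrBl natrM -expnM mulfK //.
have -> : (11 * 2 ^+ (3 * m) - 18) / (7 * 2 ^+ (3 * m + 2) - 28) =
    2 - (45 * 2 ^+ (3 * m) - 38) / (7 * 2 ^+ (3 * m + 2) - 28) :> rT.
  have N1 : 1 < 2 ^+ (3 * m) :> rT by rewrite exprn_egt1 ?ltr1n //; lia.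
  have -> : 2 ^+ (3 * m + 2) = 4 * 2 ^+ (3 * m) :> rT by rewrite exprD mulrC -natrX.
  move: (2 ^+ (3 * m)) N1 => N N1; field.
  by rewrite gt_eqF //; lra.
by apply: cvgB; [exact: cvg_cst|exact: lim].
Qed.
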